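(* Let $M$ be a partial multiplication matrix whose row-column graph $G_M$ is a cycle, and let $\mathcal{C}\subseteq\mathsf{Grid}(M)$ be a permutation class. Then $\mathcal{C}$ is well quasi-ordered (under containment) if and only if $\mathcal{C}$ contains only finitely many end-inflated $M$-coils.
   Context: Permutations are identified with their plots; $\sigma\le\pi$ if $\pi$ has a subsequence order-isomorphic to $\sigma$. A permutation class is a containment-closed set. A set of permutations is well quasi-ordered if every infinite sequence $x_1,x_2,\dots$ in it has $i<j$ with $x_i\le x_j$. A gridding matrix has entries in $\{0,1,-1\}$; an $m\times n$ one has $m$ columns, $n$ rows, $M_{ij}$ in column $i$ from the left and row $j$ from the bottom. An $M$-gridding of a permutation $\pi$ of length $L$ is a choice of vertical lines $\tfrac12=v_0\le\dots\le v_m=L+\tfrac12$ and horizontal lines $\tfrac12=h_0\le\dots\le h_n=L+\tfrac12$, not through points of $\pi$, such that in each cell $C_{ij}=\{v_{i-1}<x<v_i,\ h_{j-1}<y<h_j\}$ the points of $\pi$ are absent if $M_{ij}=0$, increasing if $M_{ij}=1$, decreasing if $M_{ij}=-1$; $\pi$ with such a gridding is an $M$-gridded permutation $\pi^\#$, and $\mathsf{Grid}(M)$ is the class of permutations having an $M$-gridding. The row-column graph $G_M$ is the bipartite graph on $\{1,\dots,m\}\cup\{1',\dots,n'\}$ with edge $ij'$ iff $M_{ij}\neq 0$. $M$ is a partial multiplication matrix if there are fixed $c_1,\dots,c_m,r_1,\dots,r_n\in\{\pm1\}$ with $M_{ij}=c_ir_j$ for each non-zero entry. Column $i$ is oriented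 left-to-right if $c_i=1$, right-to-left otherwise; row $j$ bottom-to-top if $r_j=1$, top-to-bottom otherwise. The orientation digraph $D_{\pi^\#}$ has the points of $\pi^\#$ as vertices and $x\to y$ whenever $x,y$ lie in a common column of cells and $x$ precedes $y$ in that column's orientation, or in a common row of cells and $x$ precedes $y$ in that row's orientation. Let $\ell$ be the length of the cycle $G_M$. A gridded $M$-coil is an $M$-gridded permutation of length $n>\ell$ with an ordering $v_1,\dots,v_n$ of its points and a labelling of the $\ell$ non-zero cells by $1,\dots,\ell$ such that (C1) $v_i$ lies in cell $i\bmod\ell$ (residues in $\{1,\dots,\ell\}$); (C2) $v_{i-1}\to v_i$ for $1<i\le n$; (C3) $v_i\to v_{i-\ell-1}$ for $\ell+1<i\le n$; (C4) $v_{\ell+1}\to v_1$. Given a gridded $M$-coil $\mathcal{O}$ with points $v_1,\dots,v_n$, let $\alpha^\#_{\mathcal{O}}$ be obtained by replacing $v_1$ by two points, consecutive in both position and value and in the same cell as $v_1$, forming an increasing pair if that cell's entry is $1$ and a decreasing pair if it is $-1$, and likewise replacing $v_n$. The underlying (ungridded) permutation $\alpha_{\mathcal{O}}$ is called an end-inflated $M$-coil. *)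

(* Defs.v *)
From mathcomp Require Import all_boot all_order all_algebra.
Set Implicit Arguments. Unset Strict Implicit. Unset Printing Implicit Defensive.
Import GRing.Theory Num.Theory.

(* Conventions (0-based).  A permutation of length L is a sequence
   s = [:: s_0; ...; s_{L-1}] which is a rearrangement of 0..L-1; its points
   are (x, s_x) for positions x < L.  *)

Definition is_perm (s : seq nat) : bool := perm_eq s (iota 0 (size s)).

Definition order_iso (s t : seq nat) : Prop :=
  size s = size t /\
  forall i j, i < size s -> j < size s ->
    (nth 0 s i < nth 0 s j) = (nth 0 t i < nth 0 t j).

Definition contains (p sg : seq nat) : Prop :=
  exists msk : bitseq, order_iso sg (mask msk p).

Definition perm_class (C : seq nat -> Prop) : Prop :=
  (forall p, C p -> is_perm p) /\
  (forall p sg, C p -> is_perm sg -> contains p sg -> C sg).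

Definition wqo (C : seq nat -> Prop) : Prop :=
  forall f : nat -> seq nat, (forall k, C (f k)) ->
    exists i j, i < j /\ contains (f j) (f i).

Section Grid.
Local Open Scope ring_scope.
(* M : 'M[int]_(m, n) is a gridding matrix with m columns and n rows;
   M i j is the entry in column i (from the left) and row j (from the bottom),
   0-based. *)
Variables (m n : nat) (M : 'M[int]_(m, n)).

Definition gridding_matrix : Prop :=
  forall i j, M i j = 0 \/ M i j = 1 \/ M i j = -1.

(* A gridding: vertical lines v 0 <= ... <= v m, horizontal lines
   h 0 <= ... <= h n; column i is the set of positions x with
   v i <= x < v (i+1), row j the set of values y with h j <= y < h (j+1). *)
Definition in_col (v : nat -> nat) (i : 'I_m) (x : nat) : bool :=
  (v i <= x < v i.+1)%N.
Definition in_row (s : seq nat) (h : nat -> nat) (j : 'I_n) (x : nat) : bool :=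
  (h j <= nth 0%N s x < h j.+1)%N.
Definition in_cell (s : seq nat) (v h : nat -> nat) (x : nat) (i : 'I_m) (j : 'I_n) :=
  in_col v i x && in_row s h j x.

Definition is_gridding (s : seq nat) (v h : nat -> nat) : Prop :=
  v 0%N = 0%N /\ v m = size s /\ h 0%N = 0%N /\ h n = size s /\
      (forall i, (i < m)%N -> (v i <= v i.+1)%N) /\
      (forall j, (j < n)%N -> (h j <= h j.+1)%N) /\
      forall i j x x', (x < size s)%N -> (x' < size s)%N ->
        in_cell s v h x i j -> in_cell s v h x' i j ->
        [/\ M i j != 0,
            (M i j = 1 -> (x < x')%N -> (nth 0%N s x < nth 0%N s x')%N) &
            (M i j = -1 -> (x < x')%N -> (nth 0%N s x' < nth 0%N s x)%N)].

Definition in_Grid (s : seq nat) : Prop :=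
  is_perm s /\ exists v h, is_gridding s v h.

Definition partial_mult (c : 'I_m -> int) (r : 'I_n -> int) : Prop :=
  (forall i, c i = 1 \/ c i = -1) /\ (forall j, r j = 1 \/ r j = -1) /\
  forall i j, M i j != 0 -> M i j = c i * r j.

Definition rc_edge : rel ('I_m + 'I_n)%type := fun u w =>
  match u, w with
  | inl i, inr j => M i j != 0
  | inr j, inl i => M i j != 0
  | _, _ => false
  end.

Definition rc_is_cycle : Prop :=
  (0 < m + n)%N /\
  (forall u w, connect rc_edge u w) /\
  (forall u, #|[pred w | rc_edge u w]| = 2%N).

(* length of the cycle G_M = number of edges = number of non-zero cells *)
Definition ncells : nat := #|[pred ij : 'I_m * 'I_n | M ij.1 ij.2 != 0]|.

Definition arrow (c : 'I_m -> int) (r : 'I_n -> int)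
    (s : seq nat) (v h : nat -> nat) (x y : nat) : Prop :=
  (exists i, [/\ in_col v i x, in_col v i y &
                 (if c i == 1 then (x < y)%N else (y < x)%N)]) \/
  (exists j, [/\ in_row s h j x, in_row s h j y &
                 (if r j == 1 then (nth 0%N s x < nth 0%N s y)%N
                  else (nth 0%N s y < nth 0%N s x)%N)]).

(* gridded M-coil: gridded permutation (s, v, h), ordering of points
   ord = [:: v_1; ...; v_N] (as positions, 0-based index k = i-1), and
   labelling lab of the non-zero cells by 0..l-1 (label t <-> label t+1). *)
Definition gridded_coil (c : 'I_m -> int) (r : 'I_n -> int)
    (s : seq nat) (v h : nat -> nat) (ord : seq nat)
    (lab : 'I_m * 'I_n -> nat) : Prop :=
  let N := size s in let l := ncells in
  let pt k := nth 0%N ord k in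
  is_perm s /\ is_gridding s v h /\ (l < N)%N /\
      perm_eq ord (iota 0 N) /\
      {in [pred ij : 'I_m * 'I_n | M ij.1 ij.2 != 0] &,
          injective lab} /\
      (forall i j, M i j != 0 -> (lab (i, j) < l)%N) /\
      (forall k i j, (k < N)%N -> in_cell s v h (pt k) i j ->
         lab (i, j) = (k %% l)%N) /\
      (forall k, (0 < k < N)%N -> arrow c r s v h (pt k.-1) (pt k)) /\
      (forall k, (l < k < N)%N -> arrow c r s v h (pt k) (pt (k - l.+1)%N)) /\
      arrow c r s v h (pt l) (pt 0%N).

End Grid.

Definition inflate (s : seq nat) (p : nat) (inc : bool) : seq nat :=
  let a := nth 0 s p in
  let sh y := if a < y then y.+1 else y in
  take p (map sh s) ++ (if inc then [:: a; a.+1] else [:: a.+1; a])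
    ++ drop p.+1 (map sh s).

(* inflate the two (distinct) positions p and q; the larger one first so the
   other position is unaffected *)
Definition inflate2 (s : seq nat) (p : nat) (bp : bool) (q : nat) (bq : bool) :=
  if p < q then inflate (inflate s q bq) p bp else inflate (inflate s p bp) q bq.

Definition end_inflated_coil (m n : nat) (M : 'M[int]_(m, n))
    (c : 'I_m -> int) (r : 'I_n -> int) (a : seq nat) : Prop :=
  exists s v h ord lab (b1 bN : bool),
    [/\ gridded_coil M c r s v h ord lab,
        (forall i j, in_cell s v h (nth 0 ord 0) i j -> b1 = (M i j == 1%R)),
        (forall i j, in_cell s v h (nth 0 ord (size s).-1) i j ->
           bN = (M i j == 1%R)) &
        a = inflate2 s (nth 0 ord 0) b1 (nth 0 ord (size s).-1) bN].

Definition finitely_many (C P : seq nat -> Prop) : Prop :=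
  exists l : seq (seq nat), forall a, C a -> P a -> a \in l.

(* Main.v *)
Require Import Defs.
From mathcomp Require Import all_boot all_order all_algebra.
From mathcomp Require Import zify.
From Stdlib Require Import Classical ClassicalEpsilon.
Set Implicit Arguments. Unset Strict Implicit. Unset Printing Implicit Defensive.

(* Forward direction: an embedding of one long end-inflated coil into another induces, after
   collapsing the inflated pairs, a weakly monotone map between the underlying coils.  On a long
   stretch of the first coil it maps columns to columns and rows to rows, so it permutes them
   monotonically, hence fixes them; there the coil conditions force a shift of the coil order,
   and the shift propagates to the whole coil.  Both ends are doubled, so the ends correspond
   and the coils have the same length: two long end-inflated coils of different lengths are
   incomparable.

   Backward direction: cut the orientation digraph of a gridded permutation into strongly
   connected pieces, with all arrows between two pieces going from the earlier to the later one,
   and apply Higman's lemma to the list of pieces.  A piece with at least two points carries a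
   coil and layers such that a point two or more layers above another one in a common line
   precedes it.  A point that is not on the coil yields a twin of a coil point near its layer,
   so two such points in distant layers yield a long end-inflated coil.  Hence if these have
   bounded length, the points off the coil lie in a bounded window of layers, and the piece is
   described by finitely many cells, two lengths and a word over a finite alphabet. *)

(** In a line met by a coil, later coil points precede earlier ones; only the arrow from a point to
    its successor goes the other way. Hence an embedding carries the points of a line, taken in coil
    order, monotonically through the boundedly many lines of the target, and on long stretches it
    stays in one line. The obstacle in the forward direction is that collapsing the inflated pairs
    leaves only weak monotonicity, so points and cells might merge; what saves the argument is that
    no three points can merge into one. In the backward direction the coil of a piece is greedy:
    each point is the first one in the next cell that its predecessor has an arrow to. The obstacle
    is that a point off this coil need not double the coil point of its own layer. It may behave
    like the coil point one whole turn earlier, and during the first turn there is none. Starting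
    the coil at a point with the largest orbit makes it possible to push such a point forward until
    the doubling works. *)

Section WellQuasiOrder.

(** * Well quasi-orders and Higman's lemma *)

Definition wqor (A : Type) (R : A -> A -> Prop) : Prop :=
  forall f : nat -> A, exists i j, i < j /\ R (f i) (f j).

Definition transp (A : Type) (R : A -> A -> Prop) : Prop :=
  forall y x z, R x y -> R y z -> R x z.

Lemma choice_fun (A B : Type) (P : A -> B -> Prop) :
  (forall x, exists y, P x y) -> exists f, forall x, P x (f x).
Proof.
move=> H; exists (fun x => proj1_sig (constructive_indefinite_description _ (H x))).
by move=> x; case: constructive_indefinite_description.
Qed.

(** Only finitely many terms lack a later term above them, because infinitely many would form a
    sequence without a good pair. From then on every term has a larger successor, and transitivity
    turns a chain of successors into the subsequence. *)
Lemma wqor_incr (A : Type) (R : A -> A -> Prop) :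
  wqor R -> transp R -> forall f : nat -> A, exists h : nat -> nat,
    (forall i j, i < j -> h i < h j) /\
    (forall i j, i < j -> R (f (h i)) (f (h j))).
Proof.
move=> wR tR f.
have [n0 Hn0] : exists n0, forall i, n0 <= i -> exists j, i < j /\ R (f i) (f j).
  apply: NNPP => H.
  have Hbad n : exists i, n <= i /\ forall j, i < j -> ~ R (f i) (f j).
    apply: NNPP => Hn; apply: H; exists n => i ni; apply: NNPP => Hi.
    by apply: Hn; exists i; split=> // j ij Rij; apply: Hi; exists j.
  have [b Hb] := choice_fun Hbad.
  pose h k := iter k (fun i => b i.+1) (b 0).
  have hS k : h k < h k.+1 by have [] := Hb (h k).+1.
  have hlt i j : i < j -> h i < h j.
    elim: j => // j IH; rewrite ltnS leq_eqVlt => /orP[/eqP-> //|/IH].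
    by move/ltn_trans; apply.
  have hbad k : forall j, h k < j -> ~ R (f (h k)) (f j).
    by case: k => [|k]; [case: (Hb 0) | case: (Hb (h k).+1)].
  have [i [j [ij Rij]]] := wR (fun k => f (h k)).
  by apply: (hbad i (h j)) => //; apply: hlt.
have Hn i : exists j, n0 <= i -> i < j /\ R (f i) (f j).
  case: (leqP n0 i) => ni; last by exists 0.
  by have [j Hj] := Hn0 _ ni; exists j.
have [b Hb] := choice_fun Hn.
pose h k := iter k b n0.
have hge k : n0 <= h k by elim: k => //= k IH; have [] := Hb _ IH; lia.
have step k : h k < h k.+1 /\ R (f (h k)) (f (h k.+1)) by exact: Hb.
exists h; split=> i j; elim: j => // j IH; rewrite ltnS leq_eqVlt.
  by case/orP=> [/eqP->|/IH]; have [] := step j; lia.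
by case/orP=> [/eqP->|/IH]; have [_ Rj] := step j => // Rij; apply: tR Rj.
Qed.

Definition prodR (A B : Type) (R : A -> A -> Prop) (Q : B -> B -> Prop) :=
  fun x y : A * B => R x.1 y.1 /\ Q x.2 y.2.

(** Pass to a subsequence whose first coordinates increase, and find a good pair of second
    coordinates there. *)
Lemma wqor_prod (A B : Type) (R : A -> A -> Prop) (Q : B -> B -> Prop) :
  wqor R -> transp R -> wqor Q -> wqor (prodR R Q).
Proof.
move=> wR tR wQ f.
have [h [hlt hR]] := wqor_incr wR tR (fun k => (f k).1).
have [i [j [ij Qij]]] := wQ (fun k => (f (h k)).2).
by exists (h i), (h j); split; [exact: hlt | split=> //; apply: hR].
Qed.

Lemma transp_prod (A B : Type) (R : A -> A -> Prop) (Q : B -> B -> Prop) :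
  transp R -> transp Q -> transp (prodR R Q).
Proof.
move=> tR tQ y x z [H1 H2] [H3 H4].
by split; [apply: tR H1 H3 | apply: tQ H2 H4].
Qed.

Lemma wqor_leq : wqor (fun i j : nat => i <= j).
Proof.
move=> f; apply: NNPP => H.
have step k : f k.+1 < f k.
  by rewrite ltnNge; apply/negP => le; apply: H; exists k, k.+1.
have drop k : f k + k <= f 0 by elim: k => [|k IH]; [lia | have := step k; lia].
by have := drop (f 0).+1; lia.
Qed.

Lemma wqor_fin (A : finType) : wqor (@eq A).
Proof.
move=> f; apply: NNPP => H.
have inj : injective (fun k : 'I_#|A|.+1 => f k).
  move=> i j eij; apply: val_inj => /=.
  by case: (ltngtP i j) => // ij; case: H; [exists i, j | exists j, i].
by have := leq_card _ inj; rewrite card_ord ltnn.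
Qed.

Inductive semb (A : Type) (R : A -> A -> Prop) : seq A -> seq A -> Prop :=
| semb_nil t : semb R [::] t
| semb_skip y s t : semb R s t -> semb R s (y :: t)
| semb_cons x y s t : R x y -> semb R s t -> semb R (x :: s) (y :: t).

Lemma semb_eq (A : eqType) (s t : seq A) : semb eq s t -> subseq s t.
Proof.
elim=> [u|y u w _ IH|x y u w -> _ IH]; first exact: sub0seq.
  by apply: subseq_trans IH _; apply: subseq_cons.
by rewrite /= eqxx.
Qed.

(* Nash-Williams' minimal bad sequence argument. *)
Lemma higman (A : Type) (R : A -> A -> Prop) :
  wqor R -> transp R -> wqor (semb R).
Proof.
move=> wR tR f0; apply: NNPP => bad0.
pose bad f := ~ exists i j, i < j /\ semb R (f i) (f j).
(* Among the bad sequences that agree with the given one below [n], one has a shortest [n]-th term.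
   Iterating this choice gives [F], whose diagonal [g] is the minimal bad sequence. *)
have minstep (nf : nat * {f : nat -> seq A | bad f}) :
  exists g : {f | bad f},
    (forall i, i < nf.1 -> sval g i = sval nf.2 i) /\
    (forall f, bad f -> (forall i, i < nf.1 -> f i = sval nf.2 i) ->
       size (sval g nf.1) <= size (f nf.1)).
  case: nf => n [f bf] /=.
  pose P k := exists g, [/\ bad g, forall i, i < n -> g i = f i & size (g n) = k].
  have: exists k, P k by exists (size (f n)), f.
  case=> k; elim/ltn_ind: k => k IH Pk.
  case: (classic (exists2 k', k' < k & P k')) => [[k' k'k]|noless].
    exact: IH.
  case: Pk => g [bg gf gk]; exists (exist _ g bg); split=> //= f' bf' f'f.
  rewrite leqNgt; apply/negP => lt; apply: noless.
  by exists (size (f' n)); [rewrite -gk | exists f'].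
have [step stepP] := choice_fun minstep.
pose F := fix F n : {f | bad f} :=
  if n is n'.+1 then step (n', F n') else exist _ f0 bad0.
have Fagree n i k : i < n -> sval (F (n + k)) i = sval (F n) i.
  move=> lt; elim: k => [|k IH]; first by rewrite addn0.
  by rewrite addnS /= -IH; have [/= H _] := stepP (n + k, F (n + k)); apply: H; lia.
pose g n := sval (F n.+1) n.
have gF n i : i < n -> sval (F n) i = g i.
  by move=> lt; rewrite -(subnKC lt) Fagree.
have badg : bad g.
  move=> [i [j [ij Rij]]]; apply: (svalP (F j.+1)); exists i, j; split=> //.
  by rewrite !gF //; lia.
have ming n f : bad f -> (forall i, i < n -> f i = g i) -> size (g n) <= size (f n).
  move=> bf fg; case: (stepP (n, F n)) => /= _; apply=> // i lt.
  by rewrite fg // gF.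
have gne n : exists ab, g n = ab.1 :: ab.2.
  case E: (g n) => [|a t]; last by exists (a, t).
  by case: badg; exists n, n.+1; split=> //; rewrite E; apply: semb_nil.
have [at_ atE] := choice_fun gne.
have [h [hlt hR]] := wqor_incr wR tR (fun n => (at_ n).1).
have hge k : h 0 <= h k by case: k => // k; apply/ltnW/hlt.
(* From position [h 0] on, the terms are replaced by tails along a subsequence with increasing
   heads. The result is still bad, but its term at [h 0] is shorter than that of [g]. *)
pose f n := if n < h 0 then g n else (at_ (h (n - h 0))).2.
have : bad f.
  move=> [i [j [ij]]]; rewrite /f.
  case: (ltnP j (h 0)) => jh; case: (ltnP i (h 0)) => ih Rij; try lia.
  - by apply: badg; exists i, j.
  - apply: badg; exists i, (h (j - h 0)); split; first by have := hge (j - h 0); lia.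
    by rewrite (atE (h _)); apply: semb_skip.
  - apply: badg; exists (h (i - h 0)), (h (j - h 0)).
    have lt : i - h 0 < j - h 0 by lia.
    split; first exact: hlt.
    by rewrite !(atE (h _)); apply: semb_cons => //; apply: hR.
move/(ming (h 0)); rewrite /f ltnn subnn (atE (h 0)) /= => H.
have/H : forall i, i < h 0 -> (if i < h 0 then g i else (at_ (h (i - h 0))).2) = g i.
  by move=> i ->.
lia.
Qed.

End WellQuasiOrder.

(** * Pattern containment and inflation of points *)

Section Patterns.

Lemma is_permP (s : seq nat) :
  reflect (uniq s /\ forall x, x \in s -> x < size s) (is_perm s).
Proof.
apply: (iffP idP) => [Hs|[us Hs]].
  split; first by rewrite (perm_uniq Hs) iota_uniq.
  by move=> x; rewrite (perm_mem Hs) mem_iota.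
have sub : {subset s <= iota 0 (size s)} by move=> x /Hs; rewrite mem_iota.
have [|_ eqm] := uniq_min_size us sub; first by rewrite size_iota.
by apply: uniq_perm => //; apply: iota_uniq.
Qed.

Lemma is_perm_nth_lt (s : seq nat) x : is_perm s -> x < size s -> nth 0 s x < size s.
Proof. by move/is_permP => [_ H] lt; apply/H/mem_nth. Qed.

Lemma is_perm_nth_inj (s : seq nat) x y : is_perm s -> x < size s -> y < size s ->
  nth 0 s x = nth 0 s y -> x = y.
Proof. by move/is_permP => [us _] ltx lty /eqP; rewrite nth_uniq // => /eqP. Qed.

(** Containment as an explicit map of positions, which, unlike a mask, can be composed with
    collapses and extended to new points. *)
Definition embeds (g : nat -> nat) (s p : seq nat) : Prop :=
  (forall x, x < size s -> g x < size p) /\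
  (forall x y, x < size s -> y < size s ->
     (x < y) = (g x < g y) /\
     (nth 0 s x < nth 0 s y) = (nth 0 p (g x) < nth 0 p (g y))).

Lemma embeds_contains g s p : embeds g s p -> contains p s.
Proof.
move=> [gl gc].
set l := map g (iota 0 (size s)).
exists [seq x \in l | x <- iota 0 (size p)].
have sl : sorted ltn l.
  rewrite sorted_map.
  have : sorted ltn (iota 0 (size s)) by apply: iota_ltn_sorted.
  apply: sub_in_sorted (allss _) => x y /[!mem_iota] /= lx ly.
  by have [-> _] := gc x y lx ly.
have El : [seq x <- iota 0 (size p) | x \in l] = l.
  apply: (irr_sorted_eq ltn_trans ltnn) => //.
    by apply: sorted_filter; [exact: ltn_trans | exact: iota_ltn_sorted].
  move=> x; rewrite mem_filter mem_iota add0n /=.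
  by case: (boolP (x \in l)) => // /mapP[y /[!mem_iota] /= ly ->]; apply: gl.
rewrite -{2}(mkseq_nth 0 p) /mkseq -map_mask -filter_mask El -map_comp.
split=> [|i j li lj]; first by rewrite size_map size_iota.
rewrite !(nth_map 0) ?size_iota // !nth_iota //=.
by have [] := gc i j li lj.
Qed.

Lemma contains_embeds s p : contains p s -> exists g, embeds g s p.
Proof.
move=> [msk [sz cmp]].
pose l := mask msk (iota 0 (size p)).
have E : mask msk p = map (nth 0 p) l by rewrite map_mask map_nth_iota0 // take_size.
have sl : sorted ltn l.
  by apply: sorted_mask; [exact: ltn_trans | exact: iota_ltn_sorted].
have szl : size l = size s by rewrite sz E size_map.
exists (nth 0 l); split=> [x lx|x y lx ly].
  have : nth 0 l x \in l by rewrite mem_nth // szl.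
  by move/mem_mask; rewrite mem_iota.
split; last by rewrite cmp // E !(nth_map 0) ?szl.
apply/idP/idP => H; first by apply: (sorted_ltn_nth ltn_trans); rewrite ?inE ?szl.
rewrite ltnNge; apply/negP => yx.
have : nth 0 l y <= nth 0 l x.
  by apply: (sorted_leq_nth leq_trans leqnn); rewrite ?inE ?szl //; apply: sub_sorted sl => ? ? /ltnW.
by rewrite leqNgt H.
Qed.

(** The collapse belonging to an inflation at [p]: both new positions [p] and [p.+1] return to
    [p]. *)
Definition kap (p x : nat) : nat := if x <= p then x else x.-1.

Lemma kapP p x : x <= p /\ kap p x = x \/ p < x /\ kap p x = x.-1.
Proof. by rewrite /kap; case: (leqP x p); [left | right]. Qed.

Ltac kap_lia := rewrite /kap; repeat match goal with
  |- context [if ?a <= ?b then _ else _] => case: (leqP a b) => ? end; lia.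

Lemma size_inflate s p inc : p < size s -> size (inflate s p inc) = (size s).+1.
Proof.
move=> lp; rewrite /inflate !size_cat size_take size_drop size_map lp.
by case: inc => /=; lia.
Qed.

(** The last summand raises the upper one of the two new points, which is the left one in a
    decreasing pair and the right one in an increasing pair. *)
Lemma nth_inflate s p inc x : p < size s -> x <= size s ->
  nth 0 (inflate s p inc) x =
    (let a := nth 0 s p in let y := nth 0 s (kap p x) in
     (if a < y then y.+1 else y) + ((x == p) && ~~ inc || (x == p.+1) && inc)).
Proof.
move=> lp lx; rewrite /inflate /kap.
set a := nth 0 s p.
case: (ltngtP x p) => [xp|xp|->].
- rewrite nth_cat size_take size_map lp xp nth_take // (nth_map 0); last lia.
  by rewrite (_ : (x == p.+1) = false) /= ?addn0 //; lia.
- rewrite nth_cat size_take size_map lp ltnNge (ltnW xp) nth_cat.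
  have -> : size (if inc then [:: a; a.+1] else [:: a.+1; a]) = 2 by case: (inc).
  case: (eqVneq x p.+1) => [->|xp1].
    by rewrite subSnn /= -/a ltnn; case: (inc) => /=; lia.
  rewrite (_ : x - p < 2 = false); last lia.
  rewrite nth_drop (nth_map 0); last lia.
  by rewrite (_ : p.+1 + (x - p - 2) = x.-1) /= ?addn0 //; lia.
- rewrite nth_cat size_take size_map lp ltnn subnn /= ltnn (_ : (p == p.+1) = false); last lia.
  by case: (inc) => /=; rewrite -?/a ?ltnn; lia.
Qed.

(** The interface to an inflated permutation: [k] collapses [a] onto [s], and fibres with two points
    occur over [P] and [Q] only. The last clause supplies two preimages of each point, distinct over
    [P] and [Q], so that two sections of [k] can be made to differ exactly there. *)
Definition blow (s a : seq nat) (P Q : nat) (k : nat -> nat) : Prop :=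
  [/\ forall x, x < size a -> k x < size s,
      forall x y, x < size a -> y < size a -> k x <> k y ->
        (x < y) = (k x < k y) /\ (nth 0 a x < nth 0 a y) = (nth 0 s (k x) < nth 0 s (k y)),
      forall x y z, x < size a -> y < size a -> z < size a ->
        x < y -> y < z -> k x = k y -> k y = k z -> False,
      forall x y, x < size a -> y < size a -> x < y -> k x = k y -> k x = P \/ k x = Q &
      forall z, z < size s -> exists x y,
        [/\ x < size a, y < size a, k x = z, k y = z & (z = P \/ z = Q -> x <> y)]].

Lemma inflate_cmp s p inc x y : is_perm s -> p < size s ->
  x <= size s -> y <= size s -> kap p x <> kap p y ->
  (x < y) = (kap p x < kap p y) /\
  (nth 0 (inflate s p inc) x < nth 0 (inflate s p inc) y)
    = (nth 0 s (kap p x) < nth 0 s (kap p y)).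
Proof.
move=> Hs lp lx ly kxy; split; first by move: kxy; kap_lia.
rewrite !nth_inflate //=.
have kl z : z <= size s -> kap p z < size s by kap_lia.
have ne : nth 0 s (kap p x) <> nth 0 s (kap p y).
  by move/(is_perm_nth_inj Hs (kl _ lx) (kl _ ly)).
have np z : z <= size s -> (z == p) || (z == p.+1) \/ nth 0 s (kap p z) <> nth 0 s p.
  move=> lz; case: (boolP ((z == p) || _)) => H; [by left | right].
  move/(is_perm_nth_inj Hs (kl _ lz) lp); move: H; kap_lia.
have kp z : (z == p) || (z == p.+1) -> kap p z = p by kap_lia.
have bit z : nth 0 s (kap p z) <> nth 0 s p -> (z == p) = false /\ (z == p.+1) = false.
  by move=> H; split; apply/negP => E; apply: H; rewrite kp // E ?orbT.
move: ne; case: (np x lx) (np y ly) => [Hx|Hx] [Hy|Hy].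
- by move: kxy; rewrite !kp.
- rewrite (kp x) // ltnn; have [-> ->] := bit y Hy => ne.
  by case: (inc); case: (ltngtP (nth 0 s p) (nth 0 s (kap p y))) ne => // *; lia.
- rewrite (kp y) // ltnn; have [-> ->] := bit x Hx => ne.
  by case: (inc); case: (ltngtP (nth 0 s p) (nth 0 s (kap p x))) ne => // *; lia.
have [-> ->] := bit x Hx; have [-> ->] := bit y Hy.
rewrite /= !addn0 => ne; case: (ltnP (nth 0 s p) (nth 0 s (kap p x)));
  case: (ltnP (nth 0 s p) (nth 0 s (kap p y))); lia.
Qed.

Lemma kap_le p (s : seq nat) x : p < size s -> x <= size s -> kap p x < size s.
Proof. by kap_lia. Qed.

Lemma is_perm_inflate s p inc : is_perm s -> p < size s -> is_perm (inflate s p inc).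
Proof.
move=> Hs lp; apply/is_permP; split; last first.
  move=> y /(nthP 0)[x]; rewrite size_inflate // ltnS => lx <-.
  rewrite nth_inflate //=.
  have H1 := is_perm_nth_lt Hs (kap_le lp lx).
  case: (ltnP (nth 0 s p) (nth 0 s (kap p x))) => H2; last by case: (_ || _); lia.
  suff -> : (x == p) && ~~ inc || (x == p.+1) && inc = false by lia.
  apply/negP => H3; have E : kap p x = p by move: H3; kap_lia.
  by rewrite E ltnn in H2.
apply/(uniqP 0) => x y; rewrite !inE size_inflate // !ltnS => lx ly E.
case: (eqVneq (kap p x) (kap p y)) => [k|/eqP ne]; last first.
  have [_ H1] := inflate_cmp inc Hs lp lx ly ne.
  have [_ H2] := inflate_cmp inc Hs lp ly lx (nesym ne).
  rewrite E ltnn in H1; rewrite E ltnn in H2.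
  case: ne; apply: (is_perm_nth_inj Hs) (kap_le lp lx) (kap_le lp ly) _.
  by apply/eqP; rewrite eqn_leq leqNgt -H2 /= leqNgt -H1.
move: E; rewrite !nth_inflate //= k; move: (if _ then _ else _) => w /addnI.
by case: (inc); move: k; kap_lia.
Qed.

(* [z] doubles the point [g P] of a copy of [s] in [p]. *)
Definition twin g (s p : seq nat) (P z : nat) (inc : bool) : Prop :=
  [/\ z < size p,
      forall q, q < size s -> z <> g q,
      forall q, q < size s -> q <> P -> (z < g q) = (g P < g q) /\
        (nth 0 p z < nth 0 p (g q)) = (nth 0 p (g P) < nth 0 p (g q)) &
      (inc = ((z < g P) == (nth 0 p z < nth 0 p (g P))))].

(** The inflated pair goes to [z] and [g P] in the order of their positions; [inc] records whether
    their values are ordered in the same way, so the pair gets the right direction. *)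
Lemma embeds_inflate g s p P z inc : is_perm s -> is_perm p -> P < size s ->
  embeds g s p -> twin g s p P z inc ->
  embeds (fun x => if x == P then minn z (g P) else
                   if x == P.+1 then maxn z (g P) else g (kap P x))
         (inflate s P inc) p.
Proof.
move=> Hs Hp lP [gl gc] [lz zg zc einc].
set g' := (fun x => _).
have g'l x : x <= size s -> g' x < size p.
  move=> lx; rewrite /g'; have := gl _ lP.
  by case: eqP => _; [lia | case: eqP => _; [lia | move=> _; apply/gl/kap_le]].
have ltN x y : x < size p -> y < size p -> x <> y ->
    ((y < x) = ~~ (x < y)) /\ (nth 0 p y < nth 0 p x) = ~~ (nth 0 p x < nth 0 p y).
  move=> lx ly ne; split; first lia.
  have : nth 0 p x <> nth 0 p y by move/(is_perm_nth_inj Hp lx ly).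
  lia.
have cl x y : kap P x = P -> y < size s -> y <> P ->
    (g' x < g y) = (g P < g y) /\ (nth 0 p (g' x) < nth 0 p (g y)) = (nth 0 p (g P) < nth 0 p (g y)).
  move=> kx ly ne; have [z1 z2] := zc y ly ne.
  suff [->| ->] : g' x = z \/ g' x = g P by [].
  have : x = P \/ x = P.+1 by move: kx; kap_lia.
  rewrite /g'; case=> ->; rewrite ?eqxx; first by case: (leqP z (g P)); lia.
  by rewrite (gtn_eqF (ltnSn P)); case: (leqP z (g P)); lia.
have gne x y : x < size s -> y < size s -> x <> y -> g x <> g y.
  move=> lx ly ne E; have [H1 _] := gc x y lx ly; have [H2 _] := gc y x ly lx.
  by move: H1 H2; rewrite E ltnn; lia.
split=> [x|x y]; rewrite size_inflate // !ltnS; first exact: g'l.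
move=> lx ly.
have kx := kap_le lP lx; have ky := kap_le lP ly.
have g'k w : kap P w <> P -> g' w = g (kap P w).
  rewrite /g'; case: eqP => [->|_]; first by rewrite /kap leqnn.
  by case: eqP => [->|_] //; rewrite /kap ltnn.
case: (eqVneq (kap P x) (kap P y)) => [k|/eqP ne]; last first.
  have [-> ->] := inflate_cmp inc Hs lP lx ly ne.
  case: (eqVneq (kap P x) P) => [xP|/eqP xP].
    have yP : kap P y <> P by congruence.
    by rewrite xP (g'k y) //; have [-> ->] := cl x _ xP ky yP; apply: gc.
  rewrite (g'k x) //.
  case: (eqVneq (kap P y) P) => [yP|/eqP yP]; last by rewrite g'k //; apply: gc.
  have [H1 H2] := cl y _ yP kx xP.
  have ne1 : g (kap P x) <> g' y.
    move=> E; move: H1 H2; rewrite -E ltnn => H1 _.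
    have := gne _ _ lP kx (nesym xP); have := zg _ kx.
    move: E; have : y = P \/ y = P.+1 by move: yP; kap_lia.
    rewrite /g'; case=> ->; rewrite ?eqxx; first by case: (leqP z (g P)); lia.
    by rewrite (gtn_eqF (ltnSn P)); case: (leqP z (g P)); lia.
  have [-> ->] := ltN _ _ (g'l _ ly) (gl _ kx) (nesym ne1).
  by rewrite H1 H2 yP; have [-> ->] := gc _ _ kx lP;
     have [-> ->] := ltN _ _ (gl _ lP) (gl _ kx) (gne _ _ lP kx (nesym xP)).
have zP : z <> g P by exact: zg.
have := ltN _ _ lz (gl _ lP) zP.
have : x = y \/ (x = P /\ y = P.+1) \/ (x = P.+1 /\ y = P).
  by move: k; kap_lia.
have E1 : (P.+1 == P) = false by lia.
have nP : nth 0 (inflate s P inc) P = nth 0 s P + ~~ inc.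
  rewrite nth_inflate //=; last exact: ltnW.
  by rewrite /kap leqnn ltnn eqxx (ltn_eqF (ltnSn P)) orbF.
have nP1 : nth 0 (inflate s P inc) P.+1 = nth 0 s P + inc.
  by rewrite nth_inflate //= /kap ltnn ltnn eqxx E1.
case=> [->|[] [-> ->]]; first by rewrite !ltnn.
  rewrite nP nP1 /g' !eqxx E1 => - [z1 z2].
  by rewrite einc /minn /maxn; case: (ltnP z (g P)) => ?;
    case: (ltnP (nth 0 p z) (nth 0 p (g P))) z2 => ? z2; split => //=; lia.
rewrite nP nP1 /g' !eqxx E1 => - [z1 z2].
by rewrite einc /minn /maxn; case: (ltnP z (g P)) => ?;
    case: (ltnP (nth 0 p z) (nth 0 p (g P))) z2 => ? z2; split => //=; lia.
Qed.

Lemma inflate2C s P bP Q bQ : P <> Q -> inflate2 s P bP Q bQ = inflate2 s Q bQ P bP.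
Proof. by rewrite /inflate2; case: ltngtP. Qed.

Lemma contains_inflate2 g s p P zP bP Q zQ bQ : is_perm s -> is_perm p ->
  P < size s -> Q < size s -> P <> Q -> embeds g s p ->
  twin g s p P zP bP -> twin g s p Q zQ bQ -> zP <> zQ ->
  (zP < zQ) = (g P < g Q) -> (nth 0 p zP < nth 0 p zQ) = (nth 0 p (g P) < nth 0 p (g Q)) ->
  contains p (inflate2 s P bP Q bQ).
Proof.
move=> Hs Hp.
have cneg x y x' y' : x < size p -> y < size p -> x' < size p -> y' < size p ->
    x <> y -> x' <> y' ->
    ((x < y) = (x' < y') -> (y < x) = (y' < x')) /\
    ((nth 0 p x < nth 0 p y) = (nth 0 p x' < nth 0 p y') ->
     (nth 0 p y < nth 0 p x) = (nth 0 p y' < nth 0 p x')).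
  move=> lx ly lx' ly' ne ne'; split; first lia.
  have : nth 0 p x <> nth 0 p y by move/(is_perm_nth_inj Hp lx ly).
  have : nth 0 p x' <> nth 0 p y' by move/(is_perm_nth_inj Hp lx' ly').
  lia.
wlog PQ : P zP bP Q zQ bQ / P < Q => [hw lP lQ ne eg tP tQ nz z1 z2|].
  case: (ltngtP P Q) ne => // PQ ne; first by apply: (hw P zP bP Q zQ).
  have gne : g P <> g Q.
    have [gl gc] := eg; have [+ _] := gc Q P lQ lP; rewrite PQ => H E.
    by rewrite E ltnn in H.
  have [gl _] := eg; have [lzP _ _ _] := tP; have [lzQ _ _ _] := tQ.
  have [c1 c2] := cneg _ _ _ _ lzP lzQ (gl _ lP) (gl _ lQ) nz gne.
  rewrite inflate2C //; apply: (hw Q zQ bQ P zP) => //; try exact: nesym.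
    exact: c1.
  exact: c2.
move=> lP lQ nPQ eg tP tQ nz z1 z2; rewrite /inflate2 PQ.
have gne : g P <> g Q.
  have [gl gc] := eg; have [+ _] := gc P Q lP lQ; rewrite PQ => H E.
  by rewrite E ltnn in H.
have eg' := embeds_inflate Hs Hp lQ eg tQ.
have kP : kap Q P = P by rewrite /kap ltnW.
apply: embeds_contains (embeds_inflate (is_perm_inflate bQ Hs lQ) Hp _ eg' (z := zP) _).
  by rewrite size_inflate //; lia.
have [lzP zPg zPc eP] := tP; have [lzQ zQg zQc eQ] := tQ; have [gl gc] := eg.
have gP : (if P == Q then minn zQ (g Q) else
           if P == Q.+1 then maxn zQ (g Q) else g (kap Q P)) = g P.
  by rewrite kP (ltn_eqF PQ) (ltn_eqF (ltnW PQ : P < Q.+1)).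
(* [Q] has already been inflated, so [zP] must relate to [zQ] too as [g P] does; this combines [z1],
   [z2] with the twin property of [zQ] at [P]. *)
have cQ : (zP < zQ) = (g P < zQ) /\ (nth 0 p zP < nth 0 p zQ) = (nth 0 p (g P) < nth 0 p zQ).
  have [H1 H2] := zQc P lP nPQ.
  have [c1 c2] := cneg _ _ _ _ lzQ (gl _ lP) (gl _ lQ) (gl _ lP) (zQg _ lP) (nesym gne).
  by rewrite z1 z2 c1 // c2.
rewrite /twin size_inflate //; split=> //; last by rewrite gP.
  move=> q; rewrite ltnS => lq; have := zPg _ lQ; have := zPg _ (kap_le lQ lq).
  by case: eqP => _; [lia | case: eqP => _; [lia | by []]].
move=> q; rewrite ltnS gP => lq qP; have [q1 q2] := zPc Q lQ (nesym nPQ).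
have mm (a b x y : nat) : (a < x) = (b < x) -> (a < y) = (b < y) ->
    (a < minn x y) = (b < minn x y) /\ (a < maxn x y) = (b < maxn x y).
  by case: (leqP x y).
have [m1 m2] : (minn zQ (g Q) = zQ \/ minn zQ (g Q) = g Q) /\
    (maxn zQ (g Q) = zQ \/ maxn zQ (g Q) = g Q).
  by case: (leqP zQ (g Q)); auto.
have [c1 c2] := cQ.
case: eqP => [eq|nq]; first by case: m1 => ->.
case: eqP => [eq|nq']; first by case: m2 => ->.
apply: zPc; first exact: kap_le.
by move: qP nq nq'; kap_lia.
Qed.

Lemma blow_inflate s p inc : is_perm s -> p < size s -> blow s (inflate s p inc) p p (kap p).
Proof.
move=> Hs lp; rewrite /blow size_inflate //; split.
- by move=> x; rewrite ltnS; apply: kap_le.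
- by move=> x y; rewrite !ltnS; apply: inflate_cmp.
- by move=> x y z _ _ _; kap_lia.
- by move=> x y _ _; kap_lia.
move=> z lz; case: (ltngtP z p) => zp.
- by exists z, z; split; kap_lia.
- by exists z.+1, z.+1; split; kap_lia.
by exists p, p.+1; split; kap_lia.
Qed.

Lemma blow_inflate2 s P bP Q bQ : is_perm s -> P < size s -> Q < size s -> P <> Q ->
  exists k, blow s (inflate2 s P bP Q bQ) P Q k.
Proof.
move=> Hs.
wlog PQ : P bP Q bQ / P < Q => [hw lP lQ ne|].
  case: (ltngtP P Q) ne => // PQ ne; first exact: hw.
  have [k [k1 k2 k3 k4 k5]] := hw Q bQ P bP PQ lQ lP (nesym ne).
  rewrite inflate2C //; exists k; split=> //.
    by move=> x y lx ly xy /(k4 x y lx ly xy); tauto.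
  by move=> z /k5[x [y [*]]]; exists x, y; split=> //; tauto.
move=> lP lQ ne; rewrite /inflate2 PQ.
set a1 := inflate s Q bQ.
have Ha1 : is_perm a1 by apply: is_perm_inflate.
have sa1 : size a1 = (size s).+1 by rewrite size_inflate.
have lP1 : P < size a1 by rewrite sa1; lia.
have [k1 k2 k3 k4 k5] := blow_inflate bQ Hs lQ.
have [j1 j2 j3 j4 j5] := blow_inflate bP Ha1 lP1.
exists (fun x => kap Q (kap P x)).
rewrite -/a1 in k1 k2 k3 k4 k5 *; split.
- by move=> x /j1 /k1.
- move=> x y lx ly H.
  have nj : kap P x <> kap P y by congruence.
  have [-> ->] := j2 x y lx ly nj.
  by apply: k2 => //; apply: j1.
- move=> x y z _ _ _; have := kapP P x; have := kapP P y; have := kapP P z.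
  by have := kapP Q (kap P x); have := kapP Q (kap P y); have := kapP Q (kap P z); lia.
- move=> x y _ _; have := kapP P x; have := kapP P y.
  by have := kapP Q (kap P x); have := kapP Q (kap P y); lia.
move=> z lz; have [x [y [lx ly kx ky nxy]]] := k5 z lz.
have [x1 [x2 [lx1 lx2 kx1 kx2 nx]]] := j5 x lx.
have [y1 [y2 [ly1 ly2 ky1 ky2 ny]]] := j5 y ly.
(* The two preimages of [Q] come from the inflation done first, those of any other point from the
   one done last. *)
case: (eqVneq z Q) => [zQ|/eqP zQ].
  exists x1, y1; rewrite kx1 ky1; split=> // _ E; rewrite E in kx1.
  by apply: nxy; [left | congruence].
exists x1, x2; split; rewrite ?kx1 ?kx2 //; case=> // zP; apply: nx; left.
by move: kx; rewrite zP; kap_lia.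
Qed.

End Patterns.

(** * Bounded monotone functions are constant on long stretches *)

Section Stretches.

(** Only pairs at distance at least two are compared, because consecutive coil points are ordered
    oppositely to all other pairs of their line. *)
Definition monotone_on (P : pred nat) (Q : nat -> nat) (a L : nat) : Prop :=
  (forall k k', a <= k -> k + 2 <= k' -> k' < a + L -> P k -> P k' -> Q k' <= Q k) \/
  (forall k k', a <= k -> k + 2 <= k' -> k' < a + L -> P k -> P k' -> Q k <= Q k').

Definition constant_on (P : pred nat) (Q : nat -> nat) (a L : nat) : Prop :=
  forall k k', a <= k < a + L -> a <= k' < a + L -> P k -> P k' -> Q k = Q k'.

Lemma antitone_constant_stretch W D (P : pred nat) (Q : nat -> nat) a :
  (forall k k', a <= k -> k + 2 <= k' -> k' < a + D.+1 * W.+1 ->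
     P k -> P k' -> Q k' <= Q k) ->
  (forall k, a <= k < a + D.+1 * W.+1 -> P k -> Q k <= D) ->
  exists a', [/\ a <= a', a' + W <= a + D.+1 * W.+1 & constant_on P Q a' W].
Proof.
elim: D a => [|D IH] a anti bound.
  exists a; rewrite leqnn mul1n; split=> //; first by lia.
  by move=> k k' Hk Hk' Pk Pk'; have := bound k; have := bound k'; lia.
have EW : D.+2 * W.+1 = W.+1 + D.+1 * W.+1 by rewrite mulSn.
case: (classic (constant_on P Q a W)) => [H|H]; first by exists a; split=> //; lia.
have [k [Hk Pk lk]] : exists k, [/\ a <= k < a + W, P k & Q k <= D].
  apply: NNPP => H1; apply: H => k k' Hk Hk' Pk Pk'.
  have b1 : Q k <= D.+1 by apply: bound => //; lia.
  have b2 : Q k' <= D.+1 by apply: bound => //; lia.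
  case: (leqP (Q k) D) => c1; first by case: H1; exists k.
  by case: (leqP (Q k') D) => c2; [case: H1; exists k' | lia].
have [k1 k2 *||a' [le1 le2 cst]] := IH (a + W.+1).
- by apply: anti => //; lia.
- by move=> k2 Hk2 Pk2; apply: leq_trans lk; apply: anti => //; lia.
by exists a'; split=> //; lia.
Qed.

Lemma constant_stretch W D (P : pred nat) (Q : nat -> nat) a :
  monotone_on P Q a (D.+1 * W.+1) ->
  (forall k, a <= k < a + D.+1 * W.+1 -> P k -> Q k <= D) ->
  exists a', [/\ a <= a', a' + W <= a + D.+1 * W.+1 & constant_on P Q a' W].
Proof.
move=> [anti|mono] bound; first exact: antitone_constant_stretch anti bound.
have [k k' *||a' [le1 le2 cst]] := @antitone_constant_stretch W D P (fun k => D - Q k) a.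
- by apply: leq_sub2l; apply: mono.
- by move=> k _ _; apply: leq_subr.
exists a'; split=> // k k' Hk Hk' Pk Pk'.
have := cst k k' Hk Hk' Pk Pk'; have := bound k; have := bound k'; lia.
Qed.

(** The functions are made constant one after another, each inside the stretch obtained for the
    previous one. The length [L] has to be chosen before the functions, as it must serve all pairs
    of coils at once. *)
Lemma constant_stretches W D R : exists L, forall (P : nat -> pred nat) (Q : nat -> nat -> nat) a,
  (forall i, i < R -> monotone_on (P i) (Q i) a L) ->
  (forall i k, i < R -> a <= k < a + L -> P i k -> Q i k <= D) ->
  exists a', [/\ a <= a', a' + W <= a + L & forall i, i < R -> constant_on (P i) (Q i) a' W].
Proof.
elim: R => [|R [L IH]]; first by exists W => P Q a _ _; exists a.
exists (D.+1 * L.+1) => P Q a mono bound.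
have [a1 [le1 le2 cst1]] := constant_stretch (mono R (ltnSn R)) (fun k => bound R k (ltnSn R)).
have [i iR|i k iR Hk|a2 [le3 le4 cst2]] := IH P Q a1.
- by case: (mono i (ltnW iR)) => H; [left | right] => k k' *; apply: H => //; lia.
- by apply: bound => //; lia.
exists a2; split; try lia.
move=> i; rewrite ltnS leq_eqVlt => /orP[/eqP->|]; last exact: cst2.
by move=> k k' Hk Hk'; apply: cst1; lia.
Qed.

Lemma eqmod_addP l a b : a <= b -> a = b %[mod l] -> exists j, b = a + j * l.
Proof.
move=> ab /esym/eqP; rewrite eqn_mod_dvd // => /dvdnP[j E].
by exists j; lia.
Qed.

Lemma eqmodD l a j : a + j * l = a %[mod l].
Proof. by rewrite addnC modnMDl. Qed.

End Stretches.

(** * The order of coil points along a line *)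

Section CoilData.
Variables (l : nat) (o : bool -> nat -> bool).

(* Points of a coil are indexed by their rank [k] in the coil order; [X b k] is
   the coordinate along the axis [b] ([true]: position, [false]: value), [cc b k]
   the index of the column ([b = true]) or row containing the [k]-th cell of the
   periodic sequence of cells, and [ax k] tells whether the cells [k] and [k + 1]
   share their column or their row. *)
Definition prec (X cc : bool -> nat -> nat) (b : bool) (k k' : nat) : bool :=
  if o b (cc b k) then X b k < X b k' else X b k' < X b k.

(** [prec_next] and [prec_back] are the arrows (C2) and (C3). [cc_line] expresses the cycle:
    different cells in a common line are neighbours in the cyclic sequence. [prec_cell] is the sign
    rule of a partial multiplication matrix: inside a cell the column and row orientations agree. *)
Record coil_data (N : nat) (X cc : bool -> nat -> nat) (ax : nat -> bool) : Prop := CoilData {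
  X_inj : forall b k k', k < N -> k' < N -> X b k = X b k' -> k = k';
  cc_mono : forall b k k', k < N -> k' < N -> X b k <= X b k' -> cc b k <= cc b k';
  cc_per : forall b k, cc b (k + l) = cc b k;
  cc_line : forall b k k', cc b k = cc b k' ->
    [\/ k = k' %[mod l], b = ax k /\ k' = k.+1 %[mod l] | b = ax k' /\ k = k'.+1 %[mod l]];
  ax_share : forall k, cc (ax k) k.+1 = cc (ax k) k;
  ax_alt : forall k, ax k.+1 = ~~ ax k;
  ax_per : forall k, ax (k + l) = ax k;
  prec_next : forall k, k.+1 < N -> prec X cc (ax k) k k.+1;
  prec_back : forall k, k + l.+1 < N -> prec X cc (ax k) (k + l.+1) k;
  prec_cell : forall k k', k < N -> k' < N -> k = k' %[mod l] ->
    prec X cc true k k' = prec X cc false k k' }.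

Hypothesis l3 : 3 < l.

Section Coil.
Variables (N : nat) (X cc : bool -> nat -> nat) (ax : nat -> bool).
Hypothesis D : coil_data N X cc ax.
Hypothesis lN : l.+1 < N.
Notation prec := (prec X cc).

Lemma prec_trans b x y z : cc b y = cc b x -> prec b x y -> prec b y z -> prec b x z.
Proof.
rewrite /CoilData.prec => ->; case: (o b _) => H1 H2; first exact: ltn_trans H1 H2.
exact: ltn_trans H2 H1.
Qed.

Lemma prec_total b x y : x < N -> y < N -> cc b y = cc b x -> x <> y -> prec b x y || prec b y x.
Proof.
move=> lx ly E ne; have : X b x <> X b y by move/(X_inj D lx ly).
by rewrite /CoilData.prec E; case: (o b _); lia.
Qed.

Lemma prec_asym b x y : cc b y = cc b x -> prec b x y -> ~~ prec b y x.
Proof. by rewrite /CoilData.prec => ->; case: (o b _) => /ltnW; rewrite -leqNgt. Qed.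

Lemma prec_irr b x : ~~ prec b x x.
Proof. by rewrite /CoilData.prec; case: (o b _); rewrite ltnn. Qed.

Lemma cc_perM b k j : cc b (k + j * l) = cc b k.
Proof. by elim: j => [|j IH]; rewrite ?addn0 // mulSn (addnC l) addnA (cc_per D). Qed.

Lemma ax_perM k j : ax (k + j * l) = ax k.
Proof. by elim: j => [|j IH]; rewrite ?addn0 // mulSn (addnC l) addnA (ax_per D). Qed.

Lemma cc_mod b k k' : k = k' %[mod l] -> cc b k = cc b k'.
Proof.
wlog le : k k' / k <= k' => [hw|] E; last by have [j ->] := eqmod_addP le E; rewrite cc_perM.
by case: (leqP k k') => [le|/ltnW le]; [apply: hw | apply/esym/hw].
Qed.

Lemma ax_mod k k' : k = k' %[mod l] -> ax k = ax k'.
Proof.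
wlog le : k k' / k <= k' => [hw|] E; last by have [j ->] := eqmod_addP le E; rewrite ax_perM.
by case: (leqP k k') => [le|/ltnW le]; [apply: hw | apply/esym/hw].
Qed.

(** Two different cells sharing both lines would each be the successor of the other, so that two
    steps lead back to the start, which [l > 3] excludes. *)
Lemma cc_inj k k' : (forall b, cc b k = cc b k') -> k = k' %[mod l].
Proof.
move=> E; have H1 := cc_line D (E true); have H2 := cc_line D (E false).
case: H1 => // -[b1 e1]; case: H2 => // -[b2 e2]; try by rewrite -b1 in b2.
  have : k = k.+2 %[mod l] by rewrite e2 -addn1 -modnDml e1 modnDml addn1.
  by move/eqmod_addP => []; [lia | case=> [|j]; rewrite ?mulSn; lia].
have : k' = k'.+2 %[mod l] by rewrite e2 -addn1 -modnDml e1 modnDml addn1.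
by move/eqmod_addP => []; [lia | case=> [|j]; rewrite ?mulSn; lia].
Qed.

Lemma cc_next_ne k : cc (~~ ax k) k.+1 <> cc (~~ ax k) k.
Proof.
move=> E; have : k = k.+1 %[mod l].
  by apply: cc_inj => b; case: (eqVneq b (ax k)) => [->|]; rewrite ?(ax_share D) //;
     case: b (ax k) E => -[].
by move/eqmod_addP => []; [lia | case=> [|j]; rewrite ?mulSn; lia].
Qed.

Lemma prec_cell_any b b' k k' : k < N -> k' < N -> k = k' %[mod l] ->
  prec b k k' -> prec b' k k'.
Proof. by move=> lk lk' E; have := prec_cell D lk lk' E; case: b; case: b' => // ->. Qed.

(** The path goes from [p + l] to [p + l.+1] and back to [p]. If [p + l] is the last point of the
    coil, it goes through [p.-1] instead. *)
Lemma prec_period b p : p + l < N -> prec b (p + l) p.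
Proof.
move=> lt; have E : p + l = p %[mod l] by rewrite modnDr.
have lp : p < N by lia.
case: (ltnP (p + l.+1) N) => H.
  apply: (prec_cell_any (b := ax p)) => //; apply: (@prec_trans _ _ (p + l.+1)).
  - by rewrite addnS -(ax_per D) (ax_share D).
  - by rewrite addnS -{1}(ax_per D); apply: (prec_next D); lia.
  exact: (prec_back D).
case: p lt E lp H => [|p] lt E lp H; first lia.
apply: (prec_cell_any (b := ax p)) => //; apply: (@prec_trans _ _ p).
- by rewrite addSn -(ax_per D) (ax_share D) (ax_per D) (cc_per D).
- by have := prec_back D (k := p); rewrite addnS -addSn; apply.
exact: (prec_next D).
Qed.

Lemma prec_cell_lt b p q : p < q -> q < N -> p = q %[mod l] -> prec b q p.
Proof.
move=> pq lq /(eqmod_addP (ltnW pq))[j E]; rewrite {q}E in pq lq *.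
elim: j pq lq => [|j IH]; first lia.
rewrite mulSn => _ lq; case: j IH lq => [|j] IH lq.
  by rewrite addn0 in lq *; apply: prec_period.
rewrite addnCA in lq *; rewrite addnC in lq *.
apply: (@prec_trans _ _ (p + j.+1 * l)); first by rewrite (cc_per D).
  exact: prec_period.
by apply: IH; rewrite ?mulSn; lia.
Qed.

Lemma prec_cellE b p q : p < N -> q < N -> p = q %[mod l] -> prec b p q -> q < p.
Proof.
move=> lp lq E H; case: (ltngtP q p) => // [pq|eq].
  by have := prec_asym (cc_mod b (esym E)) H; rewrite prec_cell_lt.
by rewrite eq (negbTE (prec_irr _ _)) in H.
Qed.

(** For [q > p.+1] the order is reversed: if [q] lies in the next cell, this comes from the back
    arrow into [p]; if it lies in the previous cell, one steps from [q] to [q.+1], which lies in the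
    cell of [p]. *)
Lemma prec_bound b p q : p < N -> q < N -> cc b p = cc b q -> prec b p q -> q <= p.+1.
Proof.
move=> lp lq E; case: (leqP q p.+1) => // pq; move/(prec_asym (esym E))/negP; case.
have E' := cc_line D E; case: E' => [E'|[-> E']|[bE E']].
- by apply: prec_cell_lt => //; lia.
- have [//|j qE] := eqmod_addP _ (esym E'); first lia.
  case: j qE => [|j]; [lia | rewrite mulSn => qE].
  have lpl : p + l.+1 < N by lia.
  have bk := prec_back D lpl.
  case: j qE => [|j] qE; first by rewrite qE mul0n addn0 addSn -addnS.
  have qE2 : q = p + l.+1 + j.+1 * l by lia.
  have qM : p + l.+1 = q %[mod l] by rewrite qE2 eqmodD.
  apply: prec_trans bk; first exact: cc_mod.
  by apply: prec_cell_lt => //; lia.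
have [//|j qE] := eqmod_addP _ E'; first lia.
have j1 : 0 < j by case: j qE => //; lia.
case: (ltnP q.+1 N) => Hq.
  apply: (@prec_trans _ _ q.+1); first by rewrite bE (ax_share D).
    by rewrite bE; apply: (prec_next D).
  by apply: prec_cell_lt => //; lia.
(* Here [q] is the last point and has no successor, so the path makes a turn first: [q], [q - l],
   [(q - l).+1], [p]. *)
have Eql : q = q - l + l by lia.
have bE' : b = ax (q - l) by rewrite bE {1}Eql (ax_per D).
have ccE : cc b (q - l) = cc b q by rewrite {2}Eql (cc_per D).
apply: (@prec_trans _ _ (q - l)) => //.
  by rewrite {1}Eql; apply: prec_period; lia.
have H1 : prec b (q - l) (q - l).+1 by rewrite bE'; apply: (prec_next D); lia.
case: j qE j1 => // -[|j] qE _; first by rewrite (_ : p = (q - l).+1) //; lia.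
apply: prec_trans H1 _; first by rewrite bE' (ax_share D).
apply: prec_cell_lt; rewrite ?mulSn in qE *; try lia.
by rewrite (_ : (q - l).+1 = p + j.+1 * l) ?eqmodD // mulSn; lia.
Qed.

Lemma prec_rev b p q : p < N -> q < N -> cc b p = cc b q -> p.+1 < q -> prec b q p.
Proof.
move=> lp lq E pq; have := prec_total lq lp E; case/(_ _)/orP => //; first lia.
by move/(prec_bound lp lq E); lia.
Qed.

End Coil.

End CoilData.

Lemma strict_endo_id d (psi : nat -> nat) :
  (forall j, j < d -> psi j < d) -> (forall j j', j < j' -> j' < d -> psi j < psi j') ->
  forall j, j < d -> psi j = j.
Proof.
move=> into strict.
have ge j : j < d -> j <= psi j.
  elim: j => // j IH lt; have := IH (ltnW lt); have := strict j j.+1 (ltnSn j) lt; lia.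
have up i j : j + i < d -> psi j + i <= psi (j + i).
  elim: i => [|i IH]; rewrite ?addn0 // !addnS => lt.
  have := IH (ltnW lt); have := strict (j + i) (j + i).+1 (ltnSn _) lt; lia.
move=> j lt; have := ge j lt; have := up (d.-1 - j) j; have := into d.-1.
rewrite subnKC; lia.
Qed.

Lemma window_residue l a k : 0 < l -> exists k', a <= k' < a + l /\ k' = k %[mod l].
Proof.
move=> l0; exists (a + (k + l * a - a) %% l); split.
  by rewrite leq_addr ltn_add2l ltn_mod.
rewrite modnDmr subnKC; first by rewrite addnC mulnC modnMDl.
by apply: leq_trans (leq_pmull a l0) _; apply: leq_addl.
Qed.

Lemma eqmod_near l x y : 3 < l -> x = y %[mod l] -> y <= x + 2 -> x <= y + l + 2 ->
  y = x \/ y + l = x.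
Proof.
move=> l3 E yx xy; case: (ltnP x y) => lt.
  by have [[|j]] := eqmod_addP (ltnW lt) E; rewrite ?mulSn; lia.
by have [[|[|j]]] := eqmod_addP lt (esym E); rewrite ?mulSn; lia.
Qed.

(** * A weakly monotone map between long coils is a shift *)

Section Rigidity.
Variables (l : nat) (o : bool -> nat -> bool) (dim : bool -> nat).
Variable nzb : bool -> nat -> nat -> Prop.
Hypothesis l3 : 3 < l.
Hypothesis two_cells : forall b k k1 k2 k',
  nzb b k k1 -> nzb b k k2 -> k1 <> k2 -> nzb b k k' -> k' = k1 \/ k' = k2.
Hypothesis connected : forall P : bool -> nat -> Prop,
  (forall b k k', P b k -> nzb b k k' -> P (~~ b) k') ->
  forall b k, k < dim b -> P b k -> forall b' k', k' < dim b' -> P b' k'.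

Variables (N1 : nat) (X1 cc1 : bool -> nat -> nat) (ax1 : nat -> bool).
Variables (N2 : nat) (X2 cc2 : bool -> nat -> nat) (ax2 : nat -> bool).
Hypotheses (D1 : coil_data l o N1 X1 cc1 ax1) (D2 : coil_data l o N2 X2 cc2 ax2).
Hypotheses (lN1 : l.+1 < N1) (lN2 : l.+1 < N2).
Hypothesis cc1_dim : forall b k, cc1 b k < dim b.
Hypothesis cc2_dim : forall b k, cc2 b k < dim b.
Hypothesis cc2_nz : forall b k, nzb b (cc2 b k) (cc2 (~~ b) k).
Variable g : nat -> nat.
Hypothesis g_lt : forall k, k < N1 -> g k < N2.
Hypothesis g_mono : forall b k k', k < N1 -> k' < N1 ->
  X1 b k < X1 b k' -> X2 b (g k) <= X2 b (g k').
Hypothesis g_fib : forall k k' k'', k < k' -> k' < k'' -> k'' < N1 ->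
  g k = g k' -> g k' = g k'' -> False.
Notation prec1 := (prec o X1 cc1).
Notation prec2 := (prec o X2 cc2).

Lemma cc1_lt_X b k k' : k < N1 -> k' < N1 -> cc1 b k < cc1 b k' -> X1 b k < X1 b k'.
Proof. by move=> lk lk'; rewrite !ltnNge; apply: contra; apply: (cc_mono D1). Qed.

(** Columns and rows form one family of lines, columns first. By [prec_rev] the coil order is
    reversed along a line up to successors, so the line containing [g k] is monotone in [k]. The
    hypothesis on [L] is the conclusion of [constant_stretches]; assuming it keeps [L] independent
    of the coils. *)
Lemma stable_stretch W L :
  (forall (P : nat -> pred nat) (Q : nat -> nat -> nat) a,
    (forall i, i < dim true + dim false -> monotone_on (P i) (Q i) a L) ->
    (forall i k, i < dim true + dim false -> a <= k < a + L -> P i k ->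
       Q i k <= dim true + dim false) ->
    exists a', [/\ a <= a', a' + W <= a + L &
      forall i, i < dim true + dim false -> constant_on (P i) (Q i) a' W]) ->
  L <= N1 ->
  exists a, a + W <= N1 /\ forall b k k', a <= k < a + W -> a <= k' < a + W ->
    cc1 b k = cc1 b k' -> cc2 b (g k) = cc2 b (g k').
Proof.
move=> HL LN.
pose bi i := if i < dim true then (true, i) else (false, i - dim true).
have [i _|i k _ _ _|a [_ le cst]] :=
    HL (fun i k => cc1 (bi i).1 k == (bi i).2) (fun i k => cc2 (bi i).1 (g k)) 0.
- set b := (bi i).1; set j := (bi i).2.
  have key k k' : 0 <= k -> k + 2 <= k' -> k' < 0 + L -> cc1 b k == j -> cc1 b k' == j ->
      if o b j then cc2 b (g k') <= cc2 b (g k) else cc2 b (g k) <= cc2 b (g k').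
    move=> _ le lt /eqP E /eqP E'.
    have lk : k < N1 by lia.
    have lk' : k' < N1 by lia.
    have : prec1 b k' k by apply: (prec_rev l3 D1); rewrite ?E ?E' //; lia.
    rewrite /prec E'; case: (o b j) => H; apply: (cc_mono D2);
      by [apply: g_lt | apply: g_mono].
  rewrite /monotone_on; case: (o b j) key => key; [left | right] => k k'; exact: key.
- have := cc2_dim (bi i).1 (g k); rewrite /bi; case: ifP => _ /=; lia.
exists a; split; first by rewrite add0n in le; lia.
move=> b k k' Hk Hk' E.
have lt := cc1_dim b k.
case: b lt E => lt E.
  have := cst (cc1 true k); rewrite /bi lt /= => /(_ (ltn_addr _ lt)) H.
  by apply: H; rewrite // -?E eqxx.
have := cst (dim true + cc1 false k); rewrite /bi (ltnNge _ (dim true)) leq_addr /= addKn ltn_add2l.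
by move=> /(_ lt) H; apply: H; rewrite // -?E eqxx.
Qed.

Variable a : nat.
Hypothesis aN : a + 5 * l <= N1.
Hypothesis stable : forall b k k', a <= k < a + 5 * l -> a <= k' < a + 5 * l ->
  cc1 b k = cc1 b k' -> cc2 b (g k) = cc2 b (g k').

(** A cell is monotone, so the order along one axis determines the order along the other one,
    reversed if the orientations of the two lines differ. *)
Lemma cell_order b p q : p < N2 -> q < N2 -> (forall b', cc2 b' p = cc2 b' q) ->
  X2 (~~ b) p <= X2 (~~ b) q ->
  if o b (cc2 b p) == o (~~ b) (cc2 (~~ b) p) then X2 b p <= X2 b q else X2 b q <= X2 b p.
Proof.
move=> lp lq E; have pq := cc_inj l3 D2 lN2 E.
have := prec_cell D2 lp lq pq; have := prec_cell D2 lq lp (esym pq).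
rewrite /prec -!E; case: b; case: (o true _); case: (o false _) => /=; lia.
Qed.

(* Two interleaved cells of a line cannot be mapped into one monotone cell. *)
Lemma image_next_ne_base k : a <= k -> k.+1 + 2 * l < a + 5 * l ->
  cc2 (~~ ax1 k) (g k.+1) <> cc2 (~~ ax1 k) (g k).
Proof.
move=> ak kl E; set b := ax1 k in E *.
have per b' x j : cc1 b' (x + j * l) = cc1 b' x by exact: (cc_perM D1).
pose A j := k + j * l; pose B j := k.+1 + j * l.
have stA b' j : j <= 2 -> cc2 b' (g (A j)) = cc2 b' (g k).
  by case: j => [|[|[]]] // _; apply: stable; rewrite /A ?per //; lia.
have stB b' j : j <= 2 -> cc2 b' (g (B j)) = cc2 b' (g k).
  have -> // : cc2 b' (g k) = cc2 b' (g k.+1).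
    case: (eqVneq b' b) => [->|ne].
      by apply/esym/stable; rewrite ?(ax_share D1) //; lia.
    by have -> : b' = ~~ b by move: ne; case: (b'); case: (b).
  by case: j => [|[|[]]] // _; apply: stable; rewrite /B ?per //; lia.
have lA j : j <= 2 -> A j < N1 by rewrite /A; case: j => [|[|[]]] // _; lia.
have lB j : j <= 2 -> B j < N1 by rewrite /B; case: j => [|[|[]]] // _; lia.
have pAB j : j <= 2 -> prec1 b (A j) (B j).
  move=> j2; have := prec_next D1 (k := A j); rewrite /A (ax_perM D1) /B addSn.
  by apply; exact: lB.
have pBA j : j < 2 -> prec1 b (B j.+1) (A j).
  move=> j2; have := prec_back D1 (k := A j); rewrite /A (ax_perM D1).
  have -> : B j.+1 = k + j * l + l.+1 by rewrite /B mulSn; lia.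
  by apply; have := lB j.+1 j2; rewrite /B mulSn; lia.
have ccA j : cc1 b (A j) = cc1 b k by exact: per.
have ccB j : cc1 b (B j) = cc1 b k by rewrite [LHS]per (ax_share D1).
have X2_AB i j : i <= 2 -> j <= 2 -> 
  if (o b (cc2 b (g k)) == o (~~ b) (cc2 (~~ b) (g k))) == (cc1 (~~ b) k < cc1 (~~ b) k.+1)
  then X2 b (g (A i)) <= X2 b (g (B j)) else X2 b (g (B j)) <= X2 b (g (A i)).
  move=> i2 j2; have cA : cc1 (~~ b) (A i) = cc1 (~~ b) k by exact: per.
  have cB : cc1 (~~ b) (B j) = cc1 (~~ b) k.+1 by exact: per.
  have gA := g_lt (lA _ i2); have gB := g_lt (lB _ j2).
  case: (ltngtP (cc1 (~~ b) k) (cc1 (~~ b) k.+1)) => [lt|gt|E1]; last first.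
  - by have := cc_next_ne l3 D1 lN1 (k := k); rewrite -/b E1.
  - have := @cc1_lt_X (~~ b) (B j) (A i) (lB _ j2) (lA _ i2); rewrite cA cB gt.
    move=> /(_ isT)/(g_mono (lB _ j2) (lA _ i2))/(cell_order gB gA).
    rewrite !stB //; case: eqP => // _; apply=> b'; by rewrite stA // stB.
  have := @cc1_lt_X (~~ b) (A i) (B j) (lA _ i2) (lB _ j2); rewrite cA cB lt.
  move=> /(_ isT)/(g_mono (lA _ i2) (lB _ j2))/(cell_order gA gB).
  rewrite !stA //; case: eqP => // _; apply=> b'; by rewrite stA // stB.
have mAB j : j <= 2 -> if o b (cc1 b k) then X2 b (g (A j)) <= X2 b (g (B j))
    else X2 b (g (B j)) <= X2 b (g (A j)).
  move=> j2; have := pAB j j2; rewrite /prec ccA; case: (o b (cc1 b k)) => H;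
    apply: g_mono => //; by [apply: lA | apply: lB].
have mBA j : j < 2 -> if o b (cc1 b k) then X2 b (g (B j.+1)) <= X2 b (g (A j))
    else X2 b (g (A j)) <= X2 b (g (B j.+1)).
  move=> j2; have := pBA j j2; rewrite /prec ccB; case: (o b (cc1 b k)) => H;
    apply: g_mono => //; by [apply/lA/ltnW | apply: lB].
(* Along [b] the order is [A 2], [B 2], [A 1], [B 1], [A 0], [B 0], or its reverse, while [X2_AB]
   puts the images of all [A i] weakly on one side of those of all [B j]. Together these force
   [A 1], [B 1] and [B 2] into one fibre. *)
have E1 : X2 b (g (A 1)) = X2 b (g (B 1)) /\ X2 b (g (B 1)) = X2 b (g (B 2)).
  have := mAB 0 isT; have := mAB 1 isT; have := mAB 2 isT.
  have := mBA 0 isT; have := mBA 1 isT.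
  have := X2_AB 0 2 isT isT; have := X2_AB 2 0 isT isT.
  by case: (o b (cc1 b k)); case: (_ == _ :> bool); lia.
case: E1 => E1 E2.
apply: (@g_fib (A 1) (B 1) (B 2)); rewrite /A /B; try lia.
  by apply: (X_inj D2) E1; apply: g_lt; [apply: lA | apply: lB].
by apply: (X_inj D2) E2; apply: g_lt; apply: lB.
Qed.

Lemma image_next_ne k : a <= k -> k.+1 < a + 5 * l ->
  cc2 (~~ ax1 k) (g k.+1) <> cc2 (~~ ax1 k) (g k).
Proof.
move=> ak kl; have [k' [Hk' kk']] := window_residue a k (ltnW (ltnW (ltnW l3))).
have := @image_next_ne_base k'; rewrite (ax_mod D1 kk') => H E; apply: H; try lia.
have kkS : k'.+1 = k.+1 %[mod l] by rewrite -addn1 -modnDml kk' modnDml addn1.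
rewrite (@stable _ k'.+1 k.+1) ?(@stable _ k' k) //; try lia.
  by apply: (cc_mod D1).
by apply: (cc_mod D1).
Qed.

(** Consecutive indices share a line, but their images lie in different crossing lines. Thus both
    non-zero cells of every line that the image meets are met, and connectedness of the line graph
    reaches all lines. *)
Lemma image_surj b i : i < dim b -> exists k, a <= k < a + 5 * l /\ cc2 b (g k) = i.
Proof.
have Ha : a <= a < a + 5 * l by lia.
apply: (connected (P := fun b i => exists k, a <= k < a + 5 * l /\ cc2 b (g k) = i)
  _ (cc2_dim true (g a))); last by exists a.
move=> {b i} b _ i' [k [Hk <-]] nz.
have [k' [Hk' kk']] := window_residue a.+1 k (ltnW (ltnW (ltnW l3))).
have Ek b' : cc2 b' (g k) = cc2 b' (g k').
  by apply: stable; try lia; apply: (cc_mod D1).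
have adj k1 k2 : a <= k1 < a + 5 * l -> a <= k2 < a + 5 * l ->
    cc2 b (g k1) = cc2 b (g k') -> cc2 b (g k2) = cc2 b (g k') ->
    cc2 (~~ b) (g k1) <> cc2 (~~ b) (g k2) ->
    exists k0, a <= k0 < a + 5 * l /\ cc2 (~~ b) (g k0) = i'.
  move=> H1 H2 E1 E2 ne.
  have n1 := cc2_nz b (g k1); have n2 := cc2_nz b (g k2).
  rewrite E1 in n1; rewrite E2 in n2; rewrite Ek in nz.
  by case: (two_cells n1 n2 ne nz) => ->; [exists k1 | exists k2].
case: (eqVneq b (ax1 k')) => [bE|bE].
  apply: (adj k'.+1 k'); try lia.
    by apply: stable; try lia; rewrite bE (ax_share D1).
  by rewrite bE; apply: image_next_ne; lia.
case: k' Hk' kk' Ek adj bE => [|k'] Hk' kk' Ek adj; first by lia.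
rewrite (ax_alt D1) => bE; have {}bE : b = ax1 k' by move: bE; case: (b); case: (ax1 k').
apply: (adj k'.+1 k'); try lia.
  by apply: stable; try lia; rewrite bE (ax_share D1).
by rewrite bE; apply: image_next_ne; lia.
Qed.

(** Choose for each line a line of the first coil that is mapped into it. The choice is strictly
    increasing because [g] is monotone, and a strictly increasing self-map of a finite chain is the
    identity. *)
Lemma image_cell b k : a <= k < a + 5 * l -> cc2 b (g k) = cc1 b k.
Proof.
have surj i : exists j, i < dim b ->
    j < dim b /\ exists k, [/\ a <= k < a + 5 * l, cc2 b (g k) = i & cc1 b k = j].
  case: (ltnP i (dim b)) => [lt|]; last by exists 0.
  have [k0 [Hk Ek]] := image_surj lt.
  by exists (cc1 b k0) => _; split=> //; exists k0.
have [psi Hpsi] := choice_fun surj.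
have psi_id : forall j, j < dim b -> psi j = j.
  apply: strict_endo_id => [j /Hpsi[] //|j j' jj' lj'].
  have [_ [k1 [H1 E1 F1]]] := Hpsi j (ltn_trans jj' lj').
  have [_ [k2 [H2 E2 F2]]] := Hpsi j' lj'.
  case: (ltngtP (psi j) (psi j')) => // [lt|eq].
    rewrite -F1 -F2 in lt.
    have := cc_mono D2 (b := b) (g_lt (k := k2) _) (g_lt (k := k1) _).
    rewrite E1 E2 => H; have : j' <= j; last lia.
    apply: H; try lia.
    by apply: g_mono; try lia; apply: cc1_lt_X => //; lia.
  by have := @stable b k1 k2 H1 H2; rewrite E1 E2 F1 F2 eq; lia.
move=> Hk; have lt := cc1_dim b k.
have [_ [k' [Hk' Ek' Fk']]] := Hpsi _ lt.
by rewrite -Ek'; apply: stable; rewrite // Fk' psi_id.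
Qed.

Lemma prec_image b k k' : k < N1 -> k' < N1 -> cc2 b (g k) = cc1 b k ->
  prec1 b k k' -> g k <> g k' -> prec2 b (g k) (g k').
Proof.
move=> lk lk' E H ne.
have neX : X2 b (g k) <> X2 b (g k') by move/(X_inj D2 (g_lt lk) (g_lt lk')).
move: H; rewrite /prec E; case: (o b _) => H.
  by have := g_mono lk lk' H; lia.
by have := g_mono lk' lk H; lia.
Qed.

Lemma g_next_ne k : a <= k -> k.+1 < a + 5 * l -> g k.+1 <> g k.
Proof. by move=> ak kl E; apply: (image_next_ne ak kl); rewrite E. Qed.

Lemma g_next_le k : a <= k -> k.+1 < a + 5 * l -> g k.+1 <= (g k).+1.
Proof.
move=> ak kl.
have Ek : cc2 (ax1 k) (g k) = cc1 (ax1 k) k by apply: image_cell; lia.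
apply: (prec_bound l3 D2 lN2 (b := ax1 k)); try (apply: g_lt; lia).
  by rewrite Ek image_cell ?(ax_share D1) //; lia.
apply: prec_image => //; try lia.
  by apply: (prec_next D1); lia.
exact/nesym/g_next_ne.
Qed.

(** The two images lie in one cell and [g (k + l)] strictly precedes [g k], so its index is larger,
    by a multiple of [l]. *)
Lemma g_period_ge k : a <= k -> (k + l).+1 < a + 5 * l -> g k + l <= g (k + l).
Proof.
move=> ak kl; set b := ax1 k.
have p1 : prec1 b (k + l) (k + l).+1.
  by rewrite /b -(ax_per D1); apply: (prec_next D1); lia.
have p2 : prec1 b (k + l).+1 k by rewrite -addnS; apply: (prec_back D1); lia.
have c1 : cc1 b (k + l).+1 = cc1 b (k + l) by rewrite /b -(ax_per D1) (ax_share D1).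
(* Otherwise the image of [(k + l).+1], which lies weakly between the two, would coincide with
   them. *)
have ne : g (k + l) <> g k.
  move=> E; apply: (@g_next_ne (k + l)); try lia.
  apply: (X_inj D2 (b := b)); try (apply: g_lt; lia).
  move: p1 p2; rewrite /prec c1; have lk : k < N1 by lia.
  have lkl : k + l < N1 by lia.
  have lkl1 : (k + l).+1 < N1 by lia.
  case: (o b _) => H1 H2.
    by have := g_mono lkl lkl1 H1; have := g_mono lkl1 lk H2; rewrite E; lia.
  by have := g_mono lkl1 lkl H1; have := g_mono lk lkl1 H2; rewrite E; lia.
have E b' : cc2 b' (g k) = cc2 b' (g (k + l)).
  by rewrite !image_cell ?(cc_per D1) //; lia.
have := cc_inj l3 D2 lN2 E => Em.
have lt : g k < g (k + l).
  apply: (prec_cellE l3 D2 lN2 (b := b)) (esym Em) _; try (apply: g_lt; lia).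
  apply: prec_image; try lia; first by apply: image_cell; lia.
  exact: prec_trans c1 p1 p2.
have [j Ej] := eqmod_addP (ltnW lt) Em; case: j Ej => [|j]; rewrite ?mulSn; lia.
Qed.

(** One step raises [g] by at most one and a turn of [l] steps raises it by at least [l], so every
    step raises it by exactly one. *)
Lemma g_shift_base i : i <= 2 * l + 2 -> g (a + i) + a = a + i + g a.
Proof.
elim: i => [|i IH] Hi; first by rewrite addn0 addnC.
have {IH} := IH (ltnW Hi); set k := a + i; rewrite addnS -/k => IH.
have up j : k + j < a + 5 * l -> g (k + j) <= g k + j.
  elim: j => [|j IHj]; rewrite ?addn0 // !addnS => lt.
  have := IHj (ltnW lt); have := @g_next_le (k + j); lia.
have up1 j : k.+1 + j < a + 5 * l -> g (k.+1 + j) <= g k.+1 + j.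
  elim: j => [|j IHj]; rewrite ?addn0 // !addnS => lt.
  have := IHj (ltnW lt); have := @g_next_le (k.+1 + j); lia.
have := g_period_ge (k := k); have := up 1; have := up1 l.-1.
rewrite addn1 (_ : k.+1 + l.-1 = k + l); lia.
Qed.

Notation good k := (g k + a = k + g a).

(** The lines agree on the stretch by [image_cell], and both cell sequences have period [l]. *)
Lemma aligned b k k' : k' + a = k + g a -> cc2 b k' = cc1 b k.
Proof.
move=> E; have [k0 [Hk0 kk0]] := window_residue a k (ltnW (ltnW (ltnW l3))).
have G : good k0 by have := @g_shift_base (k0 - a); rewrite subnKC; lia.
rewrite -(cc_mod D1 b kk0) -image_cell; last lia.
apply: (cc_mod D2); apply/eqP; rewrite -(eqn_modDr a) G E eqn_modDr; exact/eqP.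
Qed.

Lemma aligned_ax k k' : k' + a = k + g a -> ax2 k' = ax1 k.
Proof.
move=> E; have ES : k'.+1 + a = k.+1 + g a by rewrite !addSn E.
have := cc_next_ne l3 D2 lN2 (k := k'); rewrite (aligned _ E) (aligned _ ES).
case: (eqVneq (ax2 k') (ax1 k)) => // ne.
by have -> : ~~ ax2 k' = ax1 k; [move: ne; case: (ax2 k'); case: (ax1 k) | rewrite (ax_share D1)].
Qed.

(** A point [z] in another line is on the same side of [x] and of [w]; weak monotonicity keeps its
    image on that side of both images, whereas [g y] lies strictly between them. *)
Lemma sandwich b x y w z : x < N1 -> y < N1 -> w < N1 -> z < N1 ->
  cc1 b x = cc1 b y -> cc1 b w = cc1 b y -> cc2 b (g x) = cc2 b (g y) ->
  prec2 b (g x) (g y) -> prec2 b (g y) (g w) -> g z = g y -> cc1 b z = cc1 b y.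
Proof.
move=> lx ly lw lz cx cw c2; rewrite /prec c2 => p1 p2 E.
case: (ltngtP (cc1 b z) (cc1 b y)) => // lt.
  have := @cc1_lt_X b z x lz lx; rewrite cx lt => /(_ isT)/(g_mono lz lx).
  have := @cc1_lt_X b z w lz lw; rewrite cw lt => /(_ isT)/(g_mono lz lw).
  by rewrite E; case: (o b _) p1 p2; lia.
have := @cc1_lt_X b x z lx lz; rewrite cx lt => /(_ isT)/(g_mono lx lz).
have := @cc1_lt_X b w z lw lz; rewrite cw lt => /(_ isT)/(g_mono lw lz).
by rewrite E; case: (o b _) p1 p2; lia.
Qed.

Lemma good_prec b x y : good x -> good y -> x <> y -> x < N1 -> y < N1 ->
  prec1 b x y -> prec2 b (g x) (g y).
Proof.
move=> Gx Gy ne lx ly p; apply: prec_image => //; last lia.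
exact: aligned.
Qed.

(* In its two lines a coil point lies between its neighbours in the coil order
   and those one turn away, which excludes a second preimage in another cell. *)
Lemma sandwich_up q z : good q -> good (q + l) -> good (q + l).+1 ->
  (q + l).+1 < N1 -> z < N1 -> g z = g (q + l).+1 -> cc1 (ax1 q) z = cc1 (ax1 q) q.+1.
Proof.
move=> G1 G2 G3 lt lz E.
have c3 : cc1 (ax1 q) (q + l).+1 = cc1 (ax1 q) q by rewrite -(ax_per D1) (ax_share D1) (cc_per D1).
have c2 : cc1 (ax1 q) (q + l) = cc1 (ax1 q) q by rewrite (cc_per D1).
rewrite (ax_share D1) -c3.
apply: (@sandwich _ (q + l) (q + l).+1 q) => //; try lia; rewrite ?c2 ?c3 //.
- by rewrite (aligned _ G2) (aligned _ G3) c2 c3.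
- by apply: good_prec => //; try lia; rewrite -(ax_per D1); apply: (prec_next D1).
by apply: good_prec => //; try lia; rewrite -addnS; apply: (prec_back D1); rewrite addnS.
Qed.

Lemma sandwich_down k z : good k -> good k.+1 -> good (k + l).+1 ->
  (k + l).+1 < N1 -> z < N1 -> g z = g k -> cc1 (ax1 k) z = cc1 (ax1 k) k.
Proof.
move=> G1 G2 G3 lt lz E.
have c3 : cc1 (ax1 k) (k + l).+1 = cc1 (ax1 k) k by rewrite -(ax_per D1) (ax_share D1) (cc_per D1).
apply: (@sandwich _ (k + l).+1 k k.+1) => //; try lia; rewrite ?(ax_share D1) //.
- by rewrite (aligned _ G1) (aligned _ G3) c3.
- by apply: good_prec => //; try lia; rewrite -addnS; apply: (prec_back D1); rewrite addnS.
by apply: good_prec => //; try lia; apply: (prec_next D1); lia.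
Qed.

Lemma between_line b x q w : x < N1 -> q < N1 -> w < N1 -> 
  cc1 b q = cc1 b x -> cc2 b (g w) = cc2 b (g x) ->
  prec1 b x q -> prec1 b q w -> cc2 b (g q) = cc2 b (g x).
Proof.
move=> lx lq lw c1 c2; rewrite /prec c1.
have mo k k' : k < N1 -> k' < N1 -> X1 b k < X1 b k' -> cc2 b (g k) <= cc2 b (g k').
  by move=> lk lk' H; apply: (cc_mono D2); [apply: g_lt | apply: g_lt | apply: g_mono].
by case: (o b _) => H1 H2; have := mo _ _ _ _ H1; have := mo _ _ _ _ H2; lia.
Qed.

(** In the line shared by [e] and [e.+1], the image of [e.+1] lies between those of [e] and [e - l],
    and differs from both by sandwiching along the other axis. Then [prec_bound] and [cc_line] leave
    only the successor of [g e]. The history of [2 * l + 1] indices is what the second sandwich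
    uses, around [e - l]. *)
Lemma good_up e : 2 * l + 1 <= e -> (forall i, i <= 2 * l + 1 -> good (e - i)) ->
  e.+1 < N1 -> good e.+1.
Proof.
move=> le G lt; pose u := e - l; have eE : e = u + l by rewrite /u; lia.
have Ge : good e by rewrite -(subn0 e); apply: G.
have Gu : good u by apply: G; lia.
set b := ax1 e; have bu : b = ax1 u by rewrite /b eE (ax_per D1).
have p1 : prec1 b e e.+1 by exact: (prec_next D1).
have p2 : prec1 b e.+1 u by rewrite bu eE -addnS; apply: (prec_back D1); lia.
set q := g e.+1; set p := g e.
have gu : p = g u + l by rewrite /p; lia.
have lu : u < N1 by lia.
have le' : e < N1 by lia.
have qp : q <> p.
  move=> E; pose v := u.-1; have vE : (v + l).+1 = e by rewrite /v; lia.
  have axv : ax1 v = ~~ b by rewrite bu (_ : u = v.+1) ?(ax_alt D1) ?negbK //; lia.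
  have := @sandwich_up v e.+1; rewrite vE axv => H.
  apply: (cc_next_ne l3 D1 lN1 (k := e)); rewrite -/b H //; try (apply: G; lia).
  - by rewrite -(cc_per D1) addSn vE.
  - by rewrite (_ : v = e - l.+1); [apply: G; lia | lia].
  by rewrite (_ : v + l = e - 1); [apply: G; lia | lia].
have qu : q <> g u.
  move=> E; pose v := u - l.+1; have vE : (v + l).+1 = u by rewrite /v; lia.
  have axv : ax1 v = ~~ b by rewrite bu -vE (ax_alt D1) (ax_per D1) negbK.
  have := @sandwich_up v e.+1; rewrite vE axv => H.
  apply: (cc_next_ne l3 D1 lN1 (k := e)); rewrite -/b H //.
  - by rewrite -(cc_per D1) addSn vE eE (cc_per D1).
  - by rewrite (_ : v = e - (2 * l + 1)); [apply: G; lia | rewrite /v; lia].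
  by rewrite (_ : v + l = e - l.+1); [apply: G; lia | rewrite /v; lia].
have cu : cc2 b (g u) = cc2 b p.
  by rewrite (aligned _ Gu) (aligned _ Ge) eE (cc_per D1).
have cq : cc2 b q = cc2 b p.
  by apply: (between_line (w := u)) => //; rewrite (ax_share D1).
have r1 : prec2 b p q.
  by apply: prec_image => //; [exact: aligned | exact: nesym].
have r2 : prec2 b q (g u).
  apply: prec_image => //.
  by rewrite -/q cq (aligned _ Ge) (ax_share D1).
have q1 : q <= p.+1 by apply: (prec_bound l3 D2 lN2) r1 => //; apply: g_lt.
have q2 : g u <= q.+1 by apply: (prec_bound l3 D2 lN2) r2; rewrite ?cu //; apply: g_lt.
have axp : ax2 p = b by exact: aligned_ax.
suff : q = p.+1 by lia.
have axgu : ax2 (g u) = b by rewrite bu; exact: aligned_ax.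
have q3 : p <= q + l.+1 by rewrite gu addnS -addSn leq_add2r.
move: q1 q3 => {q2} q1 q3.
case: (cc_line D2 (esym cq)) => [E|[_ E]|[bq E]].
- case: (eqmod_near l3 E) => [||//|qlp].
  + by apply: leq_trans q1 _; rewrite addn2.
  + by apply: leq_trans q3 _; rewrite -addnA leq_add2l addn2 ltnW.
  by case: qu; apply/(@addIn l); rewrite qlp.
- case: (eqmod_near l3 (esym E)) => [||//|].
  + by apply: leq_trans q1 _; apply: leq_addr.
  + by rewrite addn2 ltnS -addnS.
  rewrite gu -addSn => /addIn qE.
  have := prec_next D2 (k := g u); rewrite axgu -qE => /(_ (g_lt lt)).
  have cgq : cc2 b (g u) = cc2 b q by rewrite cu.
  by move/(prec_asym (esym cgq)); rewrite r2.
have := ax_alt D2 q; rewrite -bq -axp (ax_mod D2 E).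
by case: (ax2 _).
Qed.

(** The mirror image of the upward step: in their common line [u] lies between [(u + l).+1] and
    [u.+1]. *)
Lemma good_down u : (forall i, i <= 2 * l + 2 -> good (u.+1 + i)) ->
  u.+1 + (2 * l + 2) < N1 -> good u.
Proof.
move=> G lt.
have Gi v i : v = u.+1 + i -> i <= 2 * l + 2 -> good v by move=> ->; apply: G.
have G1 : good u.+1 by apply: (@Gi _ 0); lia.
have Gl : good (u + l).+1 by apply: (@Gi _ l); lia.
set b := ax1 u; have bu : ax1 u.+1 = ~~ b by rewrite (ax_alt D1).
have p1 : prec1 b (u + l).+1 u by rewrite -addnS; apply: (prec_back D1); lia.
have p2 : prec1 b u u.+1 by apply: (prec_next D1); lia.
set q := g u; set p := g u.+1.
have gl : g (u + l).+1 = p + l by rewrite /p; lia.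
have qp : q <> p.
  move=> E; have := @sandwich_down u.+1 u; rewrite bu => H.
  apply: (cc_next_ne l3 D1 lN1 (k := u)); rewrite -/b H //; try lia.
  - by apply: (@Gi _ 1); lia.
  by apply: (@Gi _ l.+1); lia.
have qpl : q <> g (u + l).+1.
  move=> E; have := @sandwich_down (u + l).+1 u.
  rewrite (_ : ax1 (u + l).+1 = ~~ b) => [H|]; last by rewrite -addSn (ax_per D1).
  apply: (cc_next_ne l3 D1 lN1 (k := u)); rewrite -/b H //; try lia.
  - by rewrite -addSn (cc_per D1).
  - by apply: (@Gi _ l.+1); lia.
  by apply: (@Gi _ (2 * l + 1)); lia.
have lu : u < N1 by lia.
have lu1 : u.+1 < N1 by lia.
have lul : (u + l).+1 < N1 by lia.
have cul : cc1 b (u + l).+1 = cc1 b u by rewrite -addSn (cc_per D1) (ax_share D1).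
have cl : cc2 b p = cc2 b (g (u + l).+1).
  by rewrite (aligned _ Gl) (aligned _ G1) cul (ax_share D1).
have cq : cc2 b q = cc2 b (g (u + l).+1).
  by apply: (between_line (w := u.+1)).
have r1 : prec2 b (g (u + l).+1) q.
  by apply: prec_image => //; [exact: aligned | exact: nesym].
have r2 : prec2 b q p.
  by apply: prec_image => //; rewrite -/q cq (aligned _ Gl) cul.
have q1 : q <= (p + l).+1.
  by rewrite -gl; apply: (prec_bound l3 D2 lN2) r1 => //; apply: g_lt.
have q2 : p <= q.+1 by apply: (prec_bound l3 D2 lN2) r2; rewrite ?cl //; apply: g_lt.
have axp : ax2 p = ~~ b by rewrite -bu; exact: aligned_ax.
suff : q.+1 = p by lia.
have cqp : cc2 b q = cc2 b p by rewrite cl.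
have pl : p + l = p %[mod l] by rewrite modnDr.
case: (cc_line D2 cqp) => [E|[bq E]|[bp _]]; last by rewrite axp in bp; case: (b) bp.
- case: (@eqmod_near l (p + l) q l3) => [||||/addIn//].
  + by rewrite pl.
  + by apply: leq_trans q1 _; rewrite addn2 ltnW.
  + by apply: leq_trans (leq_add q2 (leqnn l)) _; rewrite addSn addn2 ltnW.
  by rewrite -gl.
case: (@eqmod_near l (p + l) q.+1 l3) => [||||/addIn//].
+ by rewrite pl E.
+ by rewrite addn2 ltnS.
+ by apply: leq_trans (leq_add q2 (leqnn l)) _; apply: leq_addr.
rewrite -gl => qE.
have := prec_next D2 (k := q); rewrite -bq qE => /(_ (g_lt lul)).
by have := prec_asym cq r1 => /negbTE ->.
Qed.

Lemma good_all k : k < N1 -> good k.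
Proof.
have base i : a <= i <= a + (2 * l + 2) -> good i.
  by move=> Hi; have := @g_shift_base (i - a); rewrite subnKC; lia.
have up e : e < N1 -> a <= e -> good e.
  elim/ltn_ind: e => -[|e] IH le ae; first by apply: base; lia.
  case: (leqP e.+1 (a + (2 * l + 2))) => H; first by apply: base; lia.
  by apply: good_up => //; try lia; move=> i Hi; apply: IH; lia.
have down i : i <= a -> good (a - i).
  elim/ltn_ind: i => -[|i] IH ia; first by apply: base; lia.
  apply: good_down; last lia.
  move=> j Hj; case: (leqP (a - i.+1).+1 (a - j)) => H; last by apply: up; lia.
  rewrite (_ : (a - i.+1).+1 + j = a - (i - j)); [apply: IH; lia | lia].
move=> lt; case: (leqP a k) => H; first exact: up.
by rewrite (_ : k = a - (a - k)); [apply: down; lia | lia].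
Qed.

End Rigidity.

(** * Lines and cells of a gridding, and the cycle formed by the lines *)

Section Lines.

(** Searching for the first grid line beyond [x] skips the empty strips that arise when grid lines
    coincide. *)
Definition lnum (v : nat -> nat) (m x : nat) : nat := find (fun i => x < v i.+1) (iota 0 m).

Variables (m : nat) (v : nat -> nat).
Hypotheses (v0 : v 0 = 0) (vmono : forall i, i < m -> v i <= v i.+1).

Lemma grid_line_mono i j : i <= j -> j <= m -> v i <= v j.
Proof.
elim: j => [|j IH]; first by rewrite leqn0 => /eqP->.
rewrite leq_eqVlt => /orP[/eqP-> //|ij] jm.
by apply: leq_trans (vmono jm); apply: IH => //; apply: ltnW.
Qed.

Lemma lnum_bounds x : x < v m -> lnum v m x < m /\ v (lnum v m x) <= x < v (lnum v m x).+1.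
Proof.
move=> lx; have m0 : 0 < m by case: m lx => //; rewrite v0.
have hs : has (fun i => x < v i.+1) (iota 0 m).
  by apply/hasP; exists m.-1; [rewrite mem_iota; lia | rewrite prednK].
have lm : lnum v m x < m by move: hs; rewrite has_find size_iota.
split=> //; have := nth_find 0 hs; rewrite -/(lnum v m x) nth_iota // add0n => ->.
rewrite andbT; case E: (lnum v m x) => [|i]; first by rewrite v0.
have := @before_find _ 0 (fun i => x < v i.+1) (iota 0 m) i.
rewrite -/(lnum v m x) E ltnSn => /(_ isT)/negbT; rewrite nth_iota ?add0n -?leqNgt //.
by rewrite E in lm; apply: ltnW.
Qed.

Lemma lnum_uniq i x : i < m -> v i <= x < v i.+1 -> lnum v m x = i.
Proof.
move=> im /andP[H1 H2].
have xm : x < v m by apply: leq_trans H2 _; apply: grid_line_mono.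
have [lm /andP[H3 H4]] := lnum_bounds xm.
case: (ltngtP (lnum v m x) i) => // lt.
  by have := @grid_line_mono (lnum v m x).+1 i lt (ltnW im); lia.
by have := @grid_line_mono i.+1 (lnum v m x) lt (ltnW lm); lia.
Qed.

Lemma lnum_mono x y : y < v m -> x <= y -> lnum v m x <= lnum v m y.
Proof.
move=> ly xy; have [l1 /andP[H1 H2]] := lnum_bounds ly.
have [l3 /andP[H3 H4]] := lnum_bounds (leq_ltn_trans xy ly).
rewrite leqNgt; apply/negP => lt.
by have := @grid_line_mono _ _ lt (ltnW l3); lia.
Qed.

End Lines.

Section GridFacts.
Variables (m n : nat) (M : 'M[int]_(m, n)) (c : 'I_m -> int) (r : 'I_n -> int).

Definition gdim (b : bool) : nat := if b then m else n.
Definition raw (s : seq nat) (b : bool) (x : nat) : nat := if b then x else nth 0 s x.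
Definition line (s : seq nat) (v h : nat -> nat) (b : bool) (x : nat) : nat :=
  if b then lnum v m x else lnum h n (nth 0 s x).
(** The edges of the row-column graph, with a boolean for the kind of the first line so that columns
    and rows are treated alike. *)
Definition nzline (b : bool) (k k' : nat) : Prop :=
  exists (i : 'I_m) (j : 'I_n), [/\ M i j != 0%R, (if b then k else k') = i &
    (if b then k' else k) = j].
(** Lines are numbered by natural numbers, as [coil_data] requires; out of range the value is
    [false]. *)
Definition orient (b : bool) (k : nat) : bool :=
  if b then [exists i : 'I_m, (i == k :> nat) && (c i == 1%R)]
  else [exists j : 'I_n, (j == k :> nat) && (r j == 1%R)].

Lemma orient_col (i : 'I_m) : orient true i = (c i == 1%R).
Proof.
apply/existsP/idP => [[i' /andP[/eqP/val_inj-> //]]|H].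
by exists i; rewrite eqxx.
Qed.

Lemma orient_row (j : 'I_n) : orient false j = (r j == 1%R).
Proof.
apply/existsP/idP => [[i' /andP[/eqP/val_inj-> //]]|H].
by exists j; rewrite eqxx.
Qed.

Lemma nzline_dim b k k' : nzline b k k' -> k < gdim b /\ k' < gdim (~~ b).
Proof. by case: b => -[i [j [_ -> ->]]]. Qed.

Section Gridded.
Variables (s : seq nat) (v h : nat -> nat).
Hypotheses (Hs : is_perm s) (Hg : is_gridding M s v h).
Notation line := (line s v h).
Notation raw := (raw s).

Lemma line_bounds b x : x < size s -> line b x < gdim b /\
  (if b then v else h) (line b x) <= raw b x < (if b then v else h) (line b x).+1.
Proof.
have [v0 [vm [h0 [hn [vmo [hmo _]]]]]] := Hg.
move=> lx; case: b; apply: lnum_bounds; rewrite ?vm ?hn //.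
exact: is_perm_nth_lt.
Qed.

Lemma line_uniq b k x : k < gdim b ->
  (if b then v else h) k <= raw b x < (if b then v else h) k.+1 -> line b x = k.
Proof.
have [v0 [vm [h0 [hn [vmo [hmo _]]]]]] := Hg.
by case: b => lk H; apply: lnum_uniq.
Qed.

Lemma line_mono b x y : x < size s -> y < size s -> raw b x <= raw b y -> line b x <= line b y.
Proof.
have [v0 [vm [h0 [hn [vmo [hmo _]]]]]] := Hg.
by move=> lx ly; case: b => H; apply: lnum_mono; rewrite ?vm ?hn //; apply: is_perm_nth_lt.
Qed.

Lemma raw_inj b x y : x < size s -> y < size s -> raw b x = raw b y -> x = y.
Proof. by case: b => // lx ly; apply: is_perm_nth_inj. Qed.

Lemma in_colE (i : 'I_m) x : x < size s -> in_col v i x = (line true x == i :> nat).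
Proof.
move=> lx; rewrite /in_col; apply/idP/eqP => [H|<-].
  by apply: (@line_uniq true) => /=.
by have [] := line_bounds true lx.
Qed.

Lemma in_rowE (j : 'I_n) x : x < size s -> in_row s h j x = (line false x == j :> nat).
Proof.
move=> lx; rewrite /in_row; apply/idP/eqP => [H|<-].
  by apply: (@line_uniq false) => /=.
by have [] := line_bounds false lx.
Qed.

Lemma in_cellE (i : 'I_m) (j : 'I_n) x : x < size s ->
  in_cell s v h x i j = (line true x == i :> nat) && (line false x == j :> nat).
Proof. by move=> lx; rewrite /in_cell in_colE // in_rowE. Qed.

Lemma cell_ex x : x < size s ->
  exists (i : 'I_m) (j : 'I_n), [/\ line true x = i, line false x = j & M i j != 0%R].
Proof.
move=> lx; have [li _] := line_bounds true lx; have [lj _] := line_bounds false lx.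
exists (Ordinal li), (Ordinal lj); split=> //.
have [_ [_ [_ [_ [_ [_ H]]]]]] := Hg.
have ic : in_cell s v h x (Ordinal li) (Ordinal lj) by rewrite in_cellE // !eqxx.
by have [] := H _ _ _ _ lx lx ic ic.
Qed.

Lemma line_nz b x : x < size s -> nzline b (line b x) (line (~~ b) x).
Proof. by move=> lx; have [i [j [H1 H2 H3]]] := cell_ex lx; case: b; exists i, j. Qed.

Definition ltl (b : bool) (x y : nat) : bool :=
  if orient b (line b x) then raw b x < raw b y else raw b y < raw b x.

(** The sign rule [M i j = c i * r j] makes a cell increasing exactly when its column and its row
    carry the same sign. *)
Lemma ltl_cell x y : partial_mult M c r -> x < size s -> y < size s ->
  (forall b, line b x = line b y) -> ltl true x y = ltl false x y.
Proof.
move=> [c1 [r1 cr]] lx ly E.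
have [i [j [ei ej Mij]]] := cell_ex lx.
have [_ [_ [_ [_ [_ [_ H]]]]]] := Hg.
have cx : in_cell s v h x i j by rewrite in_cellE // ei ej !eqxx.
have cy : in_cell s v h y i j by rewrite in_cellE // -!E ei ej !eqxx.
have [_ inc dec] := H i j x y lx ly cx cy.
have [_ inc' dec'] := H i j y x ly lx cy cx.
rewrite /ltl ei ej orient_col orient_row /=.
case: (eqVneq x y) => [->|/eqP xy]; first by rewrite !ltnn !if_same.
have nxy : nth 0 s x <> nth 0 s y by move/(is_perm_nth_inj Hs lx ly).
have Mcr := cr i j Mij.
case: (c1 i) (r1 j) Mcr => -> [] -> /= Mcr; rewrite ?Mcr in inc dec inc' dec'.
- have {}inc := inc erefl; have {}inc' := inc' erefl.
  by apply/idP/idP; lia.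
- have {}dec := dec erefl; have {}dec' := dec' erefl.
  by apply/idP/idP; lia.
- have {}dec := dec erefl; have {}dec' := dec' erefl.
  by apply/idP/idP; lia.
have {}inc := inc erefl; have {}inc' := inc' erefl.
by apply/idP/idP; lia.
Qed.

Lemma arrowP x y : x < size s -> y < size s ->
  arrow c r s v h x y <-> exists b, line b x = line b y /\ ltl b x y.
Proof.
move=> lx ly; split.
  case=> [[i []]|[j []]].
    rewrite !in_colE // => /eqP H1 /eqP H2 H3; exists true; split; first by rewrite H1.
    by rewrite /ltl H1 orient_col.
  rewrite !in_rowE // => /eqP H1 /eqP H2 H3; exists false; split; first by rewrite H1.
  by rewrite /ltl H1 orient_row.
have [i [j [ei ej _]]] := cell_ex lx.
case=> -[] [E]; rewrite /ltl ?ei ?ej ?orient_col ?orient_row => H.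
  by left; exists i; rewrite !in_colE // -E ei eqxx; split.
by right; exists j; rewrite !in_rowE // -E ej eqxx; split.
Qed.

End Gridded.

Section Cycle.
Hypothesis Hcyc : rc_is_cycle M.

Definition vertex (b : bool) (k : nat) (u : 'I_m + 'I_n) : Prop :=
  match u with inl i => b /\ k = i | inr j => ~~ b /\ k = j end.

Lemma vertex_ex b k : k < gdim b -> exists u, vertex b k u.
Proof. by case: b => /= lt; [exists (inl (Ordinal lt)) | exists (inr (Ordinal lt))]. Qed.

Lemma nzlineP b k k' : nzline b k k' <->
  exists u w, [/\ vertex b k u, vertex (~~ b) k' w & rc_edge M u w].
Proof.
split.
  by case: b => -[i [j [H -> ->]]]; [exists (inl i), (inr j) | exists (inr j), (inl i)].
by case: b => -[[u|u] [[w|w] [/= [? E1] [? E2] H]]] //; [exists u, w | exists w, u].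
Qed.

Lemma vertex_inj b k u u' : vertex b k u -> vertex b k u' -> u = u'.
Proof.
case: u => u; case: u' => u' /= [b1 E1] [b2 E2]; try by case: (b) b1 b2.
  by congr inl; apply: val_inj; rewrite /= -E1 -E2.
by congr inr; apply: val_inj; rewrite /= -E1 -E2.
Qed.

Lemma vertex_fun b k k' u : vertex b k u -> vertex b k' u -> k = k'.
Proof. by case: u => u /= [_ ->] [_ ->]. Qed.

Lemma nzline_two b k k1 k2 k' :
  nzline b k k1 -> nzline b k k2 -> k1 <> k2 -> nzline b k k' -> k' = k1 \/ k' = k2.
Proof.
move=> /nzlineP[u [w1 [u1 v1 e1]]] /nzlineP[u2 [w2 [u2' v2 e2]]] ne /nzlineP[u3 [w3 [u3' v3 e3]]].
have [_ [_ card2]] := Hcyc.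
rewrite (vertex_inj u2' u1) in e2; rewrite (vertex_inj u3' u1) in e3.
apply: NNPP => H.
have : 2 < #|[pred w | rc_edge M u w]|; last by rewrite card2.
apply/card_geqP; exists [:: w1; w2; w3]; split=> //.
  rewrite /= !inE !negb_or !andbT -andbA; apply/and3P; split; apply/eqP => E.
  - by apply: ne; rewrite E in v1; apply: vertex_fun v1 v2.
  - by apply: H; left; rewrite E in v1; apply: vertex_fun v3 v1.
  by apply: H; right; rewrite E in v2; apply: vertex_fun v3 v2.
by move=> w; rewrite !inE => /or3P[] /eqP->.
Qed.

Lemma nzline_other b k : k < gdim b -> forall k1, exists k2, k2 <> k1 /\ nzline b k k2.
Proof.
move=> lk k1; have [u uk] := vertex_ex lk.
have [_ [_ card2]] := Hcyc.
have := card2 u => /eqP; rewrite eqn_leq => /andP[_ /card_gt1P[w1 [w2 [e1 e2 ne]]]].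
have vw w : rc_edge M u w -> exists k', vertex (~~ b) k' w.
  by case: u uk {e1 e2} => u; case: w => w //= [+ _] _; case: b {lk} => // _; exists w.
have [j1 v1] := vw _ e1; have [j2 v2] := vw _ e2.
case: (eqVneq j1 k1) => [E|/eqP E]; last first.
  by exists j1; split=> //; apply/nzlineP; exists u, w1.
exists j2; split; last by apply/nzlineP; exists u, w2.
move=> E'; case/eqP: ne; rewrite E in v1; rewrite E' in v2.
exact: vertex_inj v1 v2.
Qed.

Lemma nzline_connected (P : bool -> nat -> Prop) :
  (forall b k k', P b k -> nzline b k k' -> P (~~ b) k') ->
  forall b k, k < gdim b -> P b k -> forall b' k', k' < gdim b' -> P b' k'.
Proof.
move=> clos b k lk Pk b' k' lk'.
have [u uk] := vertex_ex lk; have [w wk] := vertex_ex lk'.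
have [_ [conn _]] := Hcyc.
pose Q u := forall b k, vertex b k u -> P b k.
have step u1 u2 : rc_edge M u1 u2 -> Q u1 -> Q u2.
  case: u1 u2 => u1 [] u2 //= e Q1 b1 k1 /= [+ ->]; case: b1 => //= _.
    by apply: (clos true u1); [apply: (Q1 true) | exists u1, u2].
  by apply: (clos false u1); [apply: (Q1 false) | exists u2, u1].
have Qu : Q u.
  move=> b1 k1 u1; suff [<- <-] : b = b1 /\ k = k1 by [].
  by case: u uk u1 => u /= [+ ->] [+ ->]; case: (b); case: (b1).
have /connectP[p pth E] := conn u w.
suff Qw : Q w by exact: Qw wk.
elim: p u {uk} pth E Qu => [|u' p IH] u /=; first by move=> _ ->.
by case/andP=> e pth E Qu; apply: IH pth E _; apply: step e Qu.
Qed.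

(** A bipartite cycle has at least four edges: a column meets two rows, and each of these meets a
    further column. *)
Lemma ncells_gt3 : 3 < ncells M.
Proof.
have [mn0 _] := Hcyc.
have [b [k lk]] : exists b k, k < gdim b.
  by case: (posnP m) => m0; [exists false, 0; rewrite /= ; lia | exists true, 0].
have [i li] : exists i, i < gdim true.
  case: b lk => lk; first by exists k.
  by have [k2 [_ /nzline_dim[_]]] := nzline_other lk 0; exists k2.
have [j1 [_ n1]] := nzline_other li 0.
have [j2 [j12 n2]] := nzline_other li j1.
have [_ lj1] := nzline_dim n1; have [_ lj2] := nzline_dim n2.
have [i1 [i1i n3]] := nzline_other lj1 i.
have [i2 [i2i n4]] := nzline_other lj2 i.
case: n1 => a1 [b1 [M1 ai1 bj1]]; case: n2 => a2 [b2 [M2 ai2 bj2]].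
case: n3 => a3 [b3 [M3 ai3 bj3]]; case: n4 => a4 [b4 [M4 ai4 bj4]].
apply/card_geqP; exists [:: (a1, b1); (a2, b2); (a3, b3); (a4, b4)]; split=> //.
  rewrite /= !inE !xpair_eqE -!val_eqE /=; simpl in *.
  rewrite -ai1 -bj1 -ai2 -bj2 -ai3 -bj3 -ai4 -bj4 !eqxx /=.
  move/eqP/negbTE: j12; rewrite eq_sym => ->; move/eqP/negbTE: i1i; rewrite eq_sym => ->.
  by move/eqP/negbTE: i2i; rewrite eq_sym => ->; rewrite /= andbF.
by move=> x; rewrite !inE => /or4P[] /eqP-> /=.
Qed.

End Cycle.

End GridFacts.

(** * Gridded coils as coil data, and the forward direction *)

Section CoilOfPermutation.
Variables (m n : nat) (M : 'M[int]_(m, n)) (c : 'I_m -> int) (r : 'I_n -> int).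
Hypotheses (Hpm : partial_mult M c r) (Hcyc : rc_is_cycle M).
Notation l := (ncells M).

Section Coil.
Variables (s : seq nat) (v h : nat -> nat) (ord : seq nat) (lab : 'I_m * 'I_n -> nat).
Hypothesis Hc : gridded_coil M c r s v h ord lab.
Notation N := (size s).

Definition coil_pt (k : nat) : nat := nth 0 ord k.
Definition coil_X (b : bool) (k : nat) : nat := raw s b (coil_pt k).
(** Reducing the index modulo [l] makes the cell sequence periodic on all natural numbers, also past
    the last coil point. *)
Definition coil_cc (b : bool) (k : nat) : nat := line m n s v h b (coil_pt (k %% l)).
Definition coil_ax (k : nat) : bool := coil_cc true k.+1 == coil_cc true k.
Notation pt := coil_pt.
Notation cc := coil_cc.
Notation ax := coil_ax.

Let l3 : 3 < l := ncells_gt3 Hcyc.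

Lemma coil_size_ord : size ord = N.
Proof. by have [_ [_ [_ [/perm_size -> _]]]] := Hc; rewrite size_iota. Qed.

Lemma coil_pt_lt k : k < N -> pt k < N.
Proof.
have [_ [_ [_ [Ho _]]]] := Hc => lk.
have : pt k \in ord by rewrite mem_nth // coil_size_ord.
by rewrite (perm_mem Ho) mem_iota.
Qed.

Lemma coil_pt_inj k k' : k < N -> k' < N -> pt k = pt k' -> k = k'.
Proof.
have [_ [_ [_ [Ho _]]]] := Hc => lk lk' /eqP.
have uo : uniq ord by rewrite (perm_uniq Ho) iota_uniq.
by rewrite nth_uniq ?coil_size_ord // => /eqP.
Qed.

Lemma coil_pt_ex x : x < N -> exists2 k, k < N & pt k = x.
Proof.
have [_ [_ [_ [Ho _]]]] := Hc => lx.
have : x \in ord by rewrite (perm_mem Ho) mem_iota.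
by move/(nthP 0) => [k lk E]; exists k; rewrite // -coil_size_ord.
Qed.

Lemma coil_lab k i j : k < N -> line m n s v h true (pt k) = nat_of_ord i ->
  line m n s v h false (pt k) = nat_of_ord j -> lab (i, j) = k %% l.
Proof.
have [Hs [Hg [_ [_ [_ [_ [H _]]]]]]] := Hc => lk Ei Ej.
by apply: H => //; rewrite (in_cellE Hs Hg) ?coil_pt_lt // Ei Ej !eqxx.
Qed.

Lemma coil_mod_lt k : k %% l < N.
Proof. by have [_ [_ [lN _]]] := Hc; apply: ltn_trans lN; rewrite ltn_mod; lia. Qed.

Lemma coil_same_lines k k' : k < N -> k' < N -> k = k' %[mod l] <->
  forall b, line m n s v h b (pt k) = line m n s v h b (pt k').
Proof.
move=> lk lk'; have [Hs [Hg [_ [_ [inj _]]]]] := Hc.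
have [i [j [Ei Ej Mij]]] := cell_ex Hs Hg (coil_pt_lt lk).
have [i' [j' [Ei' Ej' Mij']]] := cell_ex Hs Hg (coil_pt_lt lk').
split=> [E|E].
  suff [e1 e2] : (i, j) = (i', j') by case; rewrite ?Ei ?Ej ?Ei' ?Ej' ?e1 ?e2.
  by apply: inj => //; rewrite (coil_lab lk Ei Ej) (coil_lab lk' Ei' Ej').
by rewrite -(coil_lab lk Ei Ej) -(coil_lab lk' (i := i) (j := j)) -?E.
Qed.

Lemma coil_ccE b k : k < N -> cc b k = line m n s v h b (pt k).
Proof.
by move=> lk; have [H _] := coil_same_lines (coil_mod_lt k) lk; apply: H; rewrite modn_mod.
Qed.

Lemma coil_cc_mod b k k' : k = k' %[mod l] -> cc b k = cc b k'.
Proof. by rewrite /cc => ->. Qed.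

Lemma coil_cc_inj k k' : (forall b, cc b k = cc b k') -> k = k' %[mod l].
Proof.
by case: (coil_same_lines (coil_mod_lt k) (coil_mod_lt k')) => _ H /H; rewrite !modn_mod.
Qed.

Lemma coil_nz b k : nzline M b (cc b k) (cc (~~ b) k).
Proof. by have [Hs [Hg _]] := Hc; apply: (line_nz Hs Hg); apply/coil_pt_lt/coil_mod_lt. Qed.

Lemma succ_mod k : k.+1 <> k %[mod l].
Proof. by move/esym/eqmod_addP => []; [lia | case=> [|j]; rewrite ?mulSn; lia]. Qed.

Lemma coil_share b k : ax k = b -> cc b k.+1 = cc b k.
Proof.
move=> <-; rewrite /ax; case: eqP => // ne.
have [Hs [Hg [lN [_ [_ [_ [_ [nxt _]]]]]]]] := Hc.
have lk1 : (k %% l).+1 < N by apply: leq_ltn_trans lN; rewrite ltn_mod; lia.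
have lk0 : k %% l < N by apply: ltnW.
have := nxt (k %% l).+1; rewrite lk1 => /(_ isT).
move/(arrowP c r Hs Hg (coil_pt_lt lk0) (coil_pt_lt lk1)) => [b' [E _]].
have E1 b0 : cc b0 k.+1 = cc b0 (k %% l).+1.
  by apply: coil_cc_mod; rewrite -addn1 -modnDml addn1.
have {}E : cc b' k = cc b' k.+1 by rewrite E1 (coil_ccE _ lk1) -E.
by case: b' E => // E; case: ne.
Qed.

Lemma coil_noshare b k : cc b k.+1 = cc b k -> ax k = b.
Proof.
move=> E; case: (eqVneq (ax k) b) => // ne.
case: (@succ_mod k); apply: coil_cc_inj => b'.
case: (eqVneq b' b) => [->//|nb]; apply: coil_share.
by case: (ax k) b b' ne nb {E} => -[] [].
Qed.

Lemma coil_ax_mod k k' : k = k' %[mod l] -> ax k = ax k'.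
Proof.
move=> E; rewrite /ax (coil_cc_mod _ E) (@coil_cc_mod _ k.+1 k'.+1) //.
by rewrite -addn1 -modnDml E modnDml addn1.
Qed.

Lemma coil_ne k : cc (~~ ax k) k <> cc (~~ ax k) k.+1.
Proof. by move/esym/coil_noshare; case: (ax k). Qed.

Lemma coil_line_two k k' : cc (ax k) k' = cc (ax k) k -> k' = k %[mod l] \/ k' = k.+1 %[mod l].
Proof.
move=> E; have n1 := coil_nz (ax k) k; have n2 := coil_nz (ax k) k.+1.
have n3 := coil_nz (ax k) k'; have S := coil_share (erefl (ax k)).
rewrite E in n3; rewrite S in n2.
case: (nzline_two Hcyc n1 n2 (@coil_ne k) n3) => E'; [left | right];
  by apply: coil_cc_inj => b; case: (eqVneq b (ax k)) => [->|ne]; rewrite ?S //;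
     (have -> : b = ~~ ax k by case: b (ax k) ne => -[]).
Qed.

(** Two successive steps along one line would put three non-zero cells into it. *)
Lemma coil_alt k : ax k.+1 = ~~ ax k.
Proof.
case: (eqVneq (ax k.+1) (ax k)) => [E|]; last by case: (ax _); case: (ax _).
have S1 := coil_share (erefl (ax k)); have S2 := coil_share E.
rewrite S1 in S2; case: (coil_line_two S2); last by move/succ_mod.
by move/esym/eqmod_addP => []; [lia | case=> [|j]; rewrite ?mulSn; lia].
Qed.

Lemma coil_prec b k k' : k < N -> k' < N ->
  prec (orient c r) coil_X coil_cc b k k' = ltl c r s v h b (pt k) (pt k').
Proof. by move=> lk lk'; rewrite /prec /ltl coil_ccE. Qed.

Lemma coil_arrow_ax k k' x y : k = k' %[mod l] -> x < N -> y < N ->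
  arrow c r s v h (pt x) (pt y) ->
  (x = k %[mod l] /\ y = k'.+1 %[mod l] \/ x = k.+1 %[mod l] /\ y = k' %[mod l]) ->
  prec (orient c r) coil_X coil_cc (ax k) x y.
Proof.
have [Hs [Hg _]] := Hc => kk lx ly.
move/(arrowP c r Hs Hg (coil_pt_lt lx) (coil_pt_lt ly)) => [b [E lt]] H.
suff -> : ax k = b by rewrite coil_prec.
rewrite -!coil_ccE // in E; apply: coil_noshare.
have kS : k.+1 = k'.+1 %[mod l] by rewrite -addn1 -modnDml kk modnDml addn1.
case: H => -[e1 e2]; move: E; rewrite (coil_cc_mod b e1) (coil_cc_mod b e2).
  by rewrite (coil_cc_mod b kS).
by rewrite (coil_cc_mod b kk).
Qed.

Lemma coil_dataP : coil_data l (orient c r) N coil_X coil_cc coil_ax.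
Proof.
have [Hs [Hg [lN [_ [_ [_ [_ [nxt [back _]]]]]]]]] := Hc.
split.
- by move=> b k k' lk lk' /(raw_inj Hs (coil_pt_lt lk) (coil_pt_lt lk'))/coil_pt_inj; apply.
- move=> b k k' lk lk' H; rewrite !coil_ccE //.
  by apply: (line_mono Hs Hg) => //; apply: coil_pt_lt.
- by move=> b k; apply: coil_cc_mod; rewrite modnDr.
- move=> b k k' E; case: (eqVneq (ax k) b) => [bE|ne].
    rewrite -bE in E; case: (coil_line_two (esym E)) => H; first by constructor 1.
    by constructor 2.
  (* Along the axis other than [ax k], cell [k] shares its line with the previous cell; [k + l.-1]
     represents that cell and avoids the predecessor of [0]. *)
  pose p := k + l.-1; have pS : p.+1 = k + l by rewrite /p; lia.
  have kp : k = p.+1 %[mod l] by rewrite pS modnDr.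
  have axp : ax p = b.
    by have := coil_alt p; rewrite -(coil_ax_mod kp); move: ne; case: (ax k); case: (ax p); case: (b).
  have S := coil_share (erefl (ax p)).
  have E2 : cc (ax p) k' = cc (ax p) p by rewrite -S -(coil_cc_mod _ kp) axp.
  case: (coil_line_two E2) => H; last by constructor 1; rewrite H.
  constructor 3; split; first by rewrite (coil_ax_mod H).
  by rewrite kp -addn1 -modnDml -H modnDml addn1.
- by move=> k; apply: coil_share.
- exact: coil_alt.
- by move=> k; apply: coil_ax_mod; rewrite modnDr.
- move=> k lk; apply: (@coil_arrow_ax k k) => //; [exact: ltnW | | by left].
  by have := nxt k.+1; rewrite lk; apply.
- move=> k lk; have lk' : k < N by apply: leq_ltn_trans lk; apply: leq_addr.
  apply: (@coil_arrow_ax k k) => //; last by right; rewrite addnS -addSn modnDr.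
  have := back (k + l.+1); rewrite lk addnK; apply.
  by rewrite addnS ltnS leq_addl.
move=> k k' lk lk' E; rewrite !coil_prec //.
apply: (ltl_cell Hs Hg Hpm); try exact: coil_pt_lt.
by apply/coil_same_lines.
Qed.

Lemma coil_cc_dim b k : cc b k < gdim m n b.
Proof. by have [] := nzline_dim (coil_nz b k). Qed.

End Coil.

Lemma blow_raw s a P Q k b x y : blow s a P Q k -> x < size a -> y < size a -> k x <> k y ->
  (raw a b x < raw a b y) = (raw s b (k x) < raw s b (k y)).
Proof. by move=> [_ H _ _ _] lx ly /(H _ _ lx ly) [H1 H2]; case: b. Qed.

Lemma blow_distinct s a P Q k x y z : blow s a P Q k ->
  x < size a -> y < size a -> z < size a -> x <> y -> y <> z -> x <> z ->
  k x = k y -> k y = k z -> False.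
Proof.
move=> [_ _ H _ _] lx ly lz xy yz xz E1 E2.
have E3 : k x = k z by congruence.
case: (ltngtP x y) xy => // c1 _; case: (ltngtP y z) yz => // c2 _;
  case: (ltngtP x z) xz => // c3 _.
- exact: (H x y z).
- lia.
- exact: (H x z y).
- exact: (H z x y).
- exact: (H y x z).
- exact: (H y z x).
- lia.
- exact: (H z y x).
Qed.

Lemma end_inflated_coilP a : end_inflated_coil M c r a ->
  exists s v h ord lab k, [/\ gridded_coil M c r s v h ord lab,
    blow s a (nth 0 ord 0) (nth 0 ord (size s).-1) k & size a = (size s).+2].
Proof.
move=> [s [v [h [ord [lab [b1 [bN [Hc _ _ ->]]]]]]]].
have [Hs [_ [lN _]]] := Hc; have l3 := ncells_gt3 Hcyc.
have l0 : 0 < size s by lia.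
have l1 : (size s).-1 < size s by lia.
have P0 := coil_pt_lt Hc l0; have P1 := coil_pt_lt Hc l1.
have ne : nth 0 ord 0 <> nth 0 ord (size s).-1.
  by move/(coil_pt_inj Hc l0 l1); lia.
have [k Hk] := blow_inflate2 b1 bN Hs P0 P1 ne.
exists s, v, h, ord, lab, k; split=> //.
rewrite /inflate2; case: ifP => _; rewrite !size_inflate //; exact: ltnW.
Qed.

(** Two sections of the first collapse that differ only over the ends induce two maps between the
    coils. Both maps are shifts and agree at an interior point, so they agree everywhere. Thus the
    two copies of an end land over a single point of the second coil, which must be one of its ends,
    and a shift that takes ends to ends forces equal lengths. *)
Lemma end_inflated_coil_size_eq : exists L, forall a1 a2,
  end_inflated_coil M c r a1 -> end_inflated_coil M c r a2 ->
  L <= size a1 -> L <= size a2 -> contains a2 a1 -> size a1 = size a2.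
Proof.
have [L HL] := constant_stretches (5 * l) (m + n) (m + n).
(* The margin covers the two points added by the inflation and yields coils with at least [L] and
   more than [l.+1] points. *)
exists (L + l + 10) => a1 a2 /end_inflated_coilP[s1 [v1 [h1 [ord1 [lab1 [k1 [C1 B1 S1]]]]]]].
move=> /end_inflated_coilP[s2 [v2 [h2 [ord2 [lab2 [k2 [C2 B2 S2]]]]]]] La1 La2.
move=> /contains_embeds[e [e_lt e_cmp]].
rewrite S1 S2; do 2 congr S; move: La1 La2; rewrite S1 S2.
set N1 := size s1; set N2 := size s2 => La1 La2.
have D1 := coil_dataP C1; have D2 := coil_dataP C2; have l3 := ncells_gt3 Hcyc.
have [k1_lt _ _ _ sec] := B1; have [k2_lt _ _ k2_fib _] := B2.
have e_inj x y : x < size a1 -> y < size a1 -> e x = e y -> x = y.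
  by move=> lx ly E; have := e_cmp x y lx ly; have := e_cmp y x ly lx; rewrite E !ltnn; lia.
have e_raw b x y : x < size a1 -> y < size a1 -> (raw a1 b x < raw a1 b y) = (raw a2 b (e x) < raw a2 b (e y)).
  by move=> lx ly; have [] := e_cmp x y lx ly; case: b.
pose section sg := forall z, z < N1 -> sg z < size a1 /\ k1 (sg z) = z.
pose image sg g := forall k, k < N1 -> g k < N2 /\ coil_pt ord2 (g k) = k2 (e (sg (coil_pt ord1 k))).
have image_ex sg : section sg -> exists g, image sg g.
  move=> Hsg; have H k : exists j, k < N1 -> j < N2 /\ coil_pt ord2 j = k2 (e (sg (coil_pt ord1 k))).
    case: (ltnP k N1) => lk; last by exists 0.
    have [|j lj E] := coil_pt_ex C2 (x := k2 (e (sg (coil_pt ord1 k)))); last by exists j.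
    by apply/k2_lt/e_lt; case: (Hsg _ (coil_pt_lt C1 lk)).
  by have [g Hg] := choice_fun H; exists g.
have shift sg g : section sg -> image sg g -> exists A B, forall k, k < N1 -> g k + A = k + B.
  move=> Hsg Hg.
  have g_lt k : k < N1 -> g k < N2 by move=> /Hg[].
  have g_mono b k k' : k < N1 -> k' < N1 -> coil_X s1 ord1 b k < coil_X s1 ord1 b k' ->
      coil_X s2 ord2 b (g k) <= coil_X s2 ord2 b (g k').
    move=> lk lk' H; have [_ E] := Hg k lk; have [_ E'] := Hg k' lk'.
    rewrite /coil_X E E'.
    have [sl sk] := Hsg _ (coil_pt_lt C1 lk); have [sl' sk'] := Hsg _ (coil_pt_lt C1 lk').
    set x := sg (coil_pt ord1 k) in sl sk *; set x' := sg (coil_pt ord1 k') in sl' sk' *.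
    case: (eqVneq (k2 (e x)) (k2 (e x'))) => [->//|/eqP ne].
    rewrite ltnW // -(blow_raw b B2) ?e_lt // -e_raw // (blow_raw b B1) // ?sk ?sk' //.
    by move=> E0; rewrite /coil_X E0 ltnn in H.
  have g_fib k k' k'' : k < k' -> k' < k'' -> k'' < N1 -> g k = g k' -> g k' = g k'' -> False.
    move=> kk kk' lk''; have lk' := ltn_trans kk' lk''; have lk := ltn_trans kk lk'.
    have [_ E] := Hg k lk; have [_ E'] := Hg k' lk'; have [_ E''] := Hg k'' lk''.
    have ne x y : x < y -> y < N1 -> e (sg (coil_pt ord1 x)) <> e (sg (coil_pt ord1 y)).
      move=> xy ly; have lx := ltn_trans xy ly.
      have [sx kx] := Hsg _ (coil_pt_lt C1 lx); have [sy ky] := Hsg _ (coil_pt_lt C1 ly).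
      move/(e_inj _ _ sx sy) => E0; rewrite E0 ky in kx.
      by have := coil_pt_inj C1 ly lx kx; lia.
    have le x : x < N1 -> e (sg (coil_pt ord1 x)) < size a2.
      by move=> lx; apply: e_lt; case: (Hsg _ (coil_pt_lt C1 lx)).
    move=> g1 g2; apply: (blow_distinct B2 (le _ lk) (le _ lk') (le _ lk'')).
    - exact: ne.
    - exact: ne.
    - exact: ne (ltn_trans kk kk') lk''.
    - by rewrite -E -E' g1.
    by rewrite -E' -E'' g2.
  have lN1 : l.+1 < N1 by lia.
  have lN2 : l.+1 < N2 by lia.
  have LN1 : L <= N1 by lia.
  have [a [aN st]] := stable_stretch l3 D1 D2 lN1 lN2 (coil_cc_dim C1) (coil_cc_dim C2) g_lt g_mono HL LN1.
  exists a, (g a) => k lk.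
  exact: (good_all l3 (nzline_two Hcyc) (nzline_connected Hcyc) D1 D2 lN1 lN2
    (coil_cc_dim C1) (coil_cc_dim C2) (coil_nz C2) g_lt g_mono g_fib aN st lk).
set P := nth 0 ord1 0 in sec B1; set Q := nth 0 ord1 N1.-1 in sec B1.
have l0 : 0 < N1 by lia.
have l1 : N1.-1 < N1 by lia.
have sec2 z : exists xy : nat * nat, z < N1 ->
    [/\ xy.1 < size a1, xy.2 < size a1, k1 xy.1 = z, k1 xy.2 = z & (z = P \/ z = Q -> xy.1 <> xy.2)].
  case: (ltnP z N1) => lz; last by exists (0, 0).
  by have [x [y H]] := sec z lz; exists (x, y).
have [ss Hss] := choice_fun sec2.
pose sg z := (ss z).1.
pose sg' z := if (z == P) || (z == Q) then (ss z).2 else (ss z).1.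
have Hsg : section sg by move=> z /Hss[].
have Hsg' : section sg' by move=> z /Hss[? ? ? ? _]; rewrite /sg'; case: ifP.
have [g Hg] := image_ex _ Hsg; have [g' Hg'] := image_ex _ Hsg'.
have [A [B gE]] := shift _ _ Hsg Hg; have [A' [B' gE']] := shift _ _ Hsg' Hg'.
have l2 : 1 < N1 by lia.
(* Index [1] is not an end, so both sections choose the same point over it. *)
have g1 : g 1 = g' 1.
  have [gl E] := Hg 1 l2; have [gl' E'] := Hg' 1 l2.
  apply: (coil_pt_inj C2) => //; rewrite E E'; congr (k2 (e _)).
  rewrite /sg' ifN // negb_or; apply/andP; split; apply/eqP.
    by move/(coil_pt_inj C1 l2 l0).
  by move/(coil_pt_inj C1 l2 l1); lia.
have gg k : k < N1 -> g k = g' k.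
  by move=> lk; have := gE _ lk; have := gE' _ lk; have := gE _ l2; have := gE' _ l2; lia.
have ends k : k = 0 \/ k = N1.-1 -> g k = 0 \/ g k = N2.-1.
  move=> kE; have lk : k < N1 by lia.
  have lp := coil_pt_lt C1 lk.
  have zPQ : coil_pt ord1 k = P \/ coil_pt ord1 k = Q by case: kE => ->; [left | right].
  have [gl E] := Hg k lk; have [gl' E'] := Hg' k lk.
  have [x1 x2 y1 y2 ne] := Hss _ lp.
  have EE : k2 (e (ss (coil_pt ord1 k)).1) = k2 (e (ss (coil_pt ord1 k)).2).
    move: E'; rewrite -gg // E /sg /sg' => ->.
    by rewrite ifT //; case: zPQ => ->; rewrite eqxx ?orbT.
  have nee : e (ss (coil_pt ord1 k)).1 <> e (ss (coil_pt ord1 k)).2.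
    by move/(e_inj _ _ x1 x2); apply: ne.
  have : k2 (e (ss (coil_pt ord1 k)).1) = nth 0 ord2 0 \/
         k2 (e (ss (coil_pt ord1 k)).1) = nth 0 ord2 N2.-1.
    case: (ltngtP (e (ss (coil_pt ord1 k)).1) (e (ss (coil_pt ord1 k)).2)) => // lt.
      by apply: (k2_fib _ _ _ _ lt EE); apply: e_lt.
    by rewrite EE; apply: (k2_fib _ _ _ _ lt (esym EE)); apply: e_lt.
  rewrite -/(sg (coil_pt ord1 k)) -E => -[] H; [left | right];
    by apply: (coil_pt_inj C2 gl _ H); lia.
have := ends 0 (or_introl erefl); have := ends N1.-1 (or_intror erefl).
by have := gE _ l0; have := gE _ l1; have [+ _] := Hg _ l0; have [+ _] := Hg _ l1; lia.
Qed.

Lemma bounded_perms (B : nat) : exists l0 : seq (seq nat), forall p, is_perm p -> size p <= B -> p \in l0.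
Proof.
exists (flatten [seq permutations (iota 0 k) | k <- iota 0 B.+1]) => p Hp sz.
apply/flattenP; exists (permutations (iota 0 (size p))); last by rewrite mem_permutations.
by apply/mapP; exists (size p); rewrite ?mem_iota.
Qed.

Lemma wqo_finitely_many (C : seq nat -> Prop) : perm_class C -> wqo C ->
  finitely_many C (end_inflated_coil M c r).
Proof.
move=> [Cperm _] wC; apply: NNPP => nfin.
have big B : exists a, [/\ C a, end_inflated_coil M c r a & B < size a].
  apply: NNPP => H; apply: nfin; have [l0 Hl0] := bounded_perms B.
  exists l0 => a Ca Ea; apply: Hl0; first exact: Cperm.
  by rewrite leqNgt; apply/negP => lt; apply: H; exists a.
have [f Hf] := choice_fun big.
have [L HL] := end_inflated_coil_size_eq.
(* Lengths grow strictly and exceed [L], so no containment among these coils is possible. *)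
pose F := fix F k := if k is k'.+1 then f (size (F k')) else f L.
have CF k : C (F k) /\ end_inflated_coil M c r (F k).
  by case: k => [|k] /=; [case: (Hf L) | case: (Hf (size (F k)))].
have Fs k : size (F k) < size (F k.+1) by have [] := Hf (size (F k)).
have Flt i j : i < j -> size (F i) < size (F j).
  elim: j => // j IH; rewrite ltnS leq_eqVlt => /orP[/eqP-> //|/IH lt].
  exact: ltn_trans lt (Fs j).
have F0 k : L <= size (F k).
  have H0 : L < size (F 0) by have [] := Hf L.
  by case: k => [|k]; apply: ltnW => //; apply: ltn_trans H0 (Flt _ _ _).
have [i [j [ij cij]]] := wC F (fun k => proj1 (CF k)).
have := HL _ _ (proj2 (CF i)) (proj2 (CF j)) (F0 i) (F0 j) cij.
by have := Flt _ _ ij; lia.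
Qed.

End CoilOfPermutation.

(** Applied to the arrow relation inside a cell or a layer, and to its reverse, this supplies last
    and first points. *)
Lemma set_max (T : finType) (R : rel T) (A : {set T}) :
  (exists x, x \in A) ->
  {in A &, forall x y, x != y -> R x y || R y x} ->
  {in A & &, forall x y z, R x y -> R y z -> R x z} ->
  exists2 x, x \in A & {in A, forall y, y != x -> R y x}.
Proof.
have [k] := ubnP #|A|; elim: k A => // k IH A cA [a aA] tot tr.
case: (set_0Vmem (A :\ a)) => [A0|[b bA]].
  exists a => // y yA ya; have : y \in A :\ a by rewrite !inE ya.
  by rewrite A0 inE.
have sub : {subset A :\ a <= A} by move=> x /setD1P[].
have [|x xA xmax] := IH (A :\ a) _ (ex_intro _ b bA) (sub_in2 sub tot) (sub_in3 sub tr).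
  by rewrite (cardsD1 a) aA in cA.
have [xa xA'] := setD1P xA.
case: (boolP (R a x)) => ax.
  exists x => // y yA yx; case: (eqVneq y a) => [->//|ya].
  by apply: xmax => //; rewrite !inE ya.
have xRa : R x a by have := tot a x aA xA'; rewrite eq_sym xa (negbTE ax) => /(_ isT).
exists a => // y yA ya; case: (eqVneq y x) => [->//|yx].
by apply: (tr y x a) => //; apply: xmax => //; rewrite !inE ya.
Qed.

(** * Decomposition of the orientation digraph into strongly connected pieces *)

Section LineStructure.
Variables (E : eqType) (adj : rel E).
Hypotheses (adj_refl : reflexive adj) (adj_sym : symmetric adj).

(** The orientation digraph in the abstract. Transitivity asks for adjacent end cells because a path
    may turn from a column into a row. *)
Record line_structure (T : finType) (cl : T -> E) (arr : rel T) : Prop := LineStructure {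
  arr_adj : forall x y, arr x y -> adj (cl x) (cl y);
  arr_tot : forall x y, adj (cl x) (cl y) -> x != y -> arr x y || arr y x;
  arr_asym : forall x y, arr x y -> ~~ arr y x;
  arr_trans : forall x y z, arr x y -> arr y z -> adj (cl x) (cl z) -> arr x z }.

Lemma arr_irr (T : finType) (cl : T -> E) (arr : rel T) x :
  line_structure cl arr -> ~~ arr x x.
Proof. by move=> H; apply/negP => xx; have := arr_asym H xx; rewrite xx. Qed.

(** Strong connectivity of the digraph induced on [S], stated as the absence of proper non-empty
    subsets that no arrow leaves. *)
Definition indecomposable (T : finType) (arr : rel T) (S : {set T}) : Prop :=
  S != set0 /\ forall A : {set T}, A \subset S -> A != set0 -> A != S ->
    exists x y, [/\ x \in A, y \in S, y \notin A & arr x y].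

Definition forward (T : finType) (cl : T -> E) (arr : rel T) (A B : {set T}) : bool :=
  [forall x in A, forall y in B, adj (cl x) (cl y) ==> arr x y].

Lemma forwardP (T : finType) (cl : T -> E) (arr : rel T) (A B : {set T}) :
  reflect (forall x y, x \in A -> y \in B -> adj (cl x) (cl y) -> arr x y) (forward cl arr A B).
Proof.
apply: (iffP idP) => [H x y xA yB a|H].
  by move/forall_inP: H => /(_ x xA)/forall_inP/(_ y yB)/implyP; apply.
by apply/forall_inP => x xA; apply/forall_inP => y yB; apply/implyP; apply: H.
Qed.

Lemma decomposition (T : finType) (cl : T -> E) (arr : rel T) (S : {set T}) :
  line_structure cl arr -> exists ls : seq {set T},
    [/\ forall x, x \in S <-> exists2 A, A \in ls & x \in A,
        pairwise (forward cl arr) ls & forall A, A \in ls -> indecomposable arr A].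
Proof.
move=> L; have [k] := ubnP #|S|; elim: k S => // k IH S cS.
case: (eqVneq S set0) => [->|S0].
  by exists [::]; split=> // x; rewrite inE; split=> // -[].
case: (classic (indecomposable arr S)) => [indS|].
  exists [:: S]; split=> // [x|A]; last by rewrite inE => /eqP->.
  by split=> [xS|[A]]; [exists S; rewrite ?inE | rewrite inE => /eqP->].
move=> nind; have [A [AS A0 AnS nout]] : exists A : {set T}, [/\ A \subset S, A != set0, A != S &
    forall x y, x \in A -> y \in S -> y \notin A -> ~~ arr x y].
  apply: NNPP => H; apply: nind; split=> // A AS A0 AnS; apply: NNPP => H'.
  apply: H; exists A; split=> // x y xA yS yA; apply/negP => xy.
  by apply: H'; exists x, y.
have cA : #|A| < #|S| by apply: proper_card; rewrite properEneq AnS.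
have cD : #|S :\: A| < #|S|.
  have := cardsID A S; rewrite (setIidPr AS).
  by have : 0 < #|A|; [rewrite card_gt0 | lia].
have [ls1 [m1 p1 i1]] := IH (S :\: A) (leq_trans cD cS).
have [ls2 [m2 p2 i2]] := IH A (leq_trans cA cS).
(* No arrow leaves [A], so the arrows between the two parts all enter [A], whose pieces therefore
   come last. *)
exists (ls1 ++ ls2); split.
- move=> x; split=> [xS|[B]].
    case: (boolP (x \in A)) => xA.
      by have [B Bl xB] := (m2 x).1 xA; exists B; rewrite // mem_cat Bl orbT.
    have [|B Bl xB] := (m1 x).1; first by rewrite inE xA.
    by exists B; rewrite // mem_cat Bl.
  rewrite mem_cat => /orP[] Bl xB.
    by have := (m1 x).2 (ex_intro2 _ _ B Bl xB); rewrite inE => /andP[].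
  by apply: (subsetP AS); apply/(m2 x).2; exists B.
- rewrite pairwise_cat p1 p2 !andbT; apply/allrelP => B1 B2 l1 l2.
  apply/forwardP => x y xB yB axy.
  have : x \in S :\: A by apply/(m1 x).2; exists B1.
  have yA : y \in A by apply/(m2 y).2; exists B2.
  rewrite inE => /andP[xA xS].
  have ne : x != y by apply: contraNneq xA => ->.
  by have := arr_tot L axy ne; rewrite (negbTE (nout y x yA xS xA)) orbF.
by move=> B; rewrite mem_cat => /orP[/i1|/i2].
Qed.

Definition line_embedding (T T' : finType) (cl : T -> E) (arr : rel T) (cl' : T' -> E)
    (arr' : rel T') (g : T -> T') (A : {set T}) (B : {set T'}) : Prop :=
  (forall x, x \in A -> g x \in B /\ cl' (g x) = cl x) /\
  (forall x y, x \in A -> y \in A -> arr x y -> arr' (g x) (g y)).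

Inductive coded (A K : Type) (code : A -> K -> Prop) : seq A -> seq K -> Prop :=
| coded_nil : coded code [::] [::]
| coded_cons a k s t : code a k -> coded code s t -> coded code (a :: s) (k :: t).

Lemma coded_consP (A K : Type) (code : A -> K -> Prop) s k ks : coded code s (k :: ks) ->
  exists a s', [/\ s = a :: s', code a k & coded code s' ks].
Proof.
move Ek: (k :: ks) => t Ht; case: Ht Ek => // a k' s' t' Hk Hs [-> ->].
by exists a, s'.
Qed.

Lemma coded_ex (A : eqType) (K : Type) (code : A -> K -> Prop) (s : seq A) :
  (forall a, a \in s -> exists k, code a k) -> exists t, coded code s t.
Proof.
elim: s => [|a s IH] H; first by exists [::]; constructor.
have [k Hk] := H a (mem_head a s).
have [|t Ht] := IH; first by move=> b bs; apply: H; rewrite inE bs orbT.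
by exists (k :: t); constructor.
Qed.

(** Arrows inside a piece are preserved by the embedding of that piece. Arrows between different
    pieces run forward in both lists, and the embedding of the lists respects the order of the
    pieces. *)
Lemma semb_embedding (T T' : finType) (cl : T -> E) (arr : rel T) (cl' : T' -> E)
    (arr' : rel T') (t0 : T') (K : Type) (Q : K -> K -> Prop)
    (code : {set T} -> K -> Prop) (code' : {set T'} -> K -> Prop) ls ls' ks ks' :
  line_structure cl arr -> line_structure cl' arr' ->
  (forall A B k k', code A k -> code' B k' -> Q k k' ->
     exists g, line_embedding cl arr cl' arr' g A B) ->
  coded code ls ks -> coded code' ls' ks' -> semb Q ks ks' ->
  pairwise (forward cl arr) ls -> pairwise (forward cl' arr') ls' ->
  exists g, [/\ forall A x, A \in ls -> x \in A -> cl' (g x) = cl x /\ exists2 B, B \in ls' & g x \in B &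
    forall A A' x y, A \in ls -> A' \in ls -> x \in A -> y \in A' -> arr x y -> arr' (g x) (g y)].
Proof.
move=> L L' HQ c1 c2 H; elim: H ls ls' c1 c2 => {ks ks'} [ks'|k ks ks' _ IH|k k' ks ks' Qk _ IH] /=.
- move=> ls ls' c1 _ _ _; exists (fun=> t0).
  by have -> : ls = [::] by move Ek: [::] c1 => t c1; case: c1 Ek.
- move=> ls ls0 c1 c0; have [B [ls' [-> _ c2]]] := coded_consP c0.
  move=> /= pl /andP[_ pl'].
  have [g [g1 g2]] := IH _ _ c1 c2 pl pl'.
  exists g; split=> // A x Al xA; have [E1 [B' Bl xB]] := g1 A x Al xA.
  by split=> //; exists B'; rewrite // inE Bl orbT.
move=> ls0 ls0' c0 c0'; have [A [ls [-> cA c1]]] := coded_consP c0.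
have [B [ls' [-> cB c2]]] := coded_consP c0'; move=> /=.
have [gA [gA1 gA2]] := HQ _ _ _ _ cA cB Qk.
case/andP=> fA pl /andP[fB pl']; have [g [g1 g2]] := IH _ _ c1 c2 pl pl'.
have disj C x : C \in ls -> x \in C -> x \in A -> False.
  move=> Cl xC xA; have := allP fA C Cl => /forwardP/(_ x x xA xC (adj_refl _)).
  exact/negP/(arr_irr _ L).
exists (fun x => if x \in A then gA x else g x); split.
  move=> C x; rewrite inE => /orP[/eqP->|Cl] xC.
    by rewrite xC; have [H1 H2] := gA1 x xC; split=> //; exists B; rewrite ?mem_head.
  rewrite ifN; last by apply/negP => /(disj C x Cl xC).
  have [H1 [D Dl xD]] := g1 C x Cl xC.
  by split=> //; exists D; rewrite // inE Dl orbT.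
have notA C x : C \in ls -> x \in C -> (x \in A) = false.
  by move=> Cl xC; apply/negP => /(disj C x Cl xC).
move=> C C' x y; rewrite !inE => /orP[/eqP->|Cl] /orP[/eqP->|Cl'] xC yC xy.
- by rewrite xC yC; apply: gA2.
- rewrite xC (notA C' y) //; have [H1 H2] := gA1 x xC; have [H3 [D Dl yD]] := g1 C' y Cl' yC.
  have /forwardP := allP fB D Dl; apply=> //.
  by rewrite H2 H3; apply: (arr_adj L).
- have /forwardP/(_ y x yC xC) := allP fA C Cl; rewrite adj_sym (arr_adj L xy) => /(_ isT).
  by move/(arr_asym L); rewrite xy.
by rewrite (notA C x) // (notA C' y) //; apply: (g2 C C').
Qed.

End LineStructure.

(** * Encoding a window of layers as a word *)

Section WindowWords.
Variables (T : finType) (lay : T -> nat) (arr : rel T) (S : {set T}).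

Definition near (x y : T) : bool := (lay x <= (lay y).+1) && (lay y <= (lay x).+1).

Hypothesis asym : {in S &, forall x y, arr x y -> ~~ arr y x}.
Hypothesis tot : {in S &, forall x y, near x y -> x != y -> arr x y || arr y x}.
Hypothesis trans : {in S & &, forall x y z,
  near x y -> near y z -> near x z -> arr x y -> arr y z -> arr x z}.

(* The layers form a path, so the relation between equal or consecutive layers is acyclic:
   the minimum of the last layer whose minimum is not preceded from below is a source. *)
Lemma window_source (W : {set T}) : W \subset S -> W != set0 ->
  exists2 x, x \in W & {in W, forall y, ~~ (near y x && arr y x)}.
Proof.
move=> WS W0; have inS x : x \in W -> x \in S by apply/subsetP.
have lmin x : x \in W -> exists2 z, z \in W & lay z = lay x /\
    {in W, forall y, lay y = lay x -> y != z -> arr z y}.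
  move=> xW; pose A := [set y in W | lay y == lay x].
  have nA y z : y \in A -> z \in A -> [/\ near y z, y \in S & z \in S].
    by rewrite !inE /near => /andP[yW /eqP->] /andP[zW /eqP->]; rewrite leqnSn !inS.
  have [|||z] := @set_max _ (fun y z => arr z y) A.
  - by exists x; rewrite inE xW eqxx.
  - move=> y z yA zA ne; have [n1 yS zS] := nA y z yA zA.
    by rewrite orbC; apply: tot.
  - move=> a b d aA bA dA ba db.
    have [n1 aS bS] := nA b a bA aA; have [n2 dS _] := nA d b dA bA.
    by have [n3 _ _] := nA d a dA aA; apply: (trans dS aS bS).
  rewrite inE => /andP[zW /eqP zx] zmin; exists z => //; split=> // y yW yx ne.
  by apply: zmin => //; rewrite inE yW yx eqxx.
pose good z := [&& z \in W, [forall y in W, (lay y == lay z) ==> (y != z) ==> arr z y] &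
  [forall y in W, (lay y < lay z) ==> ~~ (near y z && arr y z)]].
have goodP z : reflect [/\ z \in W, {in W, forall y, lay y = lay z -> y != z -> arr z y} &
    {in W, forall y, lay y < lay z -> near y z -> ~~ arr y z}] (good z).
  apply: (iffP and3P) => [[zW /forall_inP H1 /forall_inP H2]|[zW H1 H2]]; split=> //.
  - by move=> y yW E ne; have := H1 y yW; rewrite E eqxx ne.
  - by move=> y yW lt nyz; have := H2 y yW; rewrite lt nyz.
  - apply/forall_inP => y yW; apply/implyP => /eqP E; apply/implyP; exact: H1.
  apply/forall_inP => y yW; apply/implyP => lt; apply/negP => /andP[nyz].
  exact/negP/H2.
have [x0 x0W] := set0Pn _ W0.
have [z0 gz0] : exists z, good z.
  case: (arg_minnP lay x0W) => x xW xmin.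
  have [z zW [zx zmin]] := lmin x xW; exists z; apply/goodP; split=> //.
    by move=> y yW; rewrite zx; apply: zmin.
  by move=> y yW; rewrite zx ltnNge xmin.
case: (arg_maxnP lay gz0) => z /goodP[zW zmin zlow] zmax.
exists z => // y yW; apply/negP => /andP[nyz yz].
have yS := inS _ yW; have zS := inS _ zW.
have yne : y != z by apply: contraTneq yz => ->; apply/negP => zz; have := asym zS zS zz; rewrite zz.
case: (ltngtP (lay y) (lay z)) => [lt|gt|E].
- by have := zlow y yW lt nyz; rewrite yz.
- have Ey : lay y = (lay z).+1 by apply/eqP; move: nyz; rewrite /near eqn_leq gt andbT => /andP[].
  have [u uW [uy umin]] := lmin y yW; have uS := inS _ uW.
  have nuz : near u z by rewrite /near uy.
  have uz : arr u z.
    case: (eqVneq y u) => [<-//|ne]; apply: (trans uS yS zS) yz => //.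
      by rewrite /near uy leqnSn.
    by apply: umin.
  have : good u.
    apply/goodP; split=> //; first by move=> w wW; rewrite uy; apply: umin.
    move=> w wW; rewrite uy Ey ltnS => wz nwu; have wS := inS _ wW; apply/negP => wu.
    have Ew : lay w = lay z.
      by apply/eqP; rewrite eqn_leq wz; move: nwu; rewrite /near uy Ey ltnS => /andP[_].
    have wz' : arr w z.
      by apply: (trans wS uS zS) wu uz => //; rewrite /near Ew leqnSn.
    have ne : w != z.
      by apply: contraTneq wu => ->; exact: asym uz.
    by have := asym wS zS wz'; rewrite zmin.
  by move/zmax; rewrite /= uy Ey ltnn.
by have := asym yS zS yz; rewrite zmin.
Qed.

(** Removing sources one by one lists the points so that those in equal or consecutive layers appear
    in the direction of their arrow. The word of layer numbers then determines all these arrows. *)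
Lemma window_order (W : {set T}) : W \subset S ->
  exists xs : seq T, [/\ uniq xs, xs =i W & pairwise (fun x y => ~~ (near y x && arr y x)) xs].
Proof.
have [k] := ubnP #|W|; elim: k W => // k IH W cW WS.
case: (eqVneq W set0) => [->|W0].
  by exists [::]; split=> // x; rewrite inE.
have [x xW xsrc] := window_source WS W0.
have [||xs [u mem pw]] := IH (W :\ x).
- by move: cW; rewrite (cardsD1 x) xW ltnS.
- by apply: subset_trans WS; apply: subsetDl.
exists (x :: xs); split=> /=.
- by rewrite u mem !inE eqxx.
- by move=> y; rewrite inE mem !inE; case: (eqVneq y x) => [->|].
by rewrite pw andbT; apply/allP => y; rewrite mem inE => /andP[_ yW]; apply: xsrc.
Qed.

End WindowWords.

(** Labels may repeat, so the lift follows positions: the [i]-th point goes to the [i]-th one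
    selected by the mask. *)
Lemma subseq_map_lift (T T' L : eqType) (f : T -> L) (f' : T' -> L) xs ys (t0 : T') :
  subseq (map f xs) (map f' ys) -> uniq xs -> uniq ys ->
  exists g : T -> T', [/\ forall x, x \in xs -> g x \in ys /\ f' (g x) = f x &
    forall x y, x \in xs -> y \in xs -> index x xs < index y xs ->
      index (g x) ys < index (g y) ys].
Proof.
move=> /subseqP[msk sz E] ux uy; pose zs := mask msk ys.
have Ez : map f' zs = map f xs by rewrite map_mask E.
have szz : size zs = size xs by rewrite -(size_map f') Ez size_map.
have sub : subseq zs ys by apply: mask_subseq.
have uz : uniq zs by apply: subseq_uniq sub uy.
pose g x := nth t0 zs (index x xs).
have gz x : x \in xs -> g x \in zs by move=> xx; rewrite mem_nth // szz index_mem.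
exists g; split=> [x xx|x y xx yy lt].
  split; first by apply: mem_subseq sub _ (gz _ xx).
  case: xs ux E Ez szz xx @g gz => // a xs ux E Ez szz xx g gz.
  rewrite -(nth_map t0 (f a)) ?szz ?index_mem // Ez (nth_map a) ?index_mem //.
  by rewrite nth_index.
have iz w : w \in xs -> index (g w) zs = index w xs.
  by move=> ww; rewrite index_uniq // szz index_mem.
have key (ws vs : seq T') a b : subseq ws vs -> uniq vs -> a \in ws -> b \in ws ->
    index a ws < index b ws -> index a vs < index b vs.
  elim: vs ws => [|v vs IH] [|w ws] //= sub' /andP[nv uv].
  case: (eqVneq w v) sub' => [->|wv] sub'.
    rewrite !inE; case: (eqVneq v a) => [<-|va]; case: (eqVneq v b) => [<-|vb] //=.
    by rewrite !ltnS; apply: IH.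
  move=> aw bw lt'; have ww := mem_subseq sub'.
  rewrite ifN; last by apply: contraNneq nv => ->; apply: ww.
  rewrite ifN; last by apply: contraNneq nv => ->; apply: ww.
  rewrite ltnS; apply: (IH (w :: ws)) => //=.
by apply: (key zs) => //; rewrite ?gz // !iz.
Qed.

Lemma eqmod_eq l x y : x = y %[mod l] -> x < y + l -> y < x + l -> x = y.
Proof.
move=> E xy yx; case: (leqP x y) => le.
  by have [[|j]] := eqmod_addP le E; rewrite ?mulSn; lia.
by have [[|j]] := eqmod_addP (ltnW le) (esym E); rewrite ?mulSn; lia.
Qed.

(** * The cyclic sequence of cells of a strongly connected piece *)

Section Cells.
Variables (m n : nat) (M : 'M[int]_(m, n)).
Hypothesis Hcyc : rc_is_cycle M.
Notation E := ('I_m * 'I_n)%type.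
Notation l := (ncells M).

Definition cadj : rel E := fun e e' => (e.1 == e'.1) || (e.2 == e'.2).
Definition nzc (e : E) : bool := M e.1 e.2 != 0%R.
Definition share (b : bool) (e e' : E) : bool := if b then e.1 == e'.1 else e.2 == e'.2.

Lemma cadj_refl : reflexive cadj.
Proof. by move=> e; rewrite /cadj eqxx. Qed.

Lemma cadj_sym : symmetric cadj.
Proof. by move=> e e'; rewrite /cadj eq_sym (eq_sym e.2). Qed.

Lemma cadj_share e e' : cadj e e' -> exists b, share b e e'.
Proof. by case/orP => H; [exists true | exists false]. Qed.

Lemma share_cadj b e e' : share b e e' -> cadj e e'.
Proof. by rewrite /cadj; case: b => /= ->; rewrite ?orbT. Qed.

Lemma share_sym b e e' : share b e e' = share b e' e.
Proof. by rewrite /share; case: b; rewrite eq_sym. Qed.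

Lemma other_cell : exists oth : bool -> E -> E, forall b e, nzc e ->
  [/\ nzc (oth b e), oth b e != e, share b e (oth b e) &
      forall e', nzc e' -> share b e e' -> e' = e \/ e' = oth b e].
Proof.
pose P (be : bool * E) e' := nzc be.2 -> [/\ nzc e', e' != be.2, share be.1 be.2 e' &
      forall e2, nzc e2 -> share be.1 be.2 e2 -> e2 = be.2 \/ e2 = e'].
have H be : exists e', P be e'.
  case: be => b [i j]; rewrite /P /=.
  case: (boolP (nzc (i, j))) => nz; last by exists (i, j).
  case: b.
    have lk : i < gdim m n true by [].
    have [k2 [ne [i' [j' [nz' /val_inj ii' k2j]]]]] := nzline_other Hcyc lk j; subst i' k2.
    exists (i, j') => _; split=> //=.
      by apply/eqP => -[jj]; rewrite jj in ne.
    move=> [i2 j2] nz2 /= /eqP ii2; subst i2.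
    have n1 : nzline M true i j by exists i, j.
    have n2 : nzline M true i j' by exists i, j'.
    have n3 : nzline M true i j2 by exists i, j2.
    by case: (nzline_two Hcyc n1 n2 (nesym ne) n3) => /val_inj ->; [left | right].
  have lk : j < gdim m n false by [].
  have [k2 [ne [i' [j' [nz' k2i /val_inj jj']]]]] := nzline_other Hcyc lk i; subst j' k2.
  exists (i', j) => _; split=> //=.
    by apply/eqP => -[ii]; rewrite ii in ne.
  move=> [i2 j2] nz2 /= /eqP jj2; subst j2.
  have n1 : nzline M false j i by exists i, j.
  have n2 : nzline M false j i' by exists i', j.
  have n3 : nzline M false j i2 by exists i2, j.
  by case: (nzline_two Hcyc n1 n2 (nesym ne) n3) => /val_inj ->; [left | right].
have [o Ho] := choice_fun H.
by exists (fun b e => o (b, e)) => b e; apply: (Ho (b, e)).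
Qed.

(** Connectedness of the line graph is carried over to cells through the property of a line that [X]
    holds on all its non-zero cells. *)
Lemma cell_connected (X : E -> Prop) e0 : nzc e0 -> X e0 ->
  (forall e e', X e -> nzc e -> nzc e' -> cadj e e' -> X e') -> forall e, nzc e -> X e.
Proof.
move=> nz0 X0 clos e nz.
pose P b k := forall e' : E, nzc e' -> (if b then e'.1 : nat else e'.2) = k -> X e'.
have Pclos b k k' : P b k -> nzline M b k k' -> P (~~ b) k'.
  move=> Pk [i [j [nzij E1 E2]]].
  have Xij : X (i, j) by apply: Pk => //=; case: b E1 E2.
  move=> e' nz' E'; apply: (clos (i, j)) => //; rewrite /cadj /=.
  case: b E1 E2 E' {Pk} => /= E1 E2 E'; apply/orP; [right | left]; apply/eqP/val_inj => /=.
    by rewrite E' -E2.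
  by rewrite E' -E1.
have P0 : P true (e0.1 : nat).
  by move=> e' nz' /= /val_inj E'; apply: (clos e0) => //; rewrite /cadj E' eqxx.
have H1 : forall b' k', k' < gdim m n b' -> P b' k'.
  by apply: (nzline_connected Hcyc Pclos (b := true) (k := e0.1)).
exact: (H1 true e.1).
Qed.

Section NextCell.
Variables (T : finType) (cl : T -> E) (arr : rel T) (S : {set T}).
Hypotheses (L : line_structure cadj cl arr) (nzT : forall x, nzc (cl x)).
Hypotheses (indS : indecomposable arr S) (S1 : 1 < #|S|).

Definition topmost (x : T) : bool :=
  (x \in S) && [forall y in S, (cl y == cl x) ==> (y != x) ==> arr y x].

Lemma topmostP x : reflect (x \in S /\ forall y, y \in S -> cl y = cl x -> y != x -> arr y x)
  (topmost x).
Proof.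
apply: (iffP andP) => -[xS H]; split=> //.
  by move=> y yS E ne; move/forall_inP: H => /(_ y yS); rewrite E eqxx ne.
by apply/forall_inP => y yS; apply/implyP => /eqP E; apply/implyP; apply: H.
Qed.

Lemma topmost_ex x : x \in S -> exists2 y, topmost y & cl y = cl x /\ (x = y \/ arr x y).
Proof.
move=> xS; have [|||y] := @set_max _ arr [set y in S | cl y == cl x].
- by exists x; rewrite inE xS eqxx.
- move=> a b; rewrite !inE => /andP[_ /eqP Ea] /andP[_ /eqP Eb]; apply: (arr_tot L).
  by rewrite Ea Eb cadj_refl.
- move=> a b d; rewrite !inE => /andP[_ /eqP Ea] _ /andP[_ /eqP Ed] ab bd.
  by apply: (arr_trans L ab bd); rewrite Ea Ed cadj_refl.
rewrite inE => /andP[yS /eqP Ey] ymax; exists y.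
  by apply/topmostP; split=> // z zS Ez ne; apply: ymax; rewrite // inE zS Ez Ey eqxx.
split=> //; case: (eqVneq x y) => [->|ne]; first by left.
by right; apply: ymax; rewrite // inE xS eqxx.
Qed.

(* Each topmost point has an arrow into a neighbouring cell, and a line carries such arrows
   in one direction only; the line cycle has as many lines as cells, so it is cyclically
   oriented. *)
Lemma next_cell : exists nxt : E -> E,
  [/\ injective nxt,
      forall e, nzc e -> [/\ nzc (nxt e), cadj e (nxt e) & nxt e != e],
      forall e e', nzc e -> nzc e' -> cadj e e' -> [\/ e' = e, e' = nxt e | e = nxt e'],
      forall e e', nzc e -> nzc e' -> fconnect nxt e e' &
      forall x, x \in S -> exists y, [/\ y \in S, cl y = nxt (cl x) & arr x y]].
Proof.
have [oth Hoth] := other_cell.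
pose X e := [exists x in S, cl x == e].
have XP e : reflect (exists2 x, x \in S & cl x = e) (X e).
  by apply: (iffP exists_inP) => -[x xS /eqP H]; exists x => //; apply/eqP.
have Xnz e : X e -> nzc e by move/XP=> [x _ <-].
have othK b e : nzc e -> oth b (oth b e) = e.
  move=> nz; have [nz1 ne1 sh1 H1] := Hoth b e nz; have [nz2 ne2 sh2 H2] := Hoth b _ nz1.
  by case: (H2 e nz); rewrite ?(share_sym _ _ e) // => E1; rewrite -E1 eqxx in ne1.
(* The last point of [S] in cell [e] has an arrow into the other cell of its line along [b]. Some
   [b] has this property because arrows leave the singleton of that last point. *)
pose dir e b := exists x y, [/\ topmost x, cl x = e, y \in S, cl y = oth b e & arr x y].
have dirX e b : dir e b -> X (oth b e).
  by move=> [x [y [_ _ yS Ey _]]]; apply/XP; exists y.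
have dir_ex e : X e -> exists b, dir e b.
  move=> /XP[x0 x0S <-]; have [x xtop [Ex _]] := topmost_ex x0S.
  have [xS xmax] := topmostP _ xtop; have [_ cut] := indS.
  have [||| x' [y [/set1P -> yS]]] := cut [set x].
  - by rewrite sub1set.
  - by apply/set0Pn; exists x; rewrite inE.
  - by apply: contraTneq S1 => <-; rewrite cards1.
  rewrite inE => yx xy.
  have [b sh] := cadj_share (arr_adj L xy).
  have [_ _ _ H] := Hoth b _ (nzT x).
  case: (H _ (nzT y) sh) => Ey.
    by have := arr_asym L xy; rewrite xmax.
  by exists b, x, y; rewrite -Ex.
(* Arrows in both directions along a line would make the last point of each of its two cells precede
   the last point of the other. *)
have dir_one e b : nzc e -> dir e b -> dir (oth b e) b -> False.
  move=> nz [x [y [xtop Ex yS Ey xy]]] [x' [y' [xtop' Ex' yS' Ey' xy']]].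
  have [xS xmax] := topmostP _ xtop; have [xS' xmax'] := topmostP _ xtop'.
  rewrite othK // in Ey'; have [_ _ sh _] := Hoth b e nz.
  have aj : cadj e (oth b e) := share_cadj sh.
  have xx' : arr x x'.
    case: (eqVneq y x') => [<-//|ne]; apply: (arr_trans L xy); first by apply: xmax'; rewrite ?Ex'.
    by rewrite Ex Ex'.
  have x'x : arr x' x.
    case: (eqVneq y' x) => [<-//|ne]; apply: (arr_trans L xy'); first by apply: xmax; rewrite ?Ex.
    by rewrite Ex Ex' cadj_sym.
  by have := arr_asym L xx'; rewrite x'x.
have [nb Hnb] : exists nb : E -> bool, forall e, X e -> dir e (nb e).
  apply: (@choice_fun E bool (fun e b => X e -> dir e b)) => e.
  case: (boolP (X e)) => [/dir_ex[b]|]; last by exists true.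
  by exists b.
pose nxt e := if X e then oth (nb e) e else e.
have nX e : X e -> X (nxt e) by move=> Xe; rewrite /nxt Xe; apply/dirX/Hnb.
(* A cell entered along one axis is left along the other, so the axes alternate. *)
have nbn e : X e -> nb (nxt e) = ~~ nb e.
  move=> Xe; have := Hnb _ (nX e Xe); have := Hnb _ Xe.
  rewrite /nxt Xe; case: (eqVneq (nb (oth (nb e) e)) (nb e)) => [-> d1 d2|].
    by case: (dir_one e (nb e) (Xnz _ Xe) d1 d2).
  by case: (nb (oth _ e)); case: (nb e).
have ninj : injective nxt.
  move=> e e'; case: (boolP (X e)) => Xe; case: (boolP (X e')) => Xe' En.
  - have := nbn _ Xe; have := nbn _ Xe'; rewrite En => -> /negb_inj nbE.
    move: En; rewrite /nxt Xe Xe' nbE => En.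
    by rewrite -(othK (nb e) e) ?Xnz // En othK // Xnz.
  - by have := nX _ Xe; rewrite En {1}/nxt (negbTE Xe') (negbTE Xe').
  - by have := nX _ Xe'; rewrite -En {1}/nxt (negbTE Xe) (negbTE Xe).
  by move: En; rewrite /nxt (negbTE Xe) (negbTE Xe').
have [_ _] := indS; have [x0 x0S] : exists x, x \in S by apply/card_gt0P; apply: ltnW.
have X0 : X (cl x0) by apply/XP; exists x0.
have orbX e : fconnect nxt (cl x0) e -> X e.
  move=> /iter_findex <-; elim: (findex _ _ _) => //= k IH; exact: nX.
have adjP e e' : X e -> nzc e' -> cadj e e' ->
    [\/ e' = e, e' = nxt e | exists2 d, fconnect nxt e d & e = nxt d /\ e' = d].
  move=> Xe nz' /cadj_share[b sh]; have [_ _ _ H] := Hoth b e (Xnz _ Xe).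
  case: (H e' nz' sh) => [->|E']; first by constructor 1.
  case: (eqVneq b (nb e)) => [bE|bne]; first by constructor 2; rewrite /nxt Xe -bE.
  constructor 3; exists (finv nxt e); first by rewrite -fconnect_sym // -{2}(f_finv ninj e) fconnect1.
  have En : nxt (finv nxt e) = e by apply: f_finv.
  split; first by [].
  case: (boolP (X (finv nxt e))) => Xd; last by move: En; rewrite {1}/nxt (negbTE Xd) => Ed; rewrite Ed Xe in Xd.
  have := nbn _ Xd; rewrite En => nbE; have {}nbE : b = nb (finv nxt e).
    by move: bne; rewrite nbE; case: (b); case: (nb _).
  by rewrite E' -{1}En /nxt Xd nbE othK // Xnz.
have allorb e : nzc e -> fconnect nxt (cl x0) e.
  apply: (cell_connected (X := fun e => fconnect nxt (cl x0) e) (nzT x0)); first exact: connect0.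
  move=> e1 e2 c1 nz1 nz2 aj; case: (adjP e1 e2 (orbX _ c1) nz2 aj) => [->//|->|[d cd [_ ->]]].
    by apply: connect_trans c1 (fconnect1 _ _).
  exact: connect_trans c1 cd.
have allX e : nzc e -> X e by move/allorb/orbX.
exists nxt; split=> //.
- move=> e nz; have [nz1 ne1 sh1 _] := Hoth (nb e) e nz.
  by rewrite /nxt allX //; split=> //; apply: share_cadj sh1.
- move=> e e' nz nz' aj; case: (adjP e e' (allX e nz) nz' aj) => [->|->|[d _ [-> ->]]].
  + by constructor 1.
  + by constructor 2.
  by constructor 3.
- move=> e e' nz nz'; apply: connect_trans (allorb e' nz').
  by rewrite fconnect_sym // allorb.
move=> x xS; have Xx : X (cl x) by apply/XP; exists x.
have [z [y [ztop Ez yS Ey zy]]] := Hnb _ Xx.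
have [zS zmax] := topmostP _ ztop.
exists y; split=> //; first by rewrite Ey /nxt Xx.
case: (eqVneq x z) => [->//|ne]; apply: (arr_trans L (zmax x xS (esym Ez) ne) zy).
by rewrite Ey; have [_ _ sh _] := Hoth (nb (cl x)) _ (nzT x); apply: share_cadj sh.
Qed.

End NextCell.

End Cells.

(** * The greedy coil of a piece and its layers *)

Section CoilStructure.
Variables (m n : nat) (M : 'M[int]_(m, n)).
Hypothesis Hcyc : rc_is_cycle M.
Notation E := ('I_m * 'I_n)%type.
Notation l := (ncells M).
Notation cadj := (@cadj m n).

(* [W 0, W 1, ...] is a maximal coil in [S], read along the cyclic sequence of cells [e], and
   [lay] cuts [S] into layers, the [k]-th one having [W k] as its minimum. *)
Record coil_structure (T : finType) (cl : T -> E) (arr : rel T) (S : {set T})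
    (e : nat -> E) (W : nat -> T) (R : nat) (lay : T -> nat) : Prop := MkCoilStructure {
  cs_nz : forall k, nzc M (e k);
  cs_mod : forall i j, e i = e j <-> i = j %[mod l];
  cs_surj : forall c, nzc M c -> exists k, e k = c;
  cs_adjP : forall i j, cadj (e i) (e j) ->
    [\/ i = j %[mod l], j = i.+1 %[mod l] | i = j.+1 %[mod l]];
  cs_in : forall k, k < R -> W k \in S;
  cs_layW : forall k, k < R -> lay (W k) = k;
  cs_lay_lt : forall x, x \in S -> lay x < R;
  cs_cl : forall x, x \in S -> cl x = e (lay x);
  cs_min : forall x, x \in S -> x <> W (lay x) -> arr (W (lay x)) x;
  cs_far : forall x y, x \in S -> y \in S -> cadj (cl x) (cl y) -> (lay y).+2 <= lay x -> arr x y;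
  cs_next : forall k y, y \in S -> lay y = k.+1 -> arr (W k) y;
  cs_twin : forall x, x \in S -> x <> W (lay x) -> exists i x',
    [/\ i <= lay x + l, lay x' <= i + l, x' \in S, x' <> W (lay x') & cl x' = e i] /\
    (i.+1 < R -> arr x' (W i.+1)) /\
    (forall k, i.+1 < k -> k < R -> cadj (cl (W k)) (cl x') -> arr (W k) x') }.

Variables (T : finType) (cl : T -> E) (arr : rel T) (S : {set T}).
Hypotheses (L : line_structure cadj cl arr) (nzT : forall x, nzc M (cl x)).
Hypotheses (indS : indecomposable arr S).
Variable nxt : E -> E.
Hypotheses (nxt_inj : injective nxt)
  (nxt_nz : forall e, nzc M e -> [/\ nzc M (nxt e), cadj e (nxt e) & nxt e != e])
  (nxt_adj : forall e e', nzc M e -> nzc M e' -> cadj e e' -> [\/ e' = e, e' = nxt e | e = nxt e'])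
  (nxt_conn : forall e e', nzc M e -> nzc M e' -> fconnect nxt e e')
  (nxt_out : forall x, x \in S -> exists y, [/\ y \in S, cl y = nxt (cl x) & arr x y]).

Definition arrle (x y : T) : bool := (x == y) || arr x y.

Let l3 : 3 < l := ncells_gt3 Hcyc.

Lemma adj_cl_refl x y : cl x = cl y -> cadj (cl x) (cl y).
Proof. by move=> ->; apply: cadj_refl. Qed.

Lemma adj_nxt x y : cl y = nxt (cl x) -> cadj (cl x) (cl y).
Proof. by move=> ->; have [] := nxt_nz (nzT x). Qed.

Lemma arrle_trans x y z : arrle x y -> arrle y z -> cadj (cl x) (cl z) -> arrle x z.
Proof.
rewrite /arrle => /orP[/eqP->//|xy] /orP[/eqP<-|yz] a; first by rewrite xy orbT.
by rewrite (arr_trans L xy yz a) orbT.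
Qed.

Lemma arr_arrle x y z : arr x y -> arrle y z -> cadj (cl x) (cl z) -> arr x z.
Proof. by rewrite /arrle => xy /orP[/eqP<-//|yz] a; apply: arr_trans xy yz a. Qed.

Lemma arrle_arr x y z : arrle x y -> arr y z -> cadj (cl x) (cl z) -> arr x z.
Proof. by rewrite /arrle => /orP[/eqP->//|xy] yz a; apply: arr_trans xy yz a. Qed.

Lemma arrle_anti x y : arrle x y -> arrle y x -> x = y.
Proof.
rewrite /arrle => /orP[/eqP//|xy] /orP[/eqP//|yx].
by have := arr_asym L xy; rewrite yx.
Qed.

Lemma arrle_total x y : cadj (cl x) (cl y) -> ~~ arrle x y -> arr y x.
Proof.
rewrite /arrle negb_or => a /andP[ne nxy].
by have := arr_tot L a ne; rewrite (negbTE nxy).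
Qed.

(** The greedy step of the coil. Taking the first possible point makes [f] weakly increasing on
    every cell, on which the comparisons below rest. *)
Lemma first_out : exists f : T -> T, forall x, x \in S ->
  [/\ f x \in S, cl (f x) = nxt (cl x), arr x (f x) &
      forall y, y \in S -> cl y = nxt (cl x) -> arr x y -> arrle (f x) y].
Proof.
apply: (@choice_fun T T (fun x fx => x \in S -> [/\ fx \in S, cl fx = nxt (cl x), arr x fx &
  forall y, y \in S -> cl y = nxt (cl x) -> arr x y -> arrle fx y])) => x.
case: (boolP (x \in S)) => xS; last by exists x.
have [y0 [y0S Ey0 xy0]] := nxt_out xS.
pose A := [set y in S | (cl y == nxt (cl x)) && arr x y].
have inA y : y \in A -> [/\ y \in S, cl y = nxt (cl x) & arr x y].
  by rewrite inE => /and3P[yS /eqP Ey xy].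
have [|||y yA ymin] := @set_max _ (fun a b => arr b a) A.
- by exists y0; rewrite inE y0S Ey0 eqxx.
- move=> a b /inA[_ Ea _] /inA[_ Eb _] ne.
  by rewrite orbC; apply: (arr_tot L) => //; apply: adj_cl_refl; rewrite Ea Eb.
- move=> a b d /inA[_ Ea _] /inA[_ Eb _] /inA[_ Ed _] ba db.
  by apply: (arr_trans L db ba); apply: adj_cl_refl; rewrite Ea Ed.
have [yS Ey xy] := inA _ yA.
exists y => _; split=> // z zS Ez xz.
rewrite /arrle; case: (eqVneq y z) => //= ne.
by apply: ymin; rewrite 1?eq_sym // inE zS Ez eqxx.
Qed.

Section Orbit.
Variable f : T -> T.
Hypotheses (f_in : forall x, x \in S -> f x \in S)
  (f_cl : forall x, x \in S -> cl (f x) = nxt (cl x))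
  (f_arr : forall x, x \in S -> arr x (f x))
  (f_min : forall x y, x \in S -> y \in S -> cl y = nxt (cl x) -> arr x y -> arrle (f x) y).
Variable w0 : T.
Hypotheses (w0_top : topmost cl arr S w0)
  (w0_max : forall x, topmost cl arr S x -> order f x <= order f w0).

Let w0S : w0 \in S. Proof. by have [] := topmostP cl arr S _ w0_top. Qed.

Lemma w0_le x : x \in S -> cl x = cl w0 -> arrle x w0.
Proof.
have [_ H] := topmostP cl arr S _ w0_top => xS Ex; rewrite /arrle.
by case: eqVneq => //= ne; apply: H.
Qed.

Lemma f_mono x y : x \in S -> y \in S -> cl x = cl y -> arrle x y -> arrle (f x) (f y).
Proof.
move=> xS yS Exy xy; have aj : cl (f y) = nxt (cl x) by rewrite Exy f_cl.
by apply: f_min; rewrite ?f_in //; apply: (arrle_arr xy (f_arr yS)); apply: adj_nxt.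
Qed.

Lemma f_le_arr x y : x \in S -> cl y = nxt (cl x) -> arrle (f x) y -> arr x y.
Proof. by move=> xS Ey; move/(arr_arrle (f_arr xS)); apply; apply: adj_nxt. Qed.

Lemma f_nle_arr x y : x \in S -> y \in S -> cl y = nxt (cl x) -> ~~ arrle (f x) y -> arr y x.
Proof.
move=> xS yS Ey nle; have ne : x != y.
  by apply: contraTneq (isT) => xy; have [_ _] := nxt_nz (nzT x); rewrite -Ey xy eqxx.
have := arr_tot L (adj_nxt Ey) ne => /orP[xy|//].
by rewrite (f_min xS yS Ey xy) in nle.
Qed.

Definition cellseq (k : nat) : E := iter k nxt (cl w0).
Definition coilseq (k : nat) : T := iter k f w0.
Notation e := cellseq.
Notation W := coilseq.
Notation R := (order f w0).

Lemma cellseq_nz k : nzc M (e k).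
Proof. by elim: k => [|k IH]; [exact: nzT | have [] := nxt_nz IH]. Qed.

Lemma order_nxt : order nxt (cl w0) = l.
Proof.
apply: eq_card => x; rewrite inE /=.
apply/idP/idP => [/iter_findex <-|nzx]; first exact: cellseq_nz.
exact: nxt_conn.
Qed.

Lemma cellseq_per k : e (k + l) = e k.
Proof. by rewrite /e iterD -{1}order_nxt iter_order. Qed.

Lemma cellseq_perM k j : e (k + j * l) = e k.
Proof. by elim: j => [|j IH]; rewrite ?addn0 // mulSn addnCA addnC cellseq_per. Qed.

Lemma cellseq_mod i j : e i = e j <-> i = j %[mod l].
Proof.
have red k : e k = e (k %% l) by rewrite {1}(divn_eq k l) addnC cellseq_perM.
split=> [H|H]; last by rewrite red H -red.
have l0 : 0 < l by apply: ltn_trans l3.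
have fi k : findex nxt (cl w0) (e (k %% l)) = k %% l.
  by apply: findex_iter; rewrite order_nxt ltn_mod.
by rewrite -(fi i) -red H red fi.
Qed.

Lemma cellseq_adjP i j : cadj (e i) (e j) ->
  [\/ i = j %[mod l], j = i.+1 %[mod l] | i = j.+1 %[mod l]].
Proof.
case/(nxt_adj (cellseq_nz i) (cellseq_nz j)) => H.
- by constructor 1; apply/cellseq_mod.
- by constructor 2; apply/cellseq_mod.
by constructor 3; apply/cellseq_mod.
Qed.

Lemma coilseq_in k : W k \in S.
Proof. by elim: k => //= k IH; apply: f_in. Qed.

Lemma coilseq_cl k : cl (W k) = e k.
Proof. by elim: k => //= k IH; rewrite f_cl ?IH // coilseq_in. Qed.

(** True at the root, which is the last point of its cell, and carried along the orbit by
    monotonicity of [f]. *)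
Lemma coilseq_period k : arrle (W (k + l)) (W k).
Proof.
have c k' : cl (W (k' + l)) = cl (W k') by rewrite !coilseq_cl cellseq_per.
elim: k => [|k IH]; first by apply: w0_le; rewrite ?coilseq_in // c.
by rewrite addSn; apply: f_mono; rewrite ?coilseq_in.
Qed.

Lemma coilseq_le i j : j <= i -> i = j %[mod l] -> arrle (W i) (W j).
Proof.
move=> ji /esym/(eqmod_addP ji)[q ->]; elim: q => [|q IH]; first by rewrite addn0 /arrle eqxx.
rewrite mulSn addnCA addnC; apply: arrle_trans (coilseq_period _) IH _.
by apply: adj_cl_refl; rewrite !coilseq_cl cellseq_per cellseq_perM.
Qed.

Lemma coilseq_inj i j : i < R -> j < R -> W i = W j -> i = j.
Proof. by move=> li lj H; rewrite -(findex_iter li) -(findex_iter lj) -/(W i) H. Qed.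

Lemma coilseq_reduce k : exists2 k', k' < R & W k' = W k.
Proof.
have c : fconnect f w0 (W k) by apply: fconnect_iter.
by exists (findex f w0 (W k)); [apply: findex_max | apply: iter_findex].
Qed.

Lemma ncells_le_order : l <= R.
Proof.
have [k lk E] := coilseq_reduce R.
have : R = k %[mod l] by apply/cellseq_mod; rewrite -!coilseq_cl E.
by move/esym/(eqmod_addP (ltnW lk)) => [[|q]]; rewrite ?mulSn; lia.
Qed.

(** The orbit closes up at some [W k0] equal to [W R], with [k0 <= R - l] by the cells. The weak
    chain [W R], [W (R - l)], [W k0] thus collapses to equalities. *)
Lemma coilseq_stable k : R <= k -> W k = W (k - l).
Proof.
have H i : W (R + i) = W (R - l + i).
  elim: i => [|i IH]; last by rewrite !addnS /= -/(W (R + i)) IH.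
  rewrite !addn0; have [k0 lk E] := coilseq_reduce R.
  have Em : R = k0 %[mod l] by apply/cellseq_mod; rewrite -!coilseq_cl E.
  have lR := ncells_le_order.
  have Em' : R = R - l %[mod l] by rewrite -{1}(subnK lR) modnDr.
  have le : k0 <= R - l.
    by have [[|q]] := eqmod_addP (ltnW lk) (esym Em); rewrite ?mulSn; lia.
  apply: arrle_anti; first by apply: coilseq_le => //; lia.
  by rewrite -E; apply: coilseq_le => //; rewrite -Em'.
move=> Rk; have := H (k - R); rewrite subnKC // => ->; congr (W _).
by have := ncells_le_order; lia.
Qed.

(** The points lying weakly after some coil point of their cell form a set that no arrow leaves,
    hence all of [S]. The critical arrow leads from [y] to a point [z] of the previous cell: if [z]
    preceded the coil point there, [f z] would lie weakly before [y], and [z] would precede [y]. *)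
Lemma above_coil x : x \in S -> exists k, cl (W k) = cl x /\ arrle (W k) x.
Proof.
pose A := [set y in S | [exists k : 'I_R, (cl (W k) == cl y) && arrle (W k) y]].
have inA y k : y \in S -> cl (W k) = cl y -> arrle (W k) y -> y \in A.
  move=> yS Ek ky; rewrite inE yS /=; have [k' lk' E'] := coilseq_reduce k.
  by apply/existsP; exists (Ordinal lk'); rewrite /= E' Ek eqxx.
have AP y : y \in A -> y \in S /\ exists k, cl (W k) = cl y /\ arrle (W k) y.
  by rewrite inE => /andP[yS /existsP[k /andP[/eqP H1 H2]]]; split=> //; exists k.
suff EA : A = S by rewrite -EA => /AP[].
apply/eqP/negPn/negP => ne; have [_ cut] := indS.
have [|||y [z [yA zS zA yz]]] := cut A; rewrite ?ne //.
- by apply/subsetP => y /AP[].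
- by apply/set0Pn; exists w0; apply: (inA _ 0) => //; rewrite /arrle eqxx.
have [yS [k [Ek ky]]] := AP y yA; case/negP: zA.
have c1 : cl (f (W k)) = nxt (cl y) by rewrite f_cl ?coilseq_in // Ek.
have fk : arrle (f (W k)) (f y) by apply: f_mono; rewrite ?coilseq_in.
case: (nxt_adj (nzT y) (nzT z) (arr_adj L yz)) => Ez.
- apply: (inA z k) => //; first by rewrite Ek.
  by rewrite /arrle (arrle_arr ky yz) ?orbT // adj_cl_refl // Ek Ez.
- apply: (inA z k.+1) => //=; rewrite -/(W k) ?c1 ?Ez //.
  apply: arrle_trans fk (f_min yS zS Ez yz) _.
  by apply: adj_cl_refl; rewrite c1.
pose k' := k + l.-1; have k'S : k'.+1 = k + l by rewrite /k'; lia.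
have Ek' : cl (W k') = cl z.
  by apply: nxt_inj; rewrite -Ez -Ek !coilseq_cl -[nxt (e k')]/(e k'.+1) k'S cellseq_per.
apply: (inA z k') => //; apply/negPn/negP => nle.
have zk' : arr z (W k') by apply: arrle_total nle; apply: adj_cl_refl.
have fz : arrle (f z) (f (W k')).
  by apply: f_mono; rewrite ?coilseq_in ?Ek' // /arrle zk' orbT.
have fzy : arrle (f z) y.
  have e1 : cl (f z) = cl y by rewrite f_cl.
  have e2 : cl (W (k + l)) = cl y by rewrite coilseq_cl cellseq_per -coilseq_cl.
  apply: (@arrle_trans _ (W (k + l))); last by apply: adj_cl_refl.
    by rewrite -k'S.
  apply: arrle_trans (coilseq_period k) ky _; exact: adj_cl_refl.
by have := arr_asym L yz; rewrite (f_le_arr zS Ez fzy).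
Qed.

(** The layer is the least index of a coil point in the cell of [x] weakly before [x]. It stays
    below [R] because from [R] on every coil point repeats the one a turn earlier. *)
Lemma layer_ex : exists lay : T -> nat, forall x, x \in S ->
  [/\ lay x < R, cl x = e (lay x), arrle (W (lay x)) x &
      forall k, k < lay x -> e k = cl x -> arr x (W k)].
Proof.
apply: (@choice_fun T nat (fun x i => x \in S -> [/\ i < R, cl x = e i, arrle (W i) x &
      forall k, k < i -> e k = cl x -> arr x (W k)])) => x.
case: (boolP (x \in S)) => xS; last by exists 0.
have ex : exists k, (e k == cl x) && arrle (W k) x.
  by have [k [H1 H2]] := above_coil xS; exists k; rewrite -coilseq_cl H1 eqxx.
exists (ex_minn ex) => _; case: ex_minnP => i /andP[/eqP Ei ix] imin.
have lt_arr k : k < i -> e k = cl x -> arr x (W k).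
  move=> ki Ek; apply: arrle_total; first by apply: adj_cl_refl; rewrite coilseq_cl.
  by apply: contraTN ki => kx; rewrite -leqNgt imin // Ek eqxx.
split=> //; rewrite ltnNge; apply/negP => Ri.
have lR := ncells_le_order.
have Eil : e (i - l) = cl x by rewrite -Ei -{2}(subnK (leq_trans lR Ri)) cellseq_per.
have := imin (i - l); rewrite Eil eqxx -coilseq_stable // => /(_ ix); lia.
Qed.

Section Layers.
Variable lay : T -> nat.
Hypotheses (lay_lt : forall x, x \in S -> lay x < R)
  (lay_cl : forall x, x \in S -> cl x = e (lay x))
  (lay_ge : forall x, x \in S -> arrle (W (lay x)) x)
  (lay_min : forall x k, x \in S -> k < lay x -> e k = cl x -> arr x (W k)).

Lemma layer_le x k : x \in S -> e k = cl x -> arrle (W k) x -> lay x <= k.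
Proof.
move=> xS Ek kx; rewrite leqNgt; apply/negP => lt; have xk := lay_min xS lt Ek.
have E := arrle_anti kx; have : W k = x by apply: E; rewrite /arrle xk orbT.
by move=> E'; have := arr_irr x L; rewrite -{2}E' xk.
Qed.

Lemma layer_coil k : k < R -> lay (W k) = k.
Proof.
move=> lk; have kS := coilseq_in k.
have le : lay (W k) <= k by apply: layer_le; rewrite ?coilseq_cl // /arrle eqxx.
have Em : k = lay (W k) %[mod l] by apply/cellseq_mod; rewrite -lay_cl // coilseq_cl.
apply: (coilseq_inj (lay_lt kS) lk); apply: arrle_anti; first exact: lay_ge.
exact: coilseq_le.
Qed.

Lemma layer_next k y : y \in S -> lay y = k.+1 -> arr (W k) y.
Proof.
move=> yS Ey; apply: f_le_arr; rewrite ?coilseq_in //.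
  by rewrite (lay_cl yS) Ey coilseq_cl.
by have := lay_ge yS; rewrite Ey.
Qed.

(** [x] precedes all coil points of its cell with a smaller index than its layer, and [f] transports
    this to the neighbouring cells. Layer [0] is treated apart: it contains only the root, the last
    point of its cell. *)
Lemma layer_far x y : x \in S -> y \in S -> cadj (cl x) (cl y) ->
  (lay y).+2 <= lay x -> arr x y.
Proof.
move=> xS yS aj far; have Ex := lay_cl xS; have Ey := lay_cl yS; have gy := lay_ge yS.
move: (aj); rewrite Ex Ey => /cellseq_adjP[E0|E0|E0].
- apply: (arr_arrle (lay_min xS _ _) gy aj); first by lia.
  by rewrite Ex; apply/cellseq_mod.
- case Eb : (lay y) => [|b] in far E0 *; last first.
    have Eb' : e b = cl x.
      have H : e (lay x).+1 = e b.+1 by apply/cellseq_mod.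
      by rewrite Ex; apply: nxt_inj; exact: esym H.
    have xb : arr x (W b) by apply: lay_min => //; lia.
    have : arrle (f x) (f (W b)).
      by apply: f_mono; rewrite ?coilseq_in ?coilseq_cl // /arrle xb orbT.
    have Eyx : cl y = nxt (cl x) by rewrite Ey Eb -Eb'.
    move=> le1; apply: f_le_arr => //; rewrite Eb in gy; apply: arrle_trans le1 gy _.
    by apply: adj_cl_refl; rewrite f_cl.
  have Eyx : cl y = nxt (cl x).
    by rewrite Ey Eb Ex; apply/(cellseq_mod 0 (lay x).+1).
  have Ey0 : cl y = cl w0 by rewrite Ey Eb.
  have yw : y = w0 by apply: arrle_anti; [exact: w0_le | rewrite Eb in gy].
  apply: f_le_arr => //; rewrite yw; apply: w0_le; first exact: f_in.
  by rewrite f_cl // -Eyx.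
have xb : arr x (W (lay y).+1).
  by apply: lay_min => //; rewrite Ex; apply/cellseq_mod.
have Exy : cl x = nxt (cl y).
  by rewrite Ex Ey; apply/(cellseq_mod (lay x) (lay y).+1).
apply: f_nle_arr => //; apply/negP => fyx.
have yb : arrle (W (lay y).+1) (f y).
  by apply: f_mono; rewrite ?coilseq_in // coilseq_cl.
have c1 : cl x = cl (W (lay y).+1) by rewrite Exy Ey coilseq_cl.
have : arr x (f y) by apply: (arr_arrle xb yb); rewrite f_cl // Exy cadj_refl.
by move=> H; have := arr_irr x L; rewrite (arr_arrle H fyx) // cadj_refl.
Qed.

(** From index [i.+1] on, [x'] relates to the coil as [W i] does, so it can be the second copy of
    [W i] in a coil that starts there. *)
Definition twin_of_coil (x' : T) (i : nat) : Prop :=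
  [/\ lay x' <= i + l, x' \in S, x' <> W (lay x') & cl x' = e i] /\
  (i.+1 < R -> arr x' (W i.+1)) /\
  (forall k, i.+1 < k -> k < R -> cadj (cl (W k)) (cl x') -> arr (W k) x').

Lemma twin_same x : x \in S -> x <> W (lay x) -> f x = W (lay x).+1 -> twin_of_coil x (lay x).
Proof.
move=> xS ex Ef; split; first by split; rewrite ?leq_addr ?lay_cl.
split=> [_|k ik kR aj]; first by rewrite -Ef; apply: f_arr.
by apply: layer_far; rewrite ?coilseq_in ?layer_coil.
Qed.

Lemma arr_min x : x \in S -> x <> W (lay x) -> arr (W (lay x)) x.
Proof. by move=> xS /eqP; have := lay_ge xS; rewrite /arrle eq_sym => /orP[->|]. Qed.

Lemma f_above x : x \in S -> arrle (W (lay x).+1) (f x).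
Proof.
by move=> xS; apply: f_mono; rewrite ?coilseq_in ?lay_ge // coilseq_cl lay_cl.
Qed.

(** In its cell [x] lies between [W (i + l)] and [W i], where [i + l] is its layer. As [f x] is not
    the coil point after [W (i + l)], that coil point precedes [x], so [x] behaves like [W i] and
    not like [W (i + l)]. *)
Lemma twin_previous x : x \in S -> x <> W (lay x) -> f x <> W (lay x).+1 -> l <= lay x ->
  twin_of_coil x (lay x - l).
Proof.
move=> xS ex Ef li; set i := lay x - l; have Ei : lay x = i + l by rewrite /i subnK.
have cx : cl x = e i by rewrite lay_cl // Ei cellseq_per.
split; first by split=> //; rewrite Ei.
have xi : arr x (W i) by apply: lay_min => //; rewrite Ei -{1}(addn0 i) ltn_add2l; lia.
split=> [_|k ik kR aj].
  apply: f_le_arr; rewrite ?coilseq_cl ?cx //.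
  by apply: f_mono; rewrite ?coilseq_in ?coilseq_cl // /arrle xi orbT.
case: (leqP (lay x).+2 k) => far; first by apply: layer_far; rewrite ?coilseq_in ?layer_coil.
move: (aj); rewrite coilseq_cl lay_cl // => /cellseq_adjP[E0|E0|E0].
- have -> : k = lay x by apply: (eqmod_eq E0); lia.
  exact: arr_min.
- have H : lay x = k.+1 by apply: (eqmod_eq E0); lia.
  exact: layer_next.
have -> : k = (lay x).+1 by apply: (eqmod_eq E0); lia.
apply: f_nle_arr; rewrite ?coilseq_in ?coilseq_cl ?lay_cl //; apply/negP => le.
by apply: Ef; apply: arrle_anti le (f_above xS).
Qed.

(* This is where the root is required to have an orbit of maximal size. *)
Lemma f_not_root x : x \in S -> x <> W (lay x) -> (lay x).+1 = l -> f x <> w0.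
Proof.
move=> xS ex El fx; have [y ytop [Ey xy]] := topmost_ex L xS.
have [yS _] := topmostP cl arr S _ ytop.
have xyle : arrle x y by case: xy => [->|xy]; rewrite /arrle ?eqxx ?xy ?orbT.
have fy : f y = w0.
  apply: arrle_anti; last by rewrite -{1}fx; apply: f_mono.
  by apply: w0_le; rewrite ?f_in // f_cl // Ey -f_cl // fx.
have ny : ~~ fconnect f w0 y.
  apply/negP => /iter_findex; set k := findex f w0 y => Wk.
  have Em : k = lay x %[mod l] by apply/cellseq_mod; rewrite -lay_cl // -Ey -Wk coilseq_cl.
  have le : lay x <= k.
    case: (leqP (lay x) k) => // lt.
    by have [[|q]] := eqmod_addP (ltnW lt) Em; rewrite ?mulSn; lia.
  have yW : arrle y (W (lay x)) by rewrite -Wk; apply: coilseq_le.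
  apply: ex; apply: arrle_anti; last exact: lay_ge.
  by apply: arrle_trans xyle yW _; apply: adj_cl_refl; rewrite coilseq_cl lay_cl.
(* Since [f y = w0], the orbit of [y] contains that of [w0], and it also contains [y]. *)
have := w0_max ytop; rewrite leqNgt => /negP; apply.
apply: proper_card; apply/properP; split; last by exists y; rewrite ?inE ?connect0.
apply/subsetP => z; rewrite !inE => c; apply: connect_trans c.
by rewrite -fy fconnect1.
Qed.

(** During the first turn no coil point lies a turn earlier, so [x] is pushed along [f] until it
    either merges with the coil or reaches layer [l]. The number [d] of remaining layers decreases,
    because [f_not_root] forbids a return to layer [0]. *)
Lemma twin_small d x : x \in S -> x <> W (lay x) -> lay x + d = l ->
  exists i x', i <= l /\ twin_of_coil x' i.
Proof.
elim: d x => [|d IH] x xS ex El.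
  case: (eqVneq (f x) (W (lay x).+1)) => [Ef|/eqP Ef].
    by exists (lay x), x; split; [lia | apply: twin_same].
  by exists (lay x - l), x; split; [lia | apply: twin_previous => //; lia].
case: (eqVneq (f x) (W (lay x).+1)) => [Ef|/eqP Ef].
  by exists (lay x), x; split; [lia | apply: twin_same].
have fS := f_in xS; have cf : cl (f x) = e (lay x).+1 by rewrite f_cl // lay_cl.
have le : lay (f x) <= (lay x).+1 by apply: layer_le; rewrite ?f_above.
have Em : lay (f x) = (lay x).+1 %[mod l] by apply/cellseq_mod; rewrite -lay_cl.
have [q Eq] := eqmod_addP le Em.
have Elay : lay (f x) = (lay x).+1.
  case: q Eq => [|q]; rewrite ?mulSn => Eq; first by lia.
  have fx0 : lay (f x) = 0 by lia.
  have El1 : (lay x).+1 = l by lia.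
  case: (f_not_root xS ex El1); apply: arrle_anti.
    by apply: w0_le; rewrite // lay_cl // fx0.
  by have := lay_ge fS; rewrite fx0.
by apply: (IH (f x)) => //; rewrite Elay; [exact: Ef | lia].
Qed.

Lemma coil_structureP : coil_structure cl arr S e W R lay.
Proof.
split=> //.
- exact: cellseq_nz.
- exact: cellseq_mod.
- by move=> c nzcc; exists (findex nxt (cl w0) c); apply: iter_findex; apply: nxt_conn.
- exact: cellseq_adjP.
- by move=> k _; apply: coilseq_in.
- exact: layer_coil.
- exact: arr_min.
- exact: layer_far.
- exact: layer_next.
move=> x xS ex; have twin i x' : i <= lay x + l -> twin_of_coil x' i -> exists i x',
    [/\ i <= lay x + l, lay x' <= i + l, x' \in S, x' <> W (lay x') & cl x' = e i] /\
    (i.+1 < R -> arr x' (W i.+1)) /\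
    (forall k, i.+1 < k -> k < R -> cadj (cl (W k)) (cl x') -> arr (W k) x').
  by move=> le [[H1 H2 H3 H4] H5]; exists i, x'.
case: (leqP l (lay x)) => li.
  case: (eqVneq (f x) (W (lay x).+1)) => [Ef|/eqP Ef].
    by apply: twin (twin_same xS ex Ef); apply: leq_addr.
  by apply: twin (twin_previous xS ex Ef li); lia.
have [|i [x' [il H]]] := @twin_small (l - lay x) x xS ex; first by lia.
by apply: twin H; lia.
Qed.

End Layers.

End Orbit.

End CoilStructure.

Lemma coil_structure_ex (m n : nat) (M : 'M[int]_(m, n)) (T : finType)
    (cl : T -> 'I_m * 'I_n) (arr : rel T) (S : {set T}) :
  rc_is_cycle M -> line_structure (@cadj m n) cl arr -> (forall x, nzc M (cl x)) ->
  indecomposable arr S -> 1 < #|S| ->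
  exists e W R lay, coil_structure M cl arr S e W R lay.
Proof.
move=> Hcyc L nzT indS S1.
have [nxt [n1 n2 n3 n4 n5]] := next_cell Hcyc L nzT indS S1.
have [f Hf] := first_out L n5.
have [x0 x0S] : exists x, x \in S by apply/card_gt0P; apply: ltnW.
have [z ztop _] := topmost_ex L x0S.
case: (arg_maxnP (order f) ztop) => w0 w0top w0max.
have f_in x : x \in S -> f x \in S by case/Hf.
have f_cl x : x \in S -> cl (f x) = nxt (cl x) by case/Hf.
have f_arr x : x \in S -> arr x (f x) by case/Hf.
have f_min x y : x \in S -> y \in S -> cl y = nxt (cl x) -> arr x y -> arrle arr (f x) y.
  by case/Hf => _ _ _; apply.
have [lay Hlay] := layer_ex Hcyc L nzT indS n1 n2 n3 n4 f_in f_cl f_arr f_min w0top.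
have lay_lt x : x \in S -> lay x < order f w0 by case/Hlay.
have lay_cl x : x \in S -> cl x = cellseq cl nxt w0 (lay x) by case/Hlay.
have lay_ge x : x \in S -> arrle arr (coilseq f w0 (lay x)) x by case/Hlay.
have lay_min x k : x \in S -> k < lay x -> cellseq cl nxt w0 k = cl x -> arr x (coilseq f w0 k).
  by case/Hlay => _ _ _; apply.
exists (cellseq cl nxt w0), (coilseq f w0), (order f w0), lay.
exact: coil_structureP.
Qed.

Lemma sorted_count_lt (ps : seq nat) y i : sorted ltn ps -> i < size ps ->
  (i < count (fun x => x < y) ps) = (nth 0 ps i < y).
Proof.
elim: ps i => // a ps IH i sp.
have al : all (ltn a) ps by move: sp; rewrite /= (path_sortedE ltn_trans) => /andP[].
have sp' := path_sorted sp.
case: (ltnP a y) => ay /=; rewrite ?ay ?add1n.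
  by case: i => [|i] //= li; rewrite ltnS IH.
move=> li; rewrite (ltnNge a) ay add0n; have -> : count (fun x => x < y) ps = 0.
  apply/eqP; rewrite -leqn0 leqNgt -has_count; apply/negP => /hasP[x xp xy].
  by have /= := allP al x xp; lia.
case: i li => [|i] /= li; first by rewrite ltn0 (ltnNge a) ay.
have /= := allP al _ (mem_nth 0 (li : i < size ps)); lia.
Qed.

(** * Extracting an end-inflated coil as a pattern *)

Section Realization.
Variables (m n : nat) (M : 'M[int]_(m, n)) (c : 'I_m -> int) (r : 'I_n -> int).
Hypotheses (HM : gridding_matrix M) (Hpm : partial_mult M c r) (Hcyc : rc_is_cycle M).
Notation E := ('I_m * 'I_n)%type.
Notation l := (ncells M).
Variables (p : seq nat) (v h : nat -> nat).
Hypotheses (Hp : is_perm p) (Hg : is_gridding M p v h).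
Notation line := (line m n p v h).
Notation ltl := (ltl c r p v h).

Definition arrb (x y : nat) : bool :=
  (line true x == line true y) && ltl true x y || (line false x == line false y) && ltl false x y.

Lemma arrbE b x y : x < size p -> y < size p -> line b x = line b y -> arrb x y = ltl b x y.
Proof.
move=> lx ly E; rewrite /arrb.
have H b' : line (~~ b') x = line (~~ b') y -> line b' x = line b' y -> ltl (~~ b') x y = ltl b' x y.
  by case: b' => E1 E2; rewrite -?(ltl_cell Hp Hg Hpm lx ly) ?(ltl_cell Hp Hg Hpm lx ly) //; case.
case: b E => E; rewrite E eqxx /=.
  case: eqP => /= E'; last by rewrite orbF.
  by rewrite (H true) ?orbb.
case: eqP => //= E'.
by rewrite (H false) ?orbb.
Qed.

Lemma arrbP x y : x < size p -> y < size p -> arrow c r p v h x y <-> arrb x y.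
Proof.
move=> lx ly; split=> [/(arrowP c r Hp Hg lx ly)[b [E lt]]|]; first by rewrite (arrbE lx ly E).
move=> H; apply/(arrowP c r Hp Hg lx ly).
by case/orP: H => /andP[/eqP E lt]; [exists true | exists false].
Qed.

Lemma arrb_line x y : arrb x y -> exists b, line b x = line b y.
Proof. by case/orP => /andP[/eqP H _]; [exists true | exists false]. Qed.

Lemma raw_lines b x y : x < size p -> y < size p -> line b x <> line b y ->
  (raw p b x < raw p b y) = (line b x < line b y).
Proof.
move=> lx ly ne; apply/idP/idP => H.
  by have := line_mono Hp Hg lx ly (ltnW H); lia.
rewrite ltnNge; apply/negP => /(line_mono Hp Hg ly lx); lia.
Qed.

Lemma raw_same_line b x y : x < size p -> y < size p -> x <> y -> line b x = line b y ->
  (raw p b x < raw p b y) = (orient c r b (line b x) == arrb x y).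
Proof.
move=> lx ly ne E; have nr : raw p b x <> raw p b y by move/(raw_inj Hp lx ly).
by rewrite (arrbE lx ly E) /ltl; case: (orient _ _ _ _); case: ltngtP nr.
Qed.

(** Within a line the arrows decide the order of coordinates, and between lines the line numbers
    do. *)
Lemma raw_twin b x x' y : x < size p -> x' < size p -> y < size p -> x <> y -> x' <> y ->
  line b x = line b x' -> (line b x' = line b y -> arrb x y = arrb x' y) ->
  (raw p b x < raw p b y) = (raw p b x' < raw p b y).
Proof.
move=> lx lx' ly ne ne' E H; case: (eqVneq (line b x') (line b y)) => [E'|/eqP nE].
  by rewrite !raw_same_line ?E // H.
by rewrite !raw_lines ?E.
Qed.

Lemma cell_direction x y i j : x < size p -> y < size p -> x <> y ->
  line true x = nat_of_ord i -> line false x = nat_of_ord j ->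
  line true y = nat_of_ord i -> line false y = nat_of_ord j ->
  ((x < y) == (nth 0 p x < nth 0 p y)) = (M i j == 1%R).
Proof.
move=> lx ly ne xi xj yi yj.
have [_ [_ [_ [_ [_ [_ H]]]]]] := Hg.
have cx : in_cell p v h x i j by rewrite (in_cellE Hp Hg) // xi xj !eqxx.
have cy : in_cell p v h y i j by rewrite (in_cellE Hp Hg) // yi yj !eqxx.
have [nz inc dec] := H i j x y lx ly cx cy.
have [_ inc' dec'] := H i j y x ly lx cy cx.
have nn : nth 0 p x <> nth 0 p y by move/(is_perm_nth_inj Hp lx ly).
case: (HM i j) => [M0|[M1|M1]]; first by rewrite M0 eqxx in nz.
  rewrite M1 eqxx; have {}inc := inc M1; have {}inc' := inc' M1.
  by case: (ltngtP x y) ne => // xy _; [rewrite inc | have := inc' xy; case: ltngtP].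
rewrite M1 /=; have {}dec := dec M1; have {}dec' := dec' M1.
by case: (ltngtP x y) ne => // xy _; [have := dec xy; case: ltngtP | rewrite dec'].
Qed.

Variables (N : nat) (q : nat -> nat) (e : nat -> E).
Hypotheses (q_lt : forall t, t < N -> q t < size p)
  (q_inj : forall t t', t < N -> t' < N -> q t = q t' -> t = t') (lN : l < N)
  (e_mod : forall i j, e i = e j <-> i = j %[mod l])
  (e_nz : forall i, nzc M (e i))
  (e_surj : forall d, nzc M d -> exists k, e k = d)
  (q_col : forall t, t < N -> line true (q t) = (e t).1)
  (q_row : forall t, t < N -> line false (q t) = (e t).2)
  (q_next : forall t, t.+1 < N -> arrb (q t) (q t.+1))
  (q_back : forall t, t + l.+1 < N -> arrb (q (t + l.+1)) (q t))
  (q_close : arrb (q l) (q 0)).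

Let qs : seq nat := map q (iota 0 N).
Let ps : seq nat := sort leq qs.

Lemma ps_sorted : sorted ltn ps.
Proof.
have uq : uniq qs.
  rewrite map_inj_in_uniq ?iota_uniq // => x y; rewrite !mem_iota /= => lx ly; exact: q_inj.
by rewrite ltn_sorted_uniq_leq sort_uniq uq sort_sorted //; apply: leq_total.
Qed.

Lemma size_ps : size ps = N.
Proof. by rewrite size_sort size_map size_iota. Qed.

Lemma mem_ps x : x \in ps -> exists2 t, t < N & x = q t.
Proof. by rewrite mem_sort => /mapP[t]; rewrite mem_iota => /= lt ->; exists t. Qed.

Lemma q_ps t : t < N -> q t \in ps.
Proof. by move=> lt; rewrite mem_sort map_f // mem_iota. Qed.

Lemma ps_lt i : i < N -> nth 0 ps i < size p.
Proof.
move=> li; have : nth 0 ps i \in ps by rewrite mem_nth // size_ps.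
by case/mem_ps => t lt ->; apply: q_lt.
Qed.

(** Standardization: values and grid lines are replaced by the number of selected points below them,
    which preserves every comparison with a selected point. *)
Let cnt (b : bool) (y : nat) : nat := count (fun x => raw p b x < y) ps.

Lemma cnt_lt b x y : x \in ps -> (cnt b (raw p b x) < cnt b y) = (raw p b x < y).
Proof.
move=> xp; apply/idP/idP => [|xy].
  rewrite !ltnNge; apply: contra => yx; apply: sub_count => z /= zy.
  exact: leq_trans zy yx.
(* Strictness comes from [x] itself, which is counted below [y] but not below its own coordinate. *)
have sub z : (raw p b z < raw p b x) || (z == x) -> raw p b z < y.
  by case/orP => [H|/eqP->//]; apply: ltn_trans H xy.
apply: leq_trans (sub_count (a1 := fun z => (raw p b z < raw p b x) || (z == x)) sub ps).
have disj : count (fun z => (raw p b z < raw p b x) && (z == x)) ps = 0.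
  rewrite -(count_pred0 ps); apply: eq_count => z /=.
  by case: eqP => [->|_]; rewrite ?ltnn ?andbF.
have := count_predUI (fun z => raw p b z < raw p b x) (pred1 x) ps.
rewrite /cnt => H.
have -> : count (fun z => (raw p b z < raw p b x) || (z == x)) ps =
  count (predU (fun z => raw p b z < raw p b x) (pred1 x)) ps by apply: eq_count.
have H1 : count (predI (fun z => raw p b z < raw p b x) (pred1 x)) ps = 0.
  by rewrite -[RHS]disj; apply: eq_count.
rewrite H1 addn0 in H; rewrite H -[X in X < _]addn0 ltn_add2l.
by rewrite -has_count has_pred1.
Qed.

Lemma cnt_size b : cnt b (size p) = N.
Proof.
rewrite /cnt -size_ps -(count_predT ps); apply: eq_in_count => x /mem_ps[t lt ->] /=.
by rewrite /raw; case: b; rewrite ?is_perm_nth_lt ?q_lt.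
Qed.

Let s0 : seq nat := map (fun x => cnt false (nth 0 p x)) ps.

Lemma size_s0 : size s0 = N.
Proof. by rewrite size_map size_ps. Qed.

Lemma nth_s0_lt i y : i < N -> (nth 0 s0 i < cnt false y) = (nth 0 p (nth 0 ps i) < y).
Proof.
move=> li; rewrite (nth_map 0) ?size_ps //.
by rewrite (cnt_lt false) // mem_nth // size_ps.
Qed.

Lemma index_lt i y : i < N -> (i < cnt true y) = (nth 0 ps i < y).
Proof. by move=> li; rewrite /cnt /= sorted_count_lt ?size_ps ?ps_sorted. Qed.

Lemma s0_embeds : embeds (nth 0 ps) s0 p.
Proof.
split; rewrite size_s0; first exact: ps_lt.
move=> x y lx ly; split; last first.
  by rewrite [X in _ < X](nth_map 0) ?size_ps // nth_s0_lt.
apply/idP/idP => H; first by apply: (sorted_ltn_nth ltn_trans); rewrite ?ps_sorted ?inE ?size_ps.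
rewrite ltnNge; apply/negP => yx.
have : nth 0 ps y <= nth 0 ps x.
  apply: (sorted_leq_nth leq_trans leqnn); rewrite ?inE ?size_ps //.
  by apply: sub_sorted ps_sorted => ? ? /ltnW.
by rewrite leqNgt H.
Qed.

Lemma s0_perm : is_perm s0.
Proof.
apply/is_permP; split.
  apply/(uniqP 0) => x y; rewrite !inE size_s0 => lx ly H.
  have [_ cmp] := s0_embeds; rewrite size_s0 in cmp.
  have [a1 b1] := cmp x y lx ly; have [a2 b2] := cmp y x ly lx.
  rewrite H ltnn in b1; rewrite H ltnn in b2.
  have E : nth 0 ps x = nth 0 ps y by apply: (is_perm_nth_inj Hp); rewrite ?ps_lt //; lia.
  by rewrite E ltnn in a1; rewrite E ltnn in a2; lia.
move=> z /(nthP 0)[i]; rewrite size_s0 => li <-.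
rewrite (nth_map 0) ?size_ps // -[X in _ < X](cnt_size false).
rewrite (cnt_lt false) ?mem_nth ?size_ps //.
exact: is_perm_nth_lt (ps_lt li).
Qed.

Let v0 (k : nat) : nat := cnt true (v k).
Let h0 (k : nat) : nat := cnt false (h k).

Lemma s0_col (i : 'I_m) x : x < N -> in_col v0 i x = in_col v i (nth 0 ps x).
Proof. by move=> lx; rewrite /in_col /v0 [cnt true (v i) <= x]leqNgt !index_lt // -leqNgt. Qed.

Lemma s0_row (j : 'I_n) x : x < N -> in_row s0 h0 j x = in_row p h j (nth 0 ps x).
Proof. by move=> lx; rewrite /in_row /h0 [cnt false (h j) <= _]leqNgt !nth_s0_lt // -leqNgt. Qed.

Lemma s0_cell (i : 'I_m) (j : 'I_n) x : x < N ->
  in_cell s0 v0 h0 x i j = in_cell p v h (nth 0 ps x) i j.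
Proof. by move=> lx; rewrite /in_cell s0_col // s0_row. Qed.

Lemma s0_gridding : is_gridding M s0 v0 h0.
Proof.
have [v00 [vm [h00 [hn [vmo [hmo H]]]]]] := Hg; have [_ cmp] := s0_embeds.
rewrite size_s0 in cmp; rewrite /is_gridding size_s0.
have c0 b : cnt b 0 = 0.
  by apply/eqP; rewrite -leqn0 leqNgt -has_count; apply/negP => /hasP[x _]; rewrite ltn0.
have cm b y y' : y <= y' -> cnt b y <= cnt b y'.
  by move=> yy; apply: sub_count => x /= xy; apply: leq_trans xy yy.
rewrite /v0 /h0 v00 h00 vm hn !c0 !cnt_size; do 4 split=> //.
split; first by move=> i im; apply/cm/vmo.
split; first by move=> j jn; apply/cm/hmo.
move=> i j x x' lx lx'; rewrite !s0_cell // => cx cx'.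
have [nz inc dec] := H i j _ _ (ps_lt lx) (ps_lt lx') cx cx'.
have [E1 E2] := cmp x x' lx lx'.
have [_ E3] := cmp x' x lx' lx.
by rewrite E2 E3 E1.
Qed.

Let pt (k : nat) : nat := index (q k) ps.

Lemma pt_lt k : k < N -> pt k < N.
Proof. by move=> lk; rewrite -[X in _ < X]size_ps index_mem q_ps. Qed.

Lemma nth_pt k : k < N -> nth 0 ps (pt k) = q k.
Proof. by move=> lk; rewrite nth_index // q_ps. Qed.

Lemma s0_arrow x y : x < N -> y < N -> arrb (nth 0 ps x) (nth 0 ps y) -> arrow c r s0 v0 h0 x y.
Proof.
move=> lx ly /(arrbP (ps_lt lx) (ps_lt ly)).
have [_ cmp] := s0_embeds; rewrite size_s0 in cmp.
have [E1 E2] := cmp x y lx ly; have [E3 E4] := cmp y x ly lx.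
case=> [[i [cx cy lt]]|[j [cx cy lt]]]; [left; exists i | right; exists j].
  by rewrite !s0_col // E1 E3.
by rewrite !s0_row // E2 E4.
Qed.

Let lab (d : E) : nat := find (fun t => e t == d) (iota 0 l).

Lemma lab_spec d : nzc M d -> lab d < l /\ e (lab d) = d.
Proof.
move=> nzd; have [k Ek] := e_surj nzd.
have l0 : 0 < l by apply: leq_trans (ncells_gt3 Hcyc).
have hs : has (fun t => e t == d) (iota 0 l).
  apply/hasP; exists (k %% l); first by rewrite mem_iota ltn_mod.
  by rewrite -Ek; apply/eqP/e_mod; rewrite modn_mod.
have lt : lab d < l by move: hs; rewrite has_find size_iota.
by split=> //; have := nth_find 0 hs; rewrite -/(lab d) nth_iota // => /eqP.
Qed.

Lemma in_cell_q t i j : t < N -> in_cell p v h (q t) i j -> (i, j) = e t.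
Proof.
move=> lt; rewrite (in_cellE Hp Hg) ?q_lt // q_col // q_row // => /andP[/eqP/val_inj <- /eqP/val_inj <-].
by case: (e t).
Qed.

Lemma s0_coil : gridded_coil M c r s0 v0 h0 (map pt (iota 0 N)) lab.
Proof.
have npt k : k < N -> nth 0 (map pt (iota 0 N)) k = pt k.
  by move=> lk; rewrite (nth_map 0) ?size_iota // nth_iota.
have l0 : 0 < l by apply: leq_trans (ncells_gt3 Hcyc).
rewrite /gridded_coil size_s0; split; first exact: s0_perm.
split; first exact: s0_gridding.
split; first by [].
split.
  have ups : uniq ps by have := ps_sorted; rewrite ltn_sorted_uniq_leq => /andP[].
  have u : uniq (map pt (iota 0 N)).
    rewrite map_inj_in_uniq ?iota_uniq // => x y; rewrite !mem_iota /= => lx ly E.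
    by apply: q_inj => //; rewrite -(nth_pt lx) E nth_pt.
  apply: uniq_perm (iota_uniq _ _) _ => //.
  have sub : {subset map pt (iota 0 N) <= iota 0 N}.
    by move=> x /mapP[k]; rewrite !mem_iota /= => lk ->; apply: pt_lt.
  by have [|_] := uniq_min_size u sub; rewrite ?size_map ?size_iota.
split.
  move=> d d' nzd nzd' E; have [_ <-] := lab_spec nzd; have [_ <-] := lab_spec nzd'.
  by rewrite E.
split; first by move=> i j nz; have [] := @lab_spec (i, j) nz.
split.
  move=> k i j lk; rewrite npt // s0_cell ?pt_lt // nth_pt // => /(in_cell_q lk) ->.
  have [lt Ek] := lab_spec (e_nz k).
  have /e_mod := Ek; by rewrite modn_small.
split.
  move=> k /andP[k0 lk]; have lk' : k.-1 < N by lia.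
  rewrite !npt //; apply: s0_arrow; rewrite ?pt_lt // !nth_pt //.
  by have := @q_next k.-1; rewrite prednK //; apply.
split.
  move=> k /andP[k0 lk]; have lk' : k - l.+1 < N by lia.
  rewrite !npt //; apply: s0_arrow; rewrite ?pt_lt // !nth_pt //.
  by have := @q_back (k - l.+1); rewrite subnK //; apply.
have l0N : 0 < N by lia.
by rewrite !npt //; apply: s0_arrow; rewrite ?pt_lt // !nth_pt.
Qed.

Variables zP zQ : nat.
Hypotheses (zP_lt : zP < size p) (zQ_lt : zQ < size p) (zPQ : zP <> zQ)
  (zP_new : forall t, t < N -> zP <> q t) (zQ_new : forall t, t < N -> zQ <> q t)
  (zP_line : forall b, line b zP = line b (q 0))
  (zQ_line : forall b, line b zQ = line b (q N.-1))
  (zP_arr : forall t b, 0 < t < N -> line b (q 0) = line b (q t) -> arrb zP (q t) = arrb (q 0) (q t))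
  (zQ_arr : forall t b, t < N.-1 -> line b (q N.-1) = line b (q t) ->
     arrb zQ (q t) = arrb (q N.-1) (q t))
  (zPQ_arr : forall b, line b (q 0) = line b (q N.-1) -> arrb zP zQ = arrb (q 0) zQ).

Lemma s0_twin t z : t < N -> z < size p -> (forall t', t' < N -> z <> q t') ->
  (forall b, line b z = line b (q t)) ->
  (forall t' b, t' < N -> t' <> t -> line b (q t) = line b (q t') -> arrb z (q t') = arrb (q t) (q t')) ->
  twin (nth 0 ps) s0 p (pt t) z ((z < q t) == (nth 0 p z < nth 0 p (q t))).
Proof.
move=> lt lz znew zl za.
have ex x : x < N -> exists2 t', t' < N & nth 0 ps x = q t'.
  by move=> lx; apply: mem_ps; rewrite mem_nth // size_ps.
split; rewrite ?nth_pt // size_s0.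
  by move=> x /ex[t' lt' ->]; apply: znew.
move=> x lx ne; have [t' lt' Ex] := ex x lx; rewrite Ex.
have tt' : t' <> t.
  move=> E; apply: ne; rewrite /pt -E -Ex index_uniq ?size_ps //.
  by have := ps_sorted; rewrite ltn_sorted_uniq_leq => /andP[].
have key b : (raw p b z < raw p b (q t')) = (raw p b (q t) < raw p b (q t')).
  apply: raw_twin; rewrite ?q_lt //; first exact: znew.
    by move/(q_inj lt lt')/esym.
  by move=> H; apply: za H.
by split; [exact: (key true) | exact: (key false)].
Qed.

(** The selected points form a coil and [zP], [zQ] double its ends. The two new points must also
    compare with each other as the ends do, which [keyPQ] obtains by replacing first [zP] by [q 0]
    and then [zQ] by [q N.-1]. *)
Lemma inflated_coil_contained : exists a,
  [/\ end_inflated_coil M c r a, contains p a, is_perm a & size a = N.+2].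
Proof.
have l0N : 0 < N by lia.
have l1N : N.-1 < N by lia.
have neN : N.-1 <> 0 by have := ncells_gt3 Hcyc; lia.
set b1 := (zP < q 0) == (nth 0 p zP < nth 0 p (q 0)).
set bN := (zQ < q N.-1) == (nth 0 p zQ < nth 0 p (q N.-1)).
have npt k : k < N -> nth 0 (map pt (iota 0 N)) k = pt k.
  by move=> lk; rewrite (nth_map 0) ?size_iota // nth_iota.
have nePQ : pt 0 <> pt N.-1.
  by move=> E; apply: neN; apply: q_inj => //; rewrite -(nth_pt l1N) -E nth_pt.
have t1 : twin (nth 0 ps) s0 p (pt 0) zP b1.
  apply: s0_twin => // t' b lt' ne; apply: zP_arr; lia.
have t2 : twin (nth 0 ps) s0 p (pt N.-1) zQ bN.
  by apply: s0_twin => // t' b lt' ne; apply: zQ_arr; lia.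
have dir z t i j : t < N -> z < size p -> z <> q t -> (forall b, line b z = line b (q t)) ->
    in_cell s0 v0 h0 (pt t) i j ->
    ((z < q t) == (nth 0 p z < nth 0 p (q t))) = (M i j == 1%R).
  move=> lt lz ne zl; rewrite s0_cell ?pt_lt // nth_pt // (in_cellE Hp Hg) ?q_lt //.
  by move=> /andP[/eqP E1 /eqP E2]; apply: cell_direction; rewrite ?zl ?q_lt.
exists (inflate2 s0 (pt 0) b1 (pt N.-1) bN); split.
- exists s0, v0, h0, (map pt (iota 0 N)), lab, b1, bN; rewrite size_s0 !npt //; split=> //.
  + exact: s0_coil.
  + by move=> i j; apply: dir => //; apply: zP_new.
  by move=> i j; apply: dir => //; apply: zQ_new.
- have keyPQ b : (raw p b zP < raw p b zQ) = (raw p b (q 0) < raw p b (q N.-1)).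
    have q0l := q_lt l0N; have q1l := q_lt l1N.
    have ne01 : q 0 <> q N.-1 by move/(q_inj l0N l1N)/esym.
    have E1 : (raw p b zP < raw p b zQ) = (raw p b (q 0) < raw p b zQ).
      apply: raw_twin => //; first exact/nesym/zQ_new.
      by rewrite zQ_line => H; apply: zPQ_arr H.
    have E2 : (raw p b zQ < raw p b (q 0)) = (raw p b (q N.-1) < raw p b (q 0)).
      apply: raw_twin => //; first exact: zQ_new.
        exact: nesym.
      by move=> H; apply: zQ_arr H; lia.
    have n1 : raw p b zQ <> raw p b (q 0) by move/(raw_inj Hp zQ_lt q0l); apply: zQ_new.
    have n2 : raw p b (q N.-1) <> raw p b (q 0) by move/(raw_inj Hp q1l q0l)/esym.
    rewrite E1; lia.
  apply: (contains_inflate2 s0_perm Hp _ _ nePQ s0_embeds t1 t2 zPQ);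
    rewrite ?size_s0 ?pt_lt ?nth_pt //.
    exact: (keyPQ true).
  exact: (keyPQ false).
- rewrite /inflate2; case: ifP => _; apply: is_perm_inflate;
    rewrite ?size_inflate ?size_s0 ?pt_lt //; try exact/ltnW/pt_lt;
    by apply: is_perm_inflate; rewrite ?s0_perm ?size_s0 ?pt_lt.
rewrite /inflate2; case: ifP => _; rewrite !size_inflate ?size_s0 ?pt_lt //; exact/ltnW/pt_lt.
Qed.

End Realization.

(** * Codes of strongly connected pieces *)

Section Codes.
Variables (m n : nat) (M : 'M[int]_(m, n)).
Hypothesis Hcyc : rc_is_cycle M.
Notation E := ('I_m * 'I_n)%type.
Notation l := (ncells M).
Notation cadj := (@cadj m n).
Variable D : nat.

(** The option holds the cell of a singleton piece. For a larger piece, the function lists the [l]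
    cells from the start of the window on, the two numbers count the layers before that start and
    from it on, and the word has one letter for each of the [D.+2] layers of the window. *)
Definition code : Type := (option E * {ffun 'I_l -> E}) * (nat * nat) * seq 'I_D.+2.

Definition code_le : code -> code -> Prop :=
  prodR (prodR eq (prodR (fun i j : nat => i <= j) (fun i j : nat => i <= j))) (semb eq).

Lemma code_le_wqo : wqor code_le.
Proof.
have tle : transp (fun i j : nat => i <= j) by move=> y x z; apply: leq_trans.
apply: wqor_prod.
- apply: wqor_prod; [exact: wqor_fin | by move=> y x z -> | ].
  by apply: wqor_prod => //; apply: wqor_leq.
- by apply: transp_prod; [move=> y x z -> | apply: transp_prod].
by apply: higman; [exact: wqor_fin | move=> y x z ->].
Qed.

Lemma code_le_trans : transp code_le.
Proof.
have tle : transp (fun i j : nat => i <= j) by move=> y x z; apply: leq_trans.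
have tsemb (A : Type) (R : A -> A -> Prop) : transp R -> transp (semb R).
  move=> tR y x z xy yz; elim: yz x xy => {y z}.
  - by move=> t x H; move Ey: [::] H => y H; case: H Ey => // *; constructor.
  - by move=> b y z _ IH x /IH H; constructor.
  move=> b b' y z Rb _ IH x H; move Ey: (b :: y) H => y' H; case: H Ey => //.
  + by move=> *; constructor.
  + by move=> b0 x0 y0 H0 [_ E]; constructor; apply: IH; rewrite E.
  move=> a b0 x0 y0 R0 H0 [E0 E]; constructor; first by apply: tR Rb; rewrite E0.
  by apply: IH; rewrite E.
apply: transp_prod; last by apply: tsemb => y x z ->.
by apply: transp_prod; [move=> y x z -> | apply: transp_prod].
Qed.

Section Structure.
Variables (T : finType) (cl : T -> E) (arr : rel T) (S : {set T}).

(* The coil is reproducible from its length and its cells, so only the position, the cells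
   and the contents of a window of layers containing all the other points are recorded. *)
Definition coil_coded (k : code) : Prop :=
  exists e W R lay i xs,
    [/\ coil_structure M cl arr S e W R lay, i < R,
        forall x, x \in S -> x <> W (lay x) -> i <= lay x <= i + D,
        [/\ uniq xs, forall x, x \in xs = (x \in S) && (i <= lay x <= i + D.+1) &
            pairwise (fun x y => ~~ (near lay y x && arr y x)) xs] &
        k = ((None, [ffun j : 'I_l => e (i + j)]), (i, R - i),
             [seq inord (lay x - i) | x <- xs])].

Definition has_code (k : code) : Prop :=
  (exists x, S = [set x] /\ k.1.1.1 = Some (cl x)) \/ coil_coded k.

Hypothesis L : line_structure cadj cl arr.

Lemma near_adj e W R lay x y : coil_structure M cl arr S e W R lay ->
  x \in S -> y \in S -> near lay x y -> cadj (cl x) (cl y).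
Proof.
move=> C xS yS /andP[xy yx]; have Ex := cs_cl C xS; have Ey := cs_cl C yS.
have succ u z : u \in S -> z \in S -> lay z = (lay u).+1 -> cadj (cl u) (cl z).
  move=> uS zS /(cs_next C zS)/(arr_adj L).
  have lu := cs_lay_lt C uS.
  by rewrite (cs_cl C (cs_in C lu)) (cs_layW C lu) (cs_cl C uS).
case: (ltngtP (lay x) (lay y)) => xyl.
- by apply: succ => //; lia.
- by rewrite cadj_sym; apply: succ => //; lia.
by rewrite Ex Ey xyl cadj_refl.
Qed.

Lemma has_code_ex : (forall x, nzc M (cl x)) -> indecomposable arr S ->
  (forall e W R lay, coil_structure M cl arr S e W R lay -> forall x y, x \in S -> y \in S ->
     x <> W (lay x) -> y <> W (lay y) -> lay y <= lay x + D) ->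
  exists k, has_code k.
Proof.
move=> nzT indS Hwin; have [S0 _] := indS.
case: (ltnP 1 #|S|) => S1; last first.
  have /eqP/cards1P[x Ex] : #|S| = 1 by apply/eqP; rewrite eqn_leq S1 card_gt0.
  by exists (Some (cl x), [ffun=> cl x], (0, 0), [::]); left; exists x.
have [e [W [R [lay C]]]] := coil_structure_ex Hcyc L nzT indS S1.
have [x0 x0S] := set0Pn _ S0.
have [i [iR Hi]] : exists i, i < R /\ forall x, x \in S -> x <> W (lay x) -> i <= lay x <= i + D.
  case: (classic (exists2 x, x \in S & x <> W (lay x))) => [[x xS ex]|nex]; last first.
    exists 0; split; first by have := cs_lay_lt C x0S; lia.
    by move=> x xS ex; case: nex; exists x.
  pose P x := (x \in S) && (x != W (lay x)).
  have Px : P x by rewrite /P xS; apply/eqP.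
  case: (arg_minnP lay Px) => y /andP[yS /eqP ey] ymin.
  exists (lay y); split; first exact: (cs_lay_lt C).
  move=> z zS ez; rewrite ymin /=; first exact: (Hwin _ _ _ _ C).
  by rewrite /P zS; apply/eqP.
have [|||| xs [u mem pw]] := @window_order T lay arr S _ _ _
    [set x in S | i <= lay x <= i + D.+1].
- by move=> x y _ _; apply: (arr_asym L).
- by move=> x y xS yS nxy; apply: (arr_tot L); apply: (near_adj C).
- move=> x y z xS yS zS _ _ nxz xy yz; apply: (arr_trans L xy yz); exact: (near_adj C).
- by apply/subsetP => x; rewrite inE => /andP[].
exists ((None, [ffun j : 'I_l => e (i + j)]), (i, R - i), [seq inord (lay x - i) | x <- xs]).
right; exists e, W, R, lay, i, xs; split=> //; split=> // x.
by rewrite mem inE.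
Qed.

End Structure.

Lemma code_embedding (T T' : finType) (cl : T -> E) (arr : rel T) (cl' : T' -> E) (arr' : rel T')
    (A : {set T}) (B : {set T'}) k k' :
  line_structure cadj cl arr -> line_structure cadj cl' arr' ->
  has_code cl arr A k -> has_code cl' arr' B k' -> code_le k k' ->
  exists g, line_embedding cl arr cl' arr' g A B.
Proof.
move=> L L' [[x [-> Ex]]|HA] [[y [-> Ey]]|HB].
- move=> [[E12 _] _]; exists (fun=> y).
  split=> [z /set1P->|z w /set1P-> /set1P-> xx].
    by rewrite inE; split=> //; move: Ex; rewrite E12 Ey => -[].
  by have := arr_irr x L; rewrite xx.
- move=> [[E12 _] _]; case: HB => [e [W [R [lay [i [xs [_ _ _ _ Ek]]]]]]].
  by move: Ex; rewrite E12 Ek.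
- move=> [[E12 _] _]; case: HA => [e [W [R [lay [i [xs [_ _ _ _ Ek]]]]]]].
  by move: Ey; rewrite -E12 Ek.
case: HA => [e [W [R [lay [i [xs [C iR win [ux mx px] ->]]]]]]].
case: HB => [e' [W' [R' [lay' [i' [ys [C' iR' win' [uy my py] ->]]]]]]].
move=> [[/= [Ee] [/= ii' RR]] /= /semb_eq sub].
have l0 : 0 < l by apply: leq_trans (ncells_gt3 Hcyc).
have eE u : e (i + u) = e' (i' + u).
  have mod_e j : e (i + j) = e (i + j %% l) by apply/(cs_mod C); rewrite modnDmr.
  have mod_e' j : e' (i' + j) = e' (i' + j %% l) by apply/(cs_mod C'); rewrite modnDmr.
  have := congr1 (fun F : {ffun 'I_l -> E} => F (Ordinal (ltn_pmod u l0))) Ee.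
  by rewrite !ffunE /= -mod_e -mod_e'.
have eE' t : e t = e' (t + (i' - i)).
  (* As [t] may lie below [i], a shift by [i] whole turns is added to keep the index
     non-negative. *)
  have il : i <= i * l by rewrite leq_pmulr.
  have per u j : u + j * l = u %[mod l] by rewrite addnC modnMDl.
  have -> : e t = e (i + (t + (i * l - i))).
    by apply/(cs_mod C); rewrite (_ : i + _ = t + i * l) ?per //; lia.
  by rewrite eE; apply/(cs_mod C'); rewrite (_ : i' + _ = t + (i' - i) + i * l) ?per //; lia.
pose inw x := i <= lay x <= i + D.+1.
have [g [gm gi]] := subseq_map_lift (W' 0) sub ux uy.
(* All layers move up by [i' - i]. Window points follow the embedding of words; the remaining points
   are coil points and go to coil points. *)
pose G x := if inw x then g x else W' (lay x + (i' - i)).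
have tR t : t < R -> t + (i' - i) < R' by move=> tR; case: (leqP i t); lia.
have notin x : x \in A -> ~~ inw x -> x = W (lay x).
  move=> xA nw; apply: NNPP => ex; case/negP: nw; have := win x xA ex; rewrite /inw; clear; lia.
have GS x : x \in A -> G x \in B /\ lay' (G x) = lay x + (i' - i).
  move=> xA; rewrite /G; case: (boolP (inw x)) => wx; last first.
    have lt := tR _ (cs_lay_lt C xA).
    by split; [exact: (cs_in C') | exact: (cs_layW C')].
  have xx : x \in xs by rewrite mx xA.
  have [gy Eg] := gm x xx; move: gy; rewrite my => /andP[gB wg]; split=> //.
  have lt1 : lay' (g x) - i' < D.+2 by clear -wg; lia.
  have lt2 : lay x - i < D.+2 by move: wx; rewrite /inw; clear; lia.
  have := congr1 (@nat_of_ord _) Eg; rewrite !inordK //.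
  by move: wx; rewrite /inw; clear -wg ii'; lia.
have GE x : x \in A -> cl' (G x) = cl x.
  by move=> xA; have [gB El] := GS x xA; rewrite (cs_cl C' gB) El -eE' (cs_cl C xA).
exists G; split=> [x xA|x y xA yA xy].
  by split; [case: (GS x xA) | exact: GE].
have [GxB lx] := GS x xA; have [GyB ly] := GS y yA.
have aj := arr_adj L xy; have aj' : cadj (cl' (G x)) (cl' (G y)) by rewrite !GE.
have nex : x <> y by move=> Exy; have := arr_irr x L; rewrite {2}Exy xy.
case: (leqP (lay y).+2 (lay x)) => [far|nfar].
  by apply: (cs_far C') => //; rewrite lx ly -!addSn leq_add2r.
case: (leqP (lay x).+2 (lay y)) => [far|nfar'].
  have yx : arr y x by apply: (cs_far C) => //; rewrite cadj_sym.
  by have := arr_asym L xy; rewrite yx.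
case: (boolP (inw x && inw y)) => [/andP[wx wy]|].
  have xx : x \in xs by rewrite mx xA.
  have yy : y \in xs by rewrite mx yA.
  have nxy : near lay x y by rewrite /near -ltnS nfar -ltnS nfar'.
  have lt : index x xs < index y xs.
    rewrite ltnNge leq_eqVlt; apply/negP => /orP[/eqP H|H].
      by apply: nex; rewrite -(nth_index x xx) -H nth_index.
    have /(pairwiseP x)/(_ (index y xs) (index x xs)) := px.
    by rewrite !inE !index_mem !nth_index // nxy xy => /(_ yy xx H).
  have Gx : G x = g x by rewrite /G wx.
  have Gy : G y = g y by rewrite /G wy.
  have [gxy _] := gm x xx; have [gyy _] := gm y yy.
  have lt' := gi x y xx yy lt; rewrite -Gx in gxy lt'; rewrite -Gy in gyy lt'.
  have /(pairwiseP (G x))/(_ (index (G x) ys) (index (G y) ys)) := py.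
  rewrite !inE !index_mem !nth_index // => /(_ gxy gyy lt').
  have -> /= : near lay' (G y) (G x).
    by rewrite /near lx ly -!addSn !leq_add2r -ltnS nfar' -ltnS nfar.
  have ne : G x != G y by apply: contraTneq lt' => ->; rewrite ltnn.
  by have := arr_tot L' aj' ne => /orP[->|->].
move=> nw.
(* Off-coil points stay within the first [D.+1] layers of the window, which has one layer more. So
   in a pair of consecutive layers that the window does not contain, the lower point is a coil
   point, and so is its image. *)
have nxt u z : u \in A -> z \in A -> ~~ (inw u && inw z) -> lay z = (lay u).+1 ->
    arr u z /\ arr' (G u) (G z).
  move=> uA zA nwu Ez; have [GuB lu] := GS u uA; have [GzB lz] := GS z zA.
  have uW : u = W (lay u).
    case: (boolP (inw u)) => wu; last exact: notin.
    apply: NNPP => eu; have := win u uA eu; move: nwu; rewrite wu /inw; clear -Ez; lia.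
  have GuW : G u = W' (lay u + (i' - i)).
    rewrite -lu; case: (boolP (inw u)) => wu; last by rewrite lu /G (negbTE wu).
    apply: NNPP => eu; have := win' _ GuB eu; move: nwu wu; rewrite /inw; clear -Ez lu ii'; lia.
  split; first by rewrite uW; apply: (cs_next C).
  by rewrite GuW; apply: (cs_next C'); rewrite // lz Ez.
case: (ltngtP (lay x) (lay y)) => lxy.
- have [|//] := nxt x y xA yA nw; clear -nfar' lxy; lia.
- have El : lay x = (lay y).+1 by clear -nfar lxy; lia.
  rewrite andbC in nw; have [yx _] := nxt y x yA xA nw El.
  by have := arr_asym L xy; rewrite yx.
have wE : inw x = inw y by rewrite /inw lxy.
rewrite wE andbb in nw; have := notin x xA; rewrite wE lxy -(notin y yA nw) => /(_ nw).
by move/nex.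
Qed.

End Codes.

(** * Off-coil points in distant layers yield a long end-inflated coil *)

Section GriddedPermutation.
Variables (m n : nat) (M : 'M[int]_(m, n)) (c : 'I_m -> int) (r : 'I_n -> int).
Hypotheses (HM : gridding_matrix M) (Hpm : partial_mult M c r) (Hcyc : rc_is_cycle M).
Notation E := ('I_m * 'I_n)%type.
Notation l := (ncells M).
Variables (p : seq nat) (v h : nat -> nat).
Hypotheses (Hp : is_perm p) (Hg : is_gridding M p v h).
Notation line := (line m n p v h).
Notation T := 'I_(size p).

Definition arrp : rel T := fun x y => arrb c r p v h x y.

Definition cell_of (cl : T -> E) : Prop :=
  forall x : T, [/\ line true x = (cl x).1, line false x = (cl x).2 & nzc M (cl x)].

Lemma cell_of_ex : exists cl, cell_of cl.
Proof.
apply: (@choice_fun T E (fun x d => [/\ line true x = d.1, line false x = d.2 & nzc M d])) => x.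
have [i [j [H1 H2 H3]]] := cell_ex Hp Hg (ltn_ord x).
by exists (i, j).
Qed.

Variable cl : T -> E.
Hypothesis Hcl : cell_of cl.

Lemma share_line b (x y : T) : share b (cl x) (cl y) = (line b x == line b y).
Proof. by have [x1 x2 _] := Hcl x; have [y1 y2 _] := Hcl y; case: b; rewrite ?x1 ?x2 ?y1 ?y2. Qed.

Lemma gridded_line_structure : line_structure (@cadj m n) cl arrp.
Proof.
have adjP x y : cadj (cl x) (cl y) -> exists b, line b x = line b y.
  by move/cadj_share => [b]; rewrite share_line => /eqP; exists b.
have arrE b (x y : T) : line b x = line b y -> arrp x y = ltl c r p v h b x y.
  exact: (arrbE Hpm Hp Hg).
split.
- by move=> x y /arrb_line[b /eqP E]; apply: (@share_cadj _ _ b); rewrite share_line.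
- move=> x y /adjP[b Eb] ne; rewrite (arrE b) // (arrE b y) // /ltl Eb.
  have : raw p b x <> raw p b y by move/(raw_inj Hp (ltn_ord x) (ltn_ord y))/val_inj/eqP; apply/negP.
  by case: ifP; lia.
- move=> x y xy; have [b Eb] := arrb_line xy.
  by move: xy; rewrite (arrE b) // (arrE b y) // /ltl Eb; case: ifP; lia.
move=> x y z xy yz /adjP[b3 E3]; have [b1 E1] := arrb_line xy; have [b2 E2] := arrb_line yz.
have [b [Exy Eyz]] : exists b, line b x = line b y /\ line b y = line b z.
  case: (eqVneq b1 b2) => [E|n12]; first by exists b1; split=> //; rewrite E.
  case: (eqVneq b1 b3) => [E|n13]; first by exists b1; split=> //; rewrite -E1 E.
  have E : b2 = b3 by move: n12 n13; case: (b1); case: (b2); case: (b3).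
  by exists b2; split=> //; rewrite E2 E.
move: xy yz; rewrite (arrE b) // (arrE b y) // (arrE b x z) ?Exy // /ltl Exy Eyz.
by case: ifP; lia.
Qed.

(** A twin [z] of [W j] and the point [y] double the ends of the coil from [W j] to [W (lay y)],
    whose inflation would have more than [B] points. Of the three turns in [3 * l], one accounts for
    [j <= lay x + l], one for [lay z <= j + l], and the last keeps [y] far enough from [z]. *)
Lemma extra_layers B (S : {set T}) e W R lay x y :
  (forall a, end_inflated_coil M c r a -> contains p a -> is_perm a -> size a <= B) ->
  coil_structure M cl arrp S e W R lay -> x \in S -> y \in S ->
  x <> W (lay x) -> y <> W (lay y) -> lay y <= lay x + (B + 3 * l).
Proof.
move=> HB C xS yS ex ey; rewrite leqNgt; apply/negP => far.
have l3 := ncells_gt3 Hcyc.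
have [j [z [[jx zj zS ez Ez] [z1 z2]]]] := cs_twin C xS ex.
have yR := cs_lay_lt C yS; have zR := cs_lay_lt C zS.
pose N := (lay y - j).+1; pose q t : nat := W (j + t).
have jN t : t < N -> j + t < R by rewrite /N; lia.
have jl t : t < N -> lay (W (j + t)) = j + t by move/jN/(cs_layW C).
have jS t : t < N -> W (j + t) \in S by move/jN/(cs_in C).
have jc t : t < N -> cl (W (j + t)) = e (j + t) by move=> lt; rewrite (cs_cl C) ?jl ?jS.
have jy : j + N.-1 = lay y by rewrite /N; lia.
have lN : l < N by rewrite /N; lia.
have l0N : 0 < N by lia.
have l1N : N.-1 < N by lia.
have cy : cl (W (j + N.-1)) = cl y by rewrite jc // jy (cs_cl C).
have cz : cl (W (j + 0)) = cl z by rewrite jc // addn0.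
have line_cl b (u w : T) : cl u = cl w -> line b u = line b w.
  by move=> E; apply/eqP; rewrite -share_line E /share; case: b.
have adj_line b (u w : T) : line b u = line b w -> cadj (cl u) (cl w).
  by move=> E; apply: (@share_cadj _ _ b); rewrite share_line E.
have asymF (u w : T) : arrp u w -> arrp w u = false.
  by move/(arr_asym gridded_line_structure)/negbTE.
have far_z t b : 1 < t -> t < N -> line b (q 0) = line b (q t) ->
    arrp z (W (j + t)) = false /\ arrp (W (j + 0)) (W (j + t)) = false.
  move=> t1 lt /adj_line aj; have jR := jN _ lt; split.
    by apply/asymF/z2; rewrite -?addnS 1?cadj_sym -?cz //; lia.
  by apply/asymF/(cs_far C); [exact: jS | exact: jS | rewrite cadj_sym | rewrite !jl //; clear -t1; lia].
have next_z : arrp z (W (j + 1)) by rewrite addn1; apply: z1; have := jN 1; lia.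
have [a [a1 a2 a3 a4]] : exists a, [/\ end_inflated_coil M c r a, contains p a, is_perm a & size a = N.+2].
  apply: (@inflated_coil_contained m n M c r HM Hpm Hcyc p v h Hp Hg N q (fun t => e (j + t))
    _ _ lN _ _ _ _ _ _ _ _ z y) => //.
  - by move=> t _; apply: ltn_ord.
  - move=> t t' lt lt' /val_inj E.
    by have := jl t lt; rewrite E jl // => /addnI.
  - move=> i k; split=> [/(cs_mod C)/eqP|H]; first by rewrite eqn_modDl => /eqP.
    by apply/(cs_mod C)/eqP; rewrite eqn_modDl H.
  - by move=> i; apply: cs_nz C _.
  (* Adding [j * l - j] cancels the offset [j] modulo [l] without a negative index. *)
  - move=> d /(cs_surj C)[k Ek]; exists (k + (j * l - j)); rewrite -Ek; apply/(cs_mod C).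
    have jj : j <= j * l by rewrite leq_pmulr //; lia.
    by rewrite (_ : j + _ = j * l + k) ?modnMDl //; lia.
  - by move=> t lt; have [-> _ _] := Hcl (W (j + t)); rewrite jc.
  - by move=> t lt; have [_ -> _] := Hcl (W (j + t)); rewrite jc.
  - move=> t lt; have lt' : t < N by lia.
    by rewrite /q addnS; apply: (cs_next C); rewrite -?addnS ?jS ?jl.
  - move=> t lt; have lt' : t < N by lia.
    apply: (cs_far C); rewrite ?jS ?jl //; last by lia.
    have tN : t.+1 < N by lia.
    have -> : cl (W (j + (t + l.+1))) = cl (W (j + t.+1)).
      by rewrite !jc //; apply/(cs_mod C); rewrite addnS addnS addnA -addSn modnDr addnS.
    by rewrite cadj_sym; apply: (arr_adj gridded_line_structure); apply: (cs_next C);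
      rewrite ?jS ?jl ?addnS.
  - apply: (cs_far C); rewrite ?jS ?jl //; last by lia.
    have -> : cl (W (j + l)) = cl (W (j + 0)).
      by rewrite !jc //; apply/(cs_mod C); rewrite addn0 modnDr.
    exact: cadj_refl.
  - by move=> /val_inj E; move: far; rewrite -E; lia.
  - by move=> t lt /val_inj E; apply: ez; rewrite E jl.
  - by move=> t lt /val_inj E; apply: ey; rewrite E jl.
  - by move=> b; apply: line_cl.
  - by move=> b; apply: line_cl.
  - move=> t b /andP[t0 lt] Eb; case: (ltnP 1 t) => t1.
      by have [H1 H2] := far_z t b t1 lt Eb; rewrite /arrp in H1 H2; rewrite /q H1 H2.
    have {t0 t1}Et : t = 1 by lia.
    rewrite Et in lt *; have w1 : arrp (W (j + 0)) (W (j + 1)).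
      by rewrite addn0; apply: (cs_next C); rewrite ?jS ?jl ?addn1.
    by rewrite -[LHS]/(arrp z (W (j + 1))) -[RHS]/(arrp (W (j + 0)) (W (j + 1))) next_z w1.
  - move=> t b lt Eb; have lt' : t < N by lia.
    rewrite -[LHS]/(arrp y (W (j + t))) -[RHS]/(arrp (W (j + N.-1)) (W (j + t))).
    have aj := adj_line _ _ _ Eb.
    case: (leqP (j + t).+2 (lay y)) => H.
      have H1 : arrp y (W (j + t)) by apply: (cs_far C); rewrite ?jS ?jl -?cy.
      have H2 : arrp (W (j + N.-1)) (W (j + t)).
        by apply: (cs_far C) => //; rewrite ?jS // !jl // jy.
      by rewrite H1 H2.
    have Et : lay y = (j + t).+1 by lia.
    have H1 : arrp (W (j + t)) y by apply: (cs_next C).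
    have H2 : arrp (W (j + t)) (W (j + N.-1)) by apply: (cs_next C); rewrite ?jS ?jl ?jy.
    by rewrite (asymF _ _ H1) (asymF _ _ H2).
  move=> b /adj_line; rewrite cz cy => aj.
  have H1 : arrp y z by apply: (cs_far C); rewrite // 1?cadj_sym //; clear -zj jx far l3; lia.
  have H2 : arrp y (W (j + 0)).
    by apply: (cs_far C); rewrite ?jS ?jl // ?cz 1?cadj_sym //; clear -jx far l3; lia.
  by rewrite -[LHS]/(arrp z y) -[RHS]/(arrp (W (j + 0)) y) (asymF _ _ H1) (asymF _ _ H2).
have := HB a a1 a2 a3; rewrite a4 /N; lia.
Qed.

End GriddedPermutation.

(** * The backward direction *)

Section FinitelyManyCoils.
Variables (m n : nat) (M : 'M[int]_(m, n)) (c : 'I_m -> int) (r : 'I_n -> int).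
Hypotheses (HM : gridding_matrix M) (Hpm : partial_mult M c r) (Hcyc : rc_is_cycle M).
Notation E := ('I_m * 'I_n)%type.

(** Between adjacent cells arrows are total and asymmetric, so a map that preserves them also
    reflects them. Within a line they give the order of coordinates; between different lines the
    preserved cells give it. *)
Lemma line_embedding_contains p v h cl p' v' h' cl' (g : 'I_(size p) -> 'I_(size p')) :
  is_perm p -> is_gridding M p v h -> is_perm p' -> is_gridding M p' v' h' ->
  @cell_of m n M p v h cl -> @cell_of m n M p' v' h' cl' ->
  (forall x, cl' (g x) = cl x) ->
  (forall x y, arrp c r v h x y -> arrp c r v' h' (g x) (g y)) -> contains p' p.
Proof.
move=> Hp Hg Hp' Hg' Hcl Hcl' gcl garr.
have L := gridded_line_structure Hpm Hp Hg Hcl.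
have L' := gridded_line_structure Hpm Hp' Hg' Hcl'.
have lineE b x : line m n p' v' h' b (g x) = line m n p v h b x.
  have [x1 x2 _] := Hcl x; have [y1 y2 _] := Hcl' (g x).
  by case: b; rewrite ?x1 ?y1 ?x2 ?y2 gcl.
have key b (x y : 'I_(size p)) : (raw p b x < raw p b y) = (raw p' b (g x) < raw p' b (g y)).
  case: (eqVneq x y) => [->|ne]; first by rewrite !ltnn.
  have nev : nat_of_ord x <> y by move/val_inj/eqP; apply/negP.
  case: (eqVneq (line m n p v h b x) (line m n p v h b y)) => [El|/eqP nl]; last first.
    have nl' : line m n p' v' h' b (g x) <> line m n p' v' h' b (g y) by rewrite !lineE.
    by rewrite (raw_lines Hp Hg) // (raw_lines Hp' Hg') // !lineE.
  have aj : cadj (cl x) (cl y) by apply: (@share_cadj _ _ b); rewrite (share_line Hcl) El.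
  have neg : nat_of_ord (g x) <> g y.
    move=> /val_inj Eg; have := arr_tot L aj ne.
    by case/orP => /garr; rewrite Eg; apply/negP/(arr_irr _ L').
  rewrite (raw_same_line Hpm Hp Hg) // (raw_same_line Hpm Hp' Hg') ?lineE //.
  congr (_ == _); rewrite -[LHS]/(arrp c r v h x y) -[RHS]/(arrp c r v' h' (g x) (g y)).
  apply/idP/idP => [|gxy]; first exact: garr.
  have := arr_tot L aj ne => /orP[//|/garr gyx].
  by have := arr_asym L' gxy; rewrite gyx.
pose G x := oapp (fun u : 'I_(size p) => nat_of_ord (g u)) 0 (insub x).
have GE (u : 'I_(size p)) : G u = g u by rewrite /G valK.
apply: (@embeds_contains G); split=> [x lx|x y lx ly].
  by rewrite -[x]/(nat_of_ord (Ordinal lx)) GE.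
have [Gx Gy] := (GE (Ordinal lx), GE (Ordinal ly)); rewrite [G x]Gx [G y]Gy.
by split; [exact: (key true (Ordinal lx) (Ordinal ly)) | exact: (key false (Ordinal lx) (Ordinal ly))].
Qed.

Lemma finitely_many_wqo (C : seq nat -> Prop) : perm_class C -> (forall p, C p -> in_Grid M p) ->
  finitely_many C (end_inflated_coil M c r) -> wqo C.
Proof.
move=> [_ Cclosed] CG [ll Hll].
pose B := \max_(a <- ll) size a; pose D := B + 3 * ncells M.
have HB p : C p -> forall a, end_inflated_coil M c r a -> contains p a -> is_perm a -> size a <= B.
  by move=> Cp a Ea pa Ha; apply: leq_bigmax_seq => //; apply: Hll => //; apply: Cclosed pa.
pose coding p (ks : seq (code M D)) := exists vh : (nat -> nat) * (nat -> nat),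
    exists cl : 'I_(size p) -> E, exists ls : seq {set 'I_(size p)},
    [/\ is_perm p /\ is_gridding M p vh.1 vh.2, @cell_of m n M p vh.1 vh.2 cl,
        forall x, exists2 A, A \in ls & x \in A,
        pairwise (forward (@cadj m n) cl (arrp c r vh.1 vh.2)) ls &
        coded (has_code cl (arrp c r vh.1 vh.2)) ls ks].
have coding_ex p : C p -> exists ks, coding p ks.
  move=> Cp; have [Hp [v [h Hg]]] := CG p Cp; have [cl Hcl] := cell_of_ex Hp Hg.
  have L := gridded_line_structure Hpm Hp Hg Hcl.
  have [ls [cov pw ind]] := decomposition setT L.
  have [|ks Hks] := @coded_ex _ (code M D) (has_code cl (arrp c r v h)) ls.
    move=> A /ind indA; apply: has_code_ex => //.
      by move=> x; have [] := Hcl x.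
    move=> e W R lay Hcs x y xA yA ex ey.
    exact: (extra_layers HM Hpm Hcyc Hp Hg Hcl (HB p Cp) Hcs xA yA ex ey).
  exists ks, (v, h), cl, ls; split=> // x.
  by apply/cov; rewrite inE.
move=> f Cf.
(* The empty permutation is handled apart, because assembling the embedding takes a default point in
   the target. *)
case: (classic (exists i, size (f i) = 0)) => [[i /size0nil Ei]|ne0].
  by exists i, i.+1; split=> //; rewrite Ei; exists [::]; split.
have f0 i : 0 < size (f i) by rewrite lt0n; apply/eqP => Ei; apply: ne0; exists i.
have [ks Hks] := choice_fun (fun i => coding_ex _ (Cf i)).
have [i [j [ij Rij]]] := higman (@code_le_wqo m n M D) (@code_le_trans m n M D) ks.
exists i, j; split=> //.
have [vh [cl [ls [[Hp Hg] Hcl cov pw Hc]]]] := Hks i.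
have [vh' [cl' [ls' [[Hp' Hg'] Hcl' _ pw' Hc']]]] := Hks j.
have L := gridded_line_structure Hpm Hp Hg Hcl.
have L' := gridded_line_structure Hpm Hp' Hg' Hcl'.
have [g [g1 g2]] := semb_embedding (@cadj_refl m n) (@cadj_sym m n) (Ordinal (f0 j)) L L'
  (fun A B' k k' => @code_embedding _ _ M Hcyc D _ _ cl _ cl' _ A B' k k' L L') Hc Hc' Rij pw pw'.
apply: (line_embedding_contains Hp Hg Hp' Hg' Hcl Hcl' (g := g)).
  by move=> x; have [A lA xA] := cov x; have [] := g1 A x lA xA.
move=> x y; have [A lA xA] := cov x; have [A' lA' yA'] := cov y.
exact: g2 lA lA' xA yA'.
Qed.

End FinitelyManyCoils.

Theorem theorem6p5 (m n : nat) (M : 'M[int]_(m, n))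
    (c : 'I_m -> int) (r : 'I_n -> int) (C : seq nat -> Prop) :
  gridding_matrix M -> partial_mult M c r -> rc_is_cycle M ->
  perm_class C -> (forall p, C p -> in_Grid M p) ->
  (wqo C <-> finitely_many C (end_inflated_coil M c r)).
Proof.
move=> HM Hpm Hcyc HC CG; split; first exact: wqo_finitely_many.
exact: finitely_many_wqo.
Qed.
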